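(* There is an algorithm which, given a finite idempotent algebra $\mathbf{A}$ (as a list of tables of its basic operations), runs in time bounded by a polynomial in $\|\mathbf{A}\|$ and either correctly outputs that $\mathbf{A}$ has no Maltsev term operation, or outputs a circuit (in the language of $\mathbf{A}$) computing some Maltsev term operation of $\mathbf{A}$.
   Context: The input algebra is given as a finite, nonempty list of tables of its basic operations, none of which are nullary. Its size is $\|\mathbf{A}\|=\sum_{i\ge1}k_i|A|^i$, where $k_i$ is the number of $i$-ary basic operations. A ternary term operation $p$ of $\mathbf{A}$ is a Maltsev term operation if $p(x,x,y)=p(y,x,x)=y$ for all $x,y\in A$. An algebra is idempotent if every basic operation $f$ satisfies $f(x,\dots,x)\approx x$. An $n$-ary circuit in the language of $\mathbf{A}$ is a finite directed acyclic graph (multiple edges allowed) with two kinds of vertices: exactly $n$ inputs, labeled $x_1,\dots,x_n$, each a source, and gates, each labeled by an operation symbol of $\mathbf{A}$, whose in-degree equals the arity of that symbol and whose in-edges are ordered; one vertex is designated as the output. Its size is its number of vertices. On an input tuple $(a_1,\dots,a_n)$, the value at input $x_i$ is $a_i$, the value at a gate labeled $g$ is $g^{\mathbf{A}}$ applied to the values of its in-neighbours in order, and the circuit's value is the value at the output vertex; the circuit thereby computes a term operation of $\mathbf{A}$. *)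

(* Defs.v *)
From mathcomp Require Import all_boot.
Set Implicit Arguments. Unset Strict Implicit. Unset Printing Implicit Defensive.

(* Universe A = {0, ..., n-1}.  Each basic operation is a pair         *)
(* (arity k, table f) where only the values of f on sequences in       *)
(* {0..n-1}^k matter.                                                   *)
Record alg := Alg { univ_size : nat; ops : seq (nat * (seq nat -> nat)) }.

Definition op_default : nat * (seq nat -> nat) := (0, fun _ => 0).
Definition arity (A : alg) (j : nat) : nat := (nth op_default (ops A) j).1.
Definition opf (A : alg) (j : nat) : seq nat -> nat := (nth op_default (ops A) j).2.

Fixpoint all_tuples (n k : nat) : seq (seq nat) :=
  if k is k'.+1 then
    flatten [seq [seq i :: t | t <- all_tuples n k'] | i <- iota 0 n]
  else [:: [::]].

Definition alg_ok (A : alg) : Prop :=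
  0 < univ_size A /\ 0 < size (ops A) /\
  forall j, j < size (ops A) -> 0 < arity A j /\
    forall t, t \in all_tuples (univ_size A) (arity A j) -> opf A j t < univ_size A.

Definition alg_idempotent (A : alg) : Prop :=
  forall j, j < size (ops A) ->
    forall x, x < univ_size A -> opf A j (nseq (arity A j) x) = x.

(* ||A|| = sum_i k_i |A|^i = sum over basic operations of |A|^(arity) *)
Definition alg_size (A : alg) : nat :=
  sumn [seq univ_size A ^ op.1 | op <- ops A].

Inductive term := Var of nat | App of nat & seq term.

Fixpoint term_wf (A : alg) (m : nat) (t : term) : bool :=
  match t with
  | Var i => i < m
  | App j ts => [&& j < size (ops A), size ts == arity A j &
                    all (term_wf A m) ts]
  end.

Fixpoint teval (A : alg) (env : seq nat) (t : term) : nat :=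
  match t with
  | Var i => nth 0 env i
  | App j ts => opf A j (map (teval A env) ts)
  end.

Definition is_maltsev_fun (A : alg) (p : nat -> nat -> nat -> nat) : Prop :=
  forall x y, x < univ_size A -> y < univ_size A ->
    p x x y = y /\ p y x x = y.

Definition has_maltsev (A : alg) : Prop :=
  exists t, term_wf A 3 t /\
    is_maltsev_fun A (fun x y z => teval A [:: x; y; z] t).

(* Circuits: a DAG listed in a topological order.  Vertex number p is  *)
(* either an input x_(i+1) (VIn i) or a gate labelled by the basic     *)
(* operation j whose ordered in-neighbours are the earlier vertices    *)
(* listed in args (repetitions = multiple edges).                      *)
Inductive vertex := VIn of nat | VGate of nat & seq nat.
Record circuit := Circ { verts : seq vertex; out : nat }.

Definition is_input (i : nat) (v : vertex) : bool :=
  if v is VIn i' then i' == i else false.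

Definition vertex_ok (A : alg) (m p : nat) (v : vertex) : bool :=
  match v with
  | VIn i => i < m
  | VGate j args => [&& j < size (ops A), size args == arity A j &
                        all (fun a => a < p) args]
  end.

Definition circuit_ok (A : alg) (m : nat) (C : circuit) : Prop :=
  (forall p, p < size (verts C) -> vertex_ok A m p (nth (VIn 0) (verts C) p)) /\
  (forall i, i < m -> count (is_input i) (verts C) = 1) /\
  out C < size (verts C).

Definition vertex_value (A : alg) (env vals : seq nat) (v : vertex) : nat :=
  match v with
  | VIn i => nth 0 env i
  | VGate j args => opf A j (map (nth 0 vals) args)
  end.

Definition circuit_eval (A : alg) (C : circuit) (env : seq nat) : nat :=
  nth 0 (foldl (fun vals v => rcons vals (vertex_value A env vals v))
               [::] (verts C)) (out C).

Inductive sym := Blank | Zero | One | Sep.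
Inductive move := MoveL | MoveR | Stay.

Record TM := MkTM {
  state : finType;
  q_start : state;
  q_halt : state -> bool;
  delta : state -> sym -> state * sym * move }.

(* configuration: state, reversed left part, scanned symbol, right part *)
Definition config (M : TM) := (state M * seq sym * sym * seq sym)%type.

Definition step (M : TM) (c : config M) : config M :=
  let: (q, l, a, r) := c in
  if @q_halt M q then c else
  let: (q', b, mv) := @delta M q a in
  match mv with
  | MoveL => match l with
             | [::] => (q', [::], Blank, b :: r)
             | x :: l' => (q', l', x, b :: r) end
  | MoveR => match r with
             | [::] => (q', b :: l, Blank, [::])
             | x :: r' => (q', b :: l, x, r') end
  | Stay => (q', l, b, r)
  end.

Definition run (M : TM) (t : nat) (c : config M) : config M := iter t (@step M) c.

Definition init (M : TM) (w : seq sym) : config M :=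
  match w with
  | [::] => (@q_start M, [::], Blank, [::])
  | x :: w' => (@q_start M, [::], x, w')
  end.

Definition halted (M : TM) (c : config M) : bool := @q_halt M c.1.1.1.

Fixpoint upto_blank (s : seq sym) : seq sym :=
  match s with
  | [::] => [::]
  | Blank :: _ => [::]
  | x :: s' => x :: upto_blank s'
  end.

Definition output (M : TM) (c : config M) : seq sym :=
  let: (_, _, a, r) := c in upto_blank (a :: r).

Definition enc_nat (m : nat) : seq sym := rcons (nseq m One) Sep.

Definition enc_alg (A : alg) : seq sym :=
  enc_nat (univ_size A) ++ enc_nat (size (ops A)) ++
  flatten [seq enc_nat op.1 ++
               flatten [seq enc_nat (op.2 t) | t <- all_tuples (univ_size A) op.1]
          | op <- ops A].

Definition enc_vertex (v : vertex) : seq sym :=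
  match v with
  | VIn i => Zero :: enc_nat i
  | VGate j args => One :: enc_nat j ++ enc_nat (size args) ++
                    flatten (map enc_nat args)
  end.

Definition enc_circuit (C : circuit) : seq sym :=
  enc_nat (size (verts C)) ++ enc_nat (out C) ++ flatten (map enc_vertex (verts C)).

Definition answer_no : seq sym := [:: Zero].
Definition answer_circuit (C : circuit) : seq sym := One :: enc_circuit C.

(* Main.v *)
From HB Require Import structures.
Require Import Defs.
From mathcomp Require Import all_boot zify.
Set Implicit Arguments. Unset Strict Implicit. Unset Printing Implicit Defensive.

(* Local-to-global construction.  Let [A] be idempotent.  For given
   [a, e0, e, d], closing [(a,e), (e0,e), (e0,d)] under the operations of [A^2]
   either yields a term [l] with [l(a,e0,e0) = a] and [l(e,e,d) = d] or misses
   [(a,d)], and then [A] has no Maltsev term, since that would be such an [l].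
   Suppose that it never misses.  Start from [t = z], which
   satisfies [t(y,y,z) = z], and treat the pairs [(a,b)] one after the other.
   With [e0 = t(a,b,b)], a term [s] such that [s(a,e0,e0) = a] and [s(c,c,d) = d]
   for all [c, d] makes [s(x, t(x,y,y), t(x,y,z))] a term that keeps what [t]
   satisfies and in addition sends [(a,b,b)] to [a].  The term [s] is built
   likewise, one pair [(c,d)] at a time: with [e = s(c,c,d)], replace [s] by
   [l(s(x,y,z), s(y,y,z), z)].  Idempotence preserves the equations already
   obtained.  To keep the circuit polynomial one carries along the vertices of
   [t(x,y,z)], [t(x,y,y)], and of [s(x,W,T)], [s(W,W,T)], [s(x,W,W)] for
   [T = t(x,y,z)], [W = t(x,y,y)]: each new element of a closure then costs three
   gates.

   On the machine side, strings over the nonblank symbols separated by blanks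
   serve as registers; the class [PT] of functions on encoded data that are
   computed by register programs in polynomial time is closed under composition,
   pairing, conditionals and size-bounded folds, so the algorithm can be written
   as a Rocq function. *)

(** * Turing machine fragments *)

(** The substitutions into [t] and [s] cannot be carried out literally: a gate list computes [s]
    only at the arguments for which it was made, and copying it for other arguments would multiply
    its length at each of the |A|^4 inner steps. The three vertices kept for [s] are chosen so that
    one application of [l] updates all of them: s(x,W,T) becomes l(s(x,W,T), s(W,W,T), T), s(W,W,T)
    becomes l(s(W,W,T), s(W,W,T), T), and s(x,W,W) becomes l(s(x,W,W), W, W), because s(W,W,W) = W
    by idempotence. The last one is kept since it is the next t(x,y,y). A closure is computed over
    pairs of table rows of one operation, not over tuples of closure elements: such a pair is one
    instance of the operation in A^2, so a pass makes quadratically many tests in the table size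
    whatever the arities are. Membership in [PT] requires a polynomial bound on all inputs, so the
    size bounds are proved without assuming that the input describes an algebra. *)

Definition sym_bits (a : sym) : bool * bool :=
  match a with
  | Blank => (false, false) | Zero => (false, true)
  | One => (true, false) | Sep => (true, true)
  end.
Definition bits_sym (b : bool * bool) : sym :=
  match b with
  | (false, false) => Blank | (false, true) => Zero
  | (true, false) => One | (true, true) => Sep
  end.
Lemma sym_bitsK : cancel sym_bits bits_sym. Proof. by case. Qed.
HB.instance Definition _ := Finite.copy sym (can_type sym_bitsK).

(** Named exits replace halting states: [bind] and [loop] redirect an exit to the start of another
    fragment, at no extra step. *)
Record frag (E : Type) := Frag {
  fstate : finType;
  fstart : fstate;
  fdelta : fstate -> sym -> (fstate + E) * sym * move }.

Definition tape := (seq sym * sym * seq sym)%type.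

Definition tape_step (b : sym) (mv : move) (tp : tape) : tape :=
  let: (l, _, r) := tp in
  match mv with
  | MoveL => if l is x :: l' then (l', x, b :: r) else ([::], Blank, b :: r)
  | MoveR => if r is x :: r' then (b :: l, x, r') else (b :: l, Blank, [::])
  | Stay => (l, b, r)
  end.

(* The step count is only an upper bound. *)
Inductive reach E (M : frag E) : fstate M -> tape -> nat -> E -> tape -> Prop :=
| ReachExit q tp n e b mv : fdelta q tp.1.2 = (inr e, b, mv) ->
    reach q tp n.+1 e (tape_step b mv tp)
| ReachStep q tp n e tp' q' b mv : fdelta q tp.1.2 = (inl q', b, mv) ->
    reach q' (tape_step b mv tp) n e tp' -> reach q tp n.+1 e tp'.

Definition runs E (M : frag E) tp n e tp' := reach (fstart M) tp n e tp'.

Lemma reach_le E (M : frag E) q tp n m e tp' :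
  n <= m -> @reach _ M q tp n e tp' -> @reach _ M q tp m e tp'.
Proof.
move=> le_nm H; elim: H m le_nm => {q tp n e tp'}.
  by move=> q tp n e b mv H [//|m] _; apply: ReachExit.
by move=> q tp n e tp' q' b mv H _ IH [//|m] le; apply: (ReachStep H); apply: IH.
Qed.

Lemma runs_le E (M : frag E) tp n m e tp' :
  n <= m -> runs M tp n e tp' -> runs M tp m e tp'.
Proof. exact: reach_le. Qed.

Section Bind.
Variables (E : finType) (F : Type) (M : frag E) (N : E -> frag F).
Definition bind_delta (q : fstate M + {e : E & fstate (N e)}) (a : sym) :
    ((fstate M + {e : E & fstate (N e)}) + F) * sym * move :=
  match q with
  | inl q => let: (r, b, mv) := fdelta q a in
      (inl (match r with
            | inl q' => inl q'
            | inr e => inr (Tagged (fun e => fstate (N e)) (fstart (N e)))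
            end), b, mv)
  | inr q => let: (r, b, mv) := fdelta (tagged q) a in
      (match r with
       | inl q' => inl (inr (Tagged (fun e => fstate (N e)) q'))
       | inr e => inr e
       end, b, mv)
  end.
Definition bind := @Frag F (fstate M + {e : E & fstate (N e)})%type
  (inl (fstart M)) bind_delta.

Lemma bind_runs tp n m e f tp1 tp2 :
  runs M tp n e tp1 -> runs (N e) tp1 m f tp2 -> runs bind tp (n + m) f tp2.
Proof.
have R q t k g t' : @reach _ (N e) q t k g t' ->
    @reach _ bind (inr (Tagged (fun e => fstate (N e)) q)) t k g t'.
  elim=> {q t k g t'} [q t k g b mv H|q t k g t' q' b mv H _ IH].
    by apply: ReachExit; rewrite /= H.
  by apply: ReachStep IH; rewrite /= H.
rewrite /runs /=; move: (fstart M) => q H.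
elim: H => {q tp n tp1} [q tp n e' b mv H|q tp n e' tp1 q' b mv H _ IH] in R *;
  rewrite addSn => H2.
  by apply: ReachStep; [rewrite /= H | apply: reach_le (R _ _ _ _ _ H2); rewrite leq_addl].
by apply: (@ReachStep _ bind _ _ _ _ _ (inl q') b mv); [rewrite /= H | apply: IH].
Qed.
End Bind.

Section Loop.
Variables (S : finType) (E : Type) (B : S -> frag (S + E)).
Definition loop_delta (q : {s : S & fstate (B s)}) (a : sym) :
    ({s : S & fstate (B s)} + E) * sym * move :=
  let: (r, b, mv) := fdelta (tagged q) a in
  (match r with
   | inl q' => inl (Tagged (fun s => fstate (B s)) q')
   | inr (inl s) => inl (Tagged (fun s => fstate (B s)) (fstart (B s)))
   | inr (inr e) => inr e
   end, b, mv).
(** The index [s] is finite memory carried from one round to the next, such as the symbol in transit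
    in [shl] and [shr]. *)
Definition loop s := @Frag E {s : S & fstate (B s)}
  (Tagged (fun s => fstate (B s)) (fstart (B s))) loop_delta.

Lemma loop_stop s tp n e tp' :
  runs (B s) tp n (inr e) tp' -> runs (loop s) tp n e tp'.
Proof.
rewrite /runs /=; move: (fstart (B s)) => q; move Ee: (inr e) => ee H.
elim: H Ee => {q tp n ee tp'} [q tp n e' b mv H|q tp n e' tp1 q' b mv H _ IH] Ee.
  by apply: ReachExit; rewrite /= /loop_delta H -Ee.
by apply: (@ReachStep _ (loop _) _ _ _ _ _ (Tagged (fun s => fstate (B s)) q') b mv);
  [rewrite /= /loop_delta H | apply: IH].
Qed.

Lemma loop_shift s s' q tp n e tp' :
  @reach _ (loop s') q tp n e tp' -> @reach _ (loop s) q tp n e tp'.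
Proof.
elim=> {q tp n e tp'} [q tp n e b mv H|q tp n e tp' q' b mv H _ IH].
  by apply: ReachExit; apply: H.
by apply: ReachStep IH; apply: H.
Qed.

Lemma loop_next s s' tp n m e tp1 tp2 :
  runs (B s) tp n (inl s') tp1 -> runs (loop s') tp1 m e tp2 ->
  runs (loop s) tp (n + m) e tp2.
Proof.
rewrite /runs /=; move: (fstart (B s)) => q; move Ee: (inl s') => ee H.
elim: H Ee => {q tp n ee tp1} [q tp n e' b mv H|q tp n e' tp1 q' b mv H _ IH] Ee H2.
  apply: (@ReachStep _ (loop _) _ _ _ _ _ (Tagged (fun s => fstate (B s)) (fstart (B s'))) b mv).
    by rewrite /= /loop_delta H -Ee.
  by apply: reach_le (loop_shift _ H2); rewrite leq_addl.
by apply: (@ReachStep _ (loop _) _ _ _ _ _ (Tagged (fun s => fstate (B s)) q') b mv);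
  [rewrite /= /loop_delta H | apply: IH].
Qed.
End Loop.

Definition prim E (f : sym -> E * sym * move) : frag E :=
  @Frag E unit tt (fun _ a => let: (e, b, mv) := f a in (inr e, b, mv)).

Lemma prim_runs E (f : sym -> E * sym * move) tp n :
  runs (prim f) tp n.+1 (f tp.1.2).1.1
    (tape_step (f tp.1.2).1.2 (f tp.1.2).2 tp).
Proof. by apply: ReachExit => /=; case: (f _) => [[e b] mv]. Qed.

Definition mk (L R : seq sym) : tape := (L, head Blank R, behead R).

Lemma mk_right b L R : tape_step b MoveR (mk L R) = mk (b :: L) (behead R).
Proof. by case: R => [|? [|? ?]]. Qed.
Lemma mk_left b L R :
  tape_step b MoveL (mk L R) = mk (behead L) (head Blank L :: b :: behead R).
Proof. by case: L. Qed.
Lemma prim_mk E (f : sym -> E * sym * move) L R e b mv tp n :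
  f (head Blank R) = (e, b, mv) -> tape_step b mv (mk L R) = tp ->
  runs (prim f) (mk L R) n.+1 e tp.
Proof. by move=> H <-; have := prim_runs f (mk L R) n; rewrite /= H. Qed.

(** * Registers on the tape *)

(* The tape [mk X R] after one move to the left. *)
Definition mkl (X R : seq sym) : tape := mk (behead X) (head Blank X :: R).

(** Every register, even an empty one, is closed by one blank. A blank also precedes the first
    register, which stops the walk back. *)
Definition jn (rs : seq (seq sym)) := flatten [seq rcons r Blank | r <- rs].

Lemma jn_cons r rs : jn (r :: rs) = r ++ Blank :: jn rs.
Proof. by rewrite /jn /= cat_rcons. Qed.
Lemma jn_cat rs1 rs2 : jn (rs1 ++ rs2) = jn rs1 ++ jn rs2.
Proof. by rewrite /jn map_cat flatten_cat. Qed.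
Lemma jn_rcons rs r : jn (rcons rs r) = jn rs ++ rcons r Blank.
Proof. by rewrite -cats1 jn_cat jn_cons -cats1. Qed.
Lemma size_jn_cons r rs : size (jn (r :: rs)) = (size r).+1 + size (jn rs).
Proof. by rewrite jn_cons size_cat /= addnS. Qed.
Definition nonblank (r : seq sym) := Blank \notin r.

Definition ret E (e : E) : frag E := prim (fun a => (e, a, Stay)).
Definition goR : frag unit := prim (fun a => (tt, a, MoveR)).
Definition goL : frag unit := prim (fun a => (tt, a, MoveL)).
Definition readL : frag sym := prim (fun a => (a, a, MoveL)).
Definition put (x : sym) mv : frag unit := prim (fun _ => (tt, x, mv)).

Notation "'do' x <- M ; N" := (bind M (fun x => N))
  (at level 200, x name, M at level 100, N at level 200).

Definition skip1 : frag unit := loop (fun _ : unit => prim (fun a =>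
  if a is Blank then (inr tt, Blank, MoveR) else (inl tt, a, MoveR))) tt.
Fixpoint skips i : frag unit :=
  if i is i'.+1 then do _ <- skip1; skips i' else ret tt.

Definition back1 : frag unit := do _ <- goL; loop (fun _ : unit => prim (fun a =>
  if a is Blank then (inr tt, Blank, Stay) else (inl tt, a, MoveL))) tt.
Fixpoint backs i : frag unit :=
  if i is i'.+1 then do _ <- back1; backs i' else ret tt.

(** Moves a register by one cell while walking from its right end to its left end: the symbol
    carried is written where the next one is picked up. *)
Definition shl : sym -> frag sym := loop (fun y : sym => prim (fun a =>
  if a is Blank then (inr y, Blank, Stay) else (inl a, y, MoveL))).
Fixpoint shiftL i x : frag unit :=
  if i is i'.+1 then do _ <- put x MoveL; do y <- shl Blank; shiftL i' y
  else put x Stay.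

Definition shr : sym -> frag sym := loop (fun y : sym => prim (fun a =>
  if a is Blank then (inr y, Blank, Stay) else (inl a, y, MoveR))).
Fixpoint shiftR i x : frag unit :=
  if i is i'.+1 then do y <- shr x; do _ <- put y MoveR; shiftR i' Blank
  else put x Stay.

(** The top of a register is its left end. A push therefore moves only the registers in front of it,
    one cell to the left, and a pop moves them back. The start of register 0 drifts, which is why
    [homed] leaves the number of blanks open. *)
Definition pushF i x : frag unit := do _ <- skips i; do _ <- goL; shiftL i x.
Definition popF i : frag sym :=
  do _ <- skips i; do a <- readL; do _ <- backs i; do _ <- goR;
  if a is Blank then ret Blank else
  do _ <- shiftR i Blank; do _ <- backs i; do _ <- goR; ret a.

Lemma ret_runs E (e : E) L R n : runs (ret e) (mk L R) n.+1 e (mk L R).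
Proof. by apply: prim_mk. Qed.

Lemma goR_runs L R n : runs goR (mk L R) n.+1 tt (mk (head Blank R :: L) (behead R)).
Proof. by apply: prim_mk; rewrite // mk_right. Qed.

Lemma goL_runs L R n : runs goL (mk L R) n.+1 tt (mkl L (head Blank R :: behead R)).
Proof. by apply: prim_mk; rewrite // mk_left. Qed.

Lemma readL_runs L a R n : runs readL (mk L (a :: R)) n.+1 a (mkl L (a :: R)).
Proof. by apply: prim_mk; rewrite // mk_left. Qed.

Lemma nonblank_cons a r : nonblank (a :: r) = (a != Blank) && nonblank r.
Proof. by rewrite /nonblank in_cons negb_or eq_sym. Qed.
Lemma nonblank_rcons a r : nonblank (rcons r a) = (a != Blank) && nonblank r.
Proof. by rewrite /nonblank mem_rcons in_cons negb_or eq_sym. Qed.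

Lemma skip1_runs r L R : nonblank r -> head Blank R = Blank ->
  runs skip1 (mk L (r ++ R)) (size r).+1 tt (mk (Blank :: rev r ++ L) (behead R)).
Proof.
move=> nbr hR; elim: r L nbr => [|a r IH] L.
  by move=> _; apply: loop_stop; apply: (@prim_mk _ _ _ _ _ Blank MoveR); rewrite ?mk_right //= hR.
rewrite nonblank_cons => /andP[na nbr].
rewrite /= -add1n; apply: (@loop_next _ _ _ tt tt _ _ _ _ (mk (a :: L) (r ++ R))).
  by apply: (@prim_mk _ _ _ _ _ a MoveR); rewrite ?mk_right //=; case: (a) na.
by rewrite rev_cons cat_rcons; apply: IH.
Qed.

Lemma skips_runs rs L R : R != [::] -> all nonblank rs ->
  runs (skips (size rs)) (mk L (jn rs ++ R)) (size (jn rs)).+1 tt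
    (mk (rev (jn rs) ++ L) R).
Proof.
case: R => // b R _; elim: rs L => [|r rs IH] L /=; first by move=> _; apply: ret_runs.
case/andP=> nbr nbrs; rewrite size_jn_cons -addnS.
rewrite jn_cons rev_cat rev_cons -catA cat_rcons -catA cat_cons.
by apply: bind_runs (IH _ nbrs); apply: (@skip1_runs r L (Blank :: _)).
Qed.

Lemma back1_runs r L b R : nonblank r -> head Blank L = Blank ->
  runs back1 (mk (rev r ++ L) (b :: R)) (size r).+2 tt
    (mkl L (r ++ b :: R)).
Proof.
move=> nbr hL; rewrite /back1 -add1n; apply: bind_runs; first exact: goL_runs.
rewrite /=; elim/last_ind: r nbr (b :: R) => {b R} [|r a IH] nbr R.
  rewrite /mkl hL; apply: loop_stop.
  by apply: (@prim_mk _ _ _ _ _ Blank Stay).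
move: nbr; rewrite nonblank_rcons => /andP[na nbr].
rewrite rev_rcons size_rcons -add1n.
apply: (@loop_next _ _ _ tt tt _ _ _ _ (mkl (rev r ++ L) (a :: R))).
  by apply: (@prim_mk _ _ _ _ _ a MoveL); rewrite ?mk_left //=; case: (a) na.
by rewrite cat_rcons; apply: IH.
Qed.

Lemma head_rev_jn rs L : head Blank L = Blank -> head Blank (rev (jn rs) ++ L) = Blank.
Proof. by case/lastP: rs => [|rs r] //; rewrite jn_rcons rev_cat rev_rcons. Qed.

Lemma backs_runs rs L R : all nonblank rs -> head Blank L = Blank ->
  runs (backs (size rs)) (mkl (rev (jn rs) ++ L) R) (size (jn rs)).*2.+1 tt
    (mkl L (jn rs ++ R)).
Proof.
move=> + hL; elim/last_ind: rs R => [|rs r IH] R /=; first by move=> _; apply: ret_runs.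
rewrite all_rcons => /andP[nbr nbrs]; rewrite size_rcons /=.
rewrite jn_rcons rev_cat rev_rcons /= -!catA cat_rcons /mkl /=.
apply: (@runs_le _ _ _ ((size r).+2 + (size (jn rs)).*2.+1)).
  by rewrite size_cat size_rcons; lia.
apply: bind_runs; last exact: IH.
by apply: back1_runs => //; apply: head_rev_jn.
Qed.

Lemma shl_runs r y X R : nonblank r -> head Blank X = Blank ->
  runs (shl y) (mkl (rev r ++ X) R) (size r).+1 (head Blank (rcons r y))
    (mkl X (behead (rcons r y) ++ R)).
Proof.
move=> + hX; elim/last_ind: r y R => [|r a IH] y R.
  by move=> _; rewrite /mkl hX; apply: loop_stop; apply: (@prim_mk _ _ _ _ _ Blank Stay).
rewrite nonblank_rcons => /andP[na nbr].
rewrite rev_rcons size_rcons -add1n.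
apply: (@loop_next _ _ _ y a _ _ _ _ (mkl (rev r ++ X) (y :: R))).
  by apply: (@prim_mk _ _ _ _ _ y MoveL); rewrite ?mk_left //=; case: (a) na.
have -> : head Blank (rcons (rcons r a) y) = head Blank (rcons r a) by case: (r).
have -> : behead (rcons (rcons r a) y) ++ R = behead (rcons r a) ++ y :: R.
  by case: (r) => [|? ?] //=; rewrite cat_rcons.
exact: IH.
Qed.

Lemma shiftL_runs rs x L R : all nonblank rs -> head Blank L = Blank ->
  runs (shiftL (size rs) x) (mkl (rev (jn rs) ++ L) R) (size (jn rs)).*2.+1 tt
    (mk (behead L) (jn rs ++ x :: R)).
Proof.
move=> + hL; elim/last_ind: rs x R => [|rs r IH] x R /=.
  by move=> _; apply: prim_mk.
rewrite all_rcons => /andP[nbr nbrs]; rewrite size_rcons /=.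
rewrite jn_rcons rev_cat rev_rcons /= -!catA cat_rcons /mkl /=.
apply: (@runs_le _ _ _ (1 + ((size r).+1 + (size (jn rs)).*2.+1))).
  by rewrite size_cat size_rcons; lia.
apply: bind_runs; first by apply: prim_mk.
rewrite mk_left; apply: bind_runs.
  by apply: shl_runs => //; apply: head_rev_jn.
have -> : r ++ Blank :: x :: R =
    head Blank (rcons r Blank) :: (behead (rcons r Blank) ++ x :: R).
  by rewrite -cat_rcons; case: (r).
exact: IH.
Qed.

Lemma shr_runs r y L R : nonblank r ->
  runs (shr y) (mk L (r ++ Blank :: R)) (size r).+1 (last y r)
    (mk (rev (belast y r) ++ L) (Blank :: R)).
Proof.
elim: r y L => [|a r IH] y L.
  by move=> _; apply: loop_stop; apply: (@prim_mk _ _ _ _ _ Blank Stay).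
rewrite nonblank_cons => /andP[na nbr].
rewrite -[(size (a :: r)).+1]add1n.
apply: (@loop_next _ _ _ y a _ _ _ _ (mk (y :: L) (r ++ Blank :: R))).
  by apply: (@prim_mk _ _ _ _ _ y MoveR); rewrite ?mk_right //=; case: (a) na.
by rewrite /= rev_cons cat_rcons; apply: IH.
Qed.

Lemma shiftR_runs rs x L a R : all nonblank rs ->
  runs (shiftR (size rs) x) (mk L (jn rs ++ a :: R)) (size (jn rs)).*2.+1 tt
    (mkl (rev (x :: jn rs) ++ L) R).
Proof.
elim: rs x L => [|r rs IH] x L /=.
  by move=> _; apply: prim_mk.
case/andP=> nbr nbrs; rewrite jn_cons.
apply: (@runs_le _ _ _ ((size r).+1 + (1 + (size (jn rs)).*2.+1))).
  by rewrite size_cat /=; lia.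
rewrite -catA cat_cons; apply: bind_runs; first exact: shr_runs.
apply: bind_runs; first by apply: prim_mk.
have -> : rev (x :: r ++ Blank :: jn rs) ++ L =
    rev (Blank :: jn rs) ++ (last x r :: rev (belast x r) ++ L).
  by rewrite -cat_cons lastI rev_cat rev_rcons -catA.
by rewrite mk_right /=; apply: IH.
Qed.

Lemma pushF_runs rs x L R : all nonblank rs -> head Blank L = Blank -> R != [::] ->
  runs (pushF (size rs) x) (mk L (jn rs ++ R)) (10 * (size (jn rs)).+1) tt
    (mk (behead L) (jn rs ++ x :: R)).
Proof.
move=> nbrs hL nR.
apply: (@runs_le _ _ _ ((size (jn rs)).+1 + (1 + (size (jn rs)).*2.+1))); first lia.
apply: bind_runs; first exact: skips_runs.
apply: bind_runs; first exact: goL_runs.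
have -> : head Blank R :: behead R = R by case: (R) nR.
exact: shiftL_runs.
Qed.

Lemma popF_nil rs L R : all nonblank rs -> head Blank L = Blank ->
  runs (popF (size rs)) (mk L (jn rs ++ Blank :: R)) (10 * (size (jn rs)).+1) Blank
    (mk (Blank :: behead L) (jn rs ++ Blank :: R)).
Proof.
move=> nbrs hL; set J := size (jn rs).
apply: (@runs_le _ _ _ (J.+1 + (1 + (J.*2.+1 + (1 + 1))))); first lia.
apply: bind_runs; first exact: skips_runs.
apply: bind_runs; first exact: readL_runs.
apply: bind_runs; first exact: backs_runs.
rewrite /mkl hL; apply: bind_runs; first exact: goR_runs.
exact: ret_runs.
Qed.

Lemma popF_cons rs a L R : all nonblank rs -> head Blank L = Blank -> a != Blank ->
  runs (popF (size rs)) (mk L (jn rs ++ a :: R)) (10 * (size (jn rs)).+1) a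
    (mk (Blank :: Blank :: behead L) (jn rs ++ R)).
Proof.
move=> nbrs hL na; set J := size (jn rs).
apply: (@runs_le _ _ _ (J.+1 + (1 + (J.*2.+1 + (1 + (J.*2.+1 + (J.*2.+1 + (1 + 1)))))))); first lia.
apply: bind_runs; first exact: skips_runs.
apply: bind_runs; first exact: readL_runs.
apply: bind_runs; first exact: backs_runs.
rewrite /mkl hL; apply: bind_runs; first exact: goR_runs.
have -> : forall T (x y : T), match a with Blank => x | _ => y end = y by case: (a) na.
apply: bind_runs; first exact: shiftR_runs.
rewrite rev_cons cat_rcons.
apply: bind_runs; first exact: backs_runs.
apply: bind_runs; first exact: goR_runs.
exact: ret_runs.
Qed.

(** * Register programs *)

Inductive cmd :=
| Skip
| Push of nat & sym
| Seq of cmd & cmd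
| Case of nat & (sym -> cmd)
| Loop of nat & (sym -> cmd).

Definition getr (s : seq (seq sym)) i := nth [::] s i.
Definition setr (s : seq (seq sym)) i v := set_nth [::] s i v.

(* [Case i k] pops register [i], with [Blank] standing for "empty"; [Loop i k]
   pops register [i] until it is empty.  The cost [n] is only an upper bound on
   the number of elementary operations. *)
Inductive ev : cmd -> seq (seq sym) -> nat -> seq (seq sym) -> Prop :=
| EvSkip s n : ev Skip s n.+1 s
| EvPush i x s n : i < size s -> x != Blank ->
    ev (Push i x) s n.+1 (setr s i (x :: getr s i))
| EvSeq c1 c2 s s1 s2 a b : ev c1 s a s1 -> ev c2 s1 b s2 -> ev (Seq c1 c2) s (a + b) s2
| EvCase i k s n s' : i < size s ->
    ev (k (head Blank (getr s i))) (setr s i (behead (getr s i))) n s' ->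
    ev (Case i k) s n.+1 s'
| EvLoop0 i k s n : i < size s -> getr s i = [::] -> ev (Loop i k) s n.+2 s
| EvLoop i k s x r a s1 b s2 : i < size s -> getr s i = x :: r ->
    ev (k x) (setr s i r) a s1 -> ev (Loop i k) s1 b s2 ->
    ev (Loop i k) s (a + b).+2 s2.

Lemma ev_le c s n m s' : n <= m -> ev c s n s' -> ev c s m s'.
Proof.
move=> + H; elim: H m => {c s n s'}.
- by move=> s n [//|m] _; apply: EvSkip.
- by move=> i x s n H1 H2 [//|m] _; apply: EvPush.
- move=> c1 c2 s s1 s2 a b H1 IH1 H2 IH2 m le.
  have -> : m = a + (m - a) by lia.
  by apply: EvSeq H1 (IH2 _ _); lia.
- by move=> i k s n s' H1 H2 IH [//|m] le; apply: EvCase H1 (IH _ _).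
- by move=> i k s n H1 H2 [//|[//|m]] _; apply: EvLoop0.
- move=> i k s x r a s1 b s2 H1 H2 H3 IH3 H4 IH4 [//|[//|m]] le.
  have -> : m = a + (m - a) by lia.
  by apply: EvLoop H1 H2 H3 (IH4 _ _); lia.
Qed.

Fixpoint compile (c : cmd) : frag unit :=
  match c with
  | Skip => ret tt
  | Push i x => pushF i x
  | Seq c1 c2 => do _ <- compile c1; compile c2
  | Case i k => do x <- popF i; compile (k x)
  | Loop i k => loop (fun _ : unit =>
      do x <- popF i;
      if x is Blank then ret (inr tt) else do _ <- compile (k x); ret (inl tt)) tt
  end.

Lemma getr_split s i : i < size s -> s = take i s ++ getr s i :: drop i.+1 s.
Proof. by move=> H; rewrite -drop_nth // cat_take_drop. Qed.
Lemma setr_split s i v : i < size s -> setr s i v = take i s ++ v :: drop i.+1 s.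
Proof. by move=> H; rewrite /setr set_nthE H. Qed.

Lemma size_jn_setr s i v : i < size s ->
  size (jn (setr s i v)) + size (getr s i) = size (jn s) + size v.
Proof.
move=> H; rewrite {3}(getr_split H) setr_split // !jn_cat !jn_cons.
by rewrite !size_cat /=; lia.
Qed.

Lemma size_setr s i v : i < size s -> size (setr s i v) = size s.
Proof. by move=> H; rewrite size_set_nth; apply/maxn_idPr. Qed.

Lemma nonblank_setr s i v : i < size s -> all nonblank s -> nonblank v ->
  all nonblank (setr s i v).
Proof.
move=> H; rewrite {1}(getr_split H) setr_split // !all_cat /=.
by case/and3P=> -> _ -> ->.
Qed.

Lemma nonblank_getr s i : i < size s -> all nonblank s -> nonblank (getr s i).
Proof. by move=> H /allP; apply; apply: mem_nth. Qed.

Lemma jn_split s i Z : i < size s ->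
  jn s ++ Z = jn (take i s) ++ getr s i ++ Blank :: jn (drop i.+1 s) ++ Z.
Proof.
by move=> H; rewrite {1}(getr_split H) jn_cat jn_cons -!catA.
Qed.
Lemma jn_setr s i v Z : i < size s ->
  jn (setr s i v) ++ Z = jn (take i s) ++ v ++ Blank :: jn (drop i.+1 s) ++ Z.
Proof. by move=> H; rewrite setr_split // jn_cat jn_cons -!catA. Qed.

Lemma size_jn_take s i : size (jn (take i s)) <= size (jn s).
Proof. by rewrite -{2}(cat_take_drop i s) jn_cat size_cat leq_addr. Qed.

(** Only a push lengthens the registers, by one symbol for one unit of cost. *)
Lemma ev_size c s n s' : ev c s n s' ->
  size s' = size s /\ size (jn s') <= size (jn s) + n.
Proof.
elim=> {c s n s'}.
- by move=> s n; split => //; lia.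
- move=> i x s n H1 _; rewrite size_setr //; split => //.
  by have := size_jn_setr (x :: getr s i) H1; rewrite /=; lia.
- by move=> c1 c2 s s1 s2 a b _ [-> ?] _ [-> ?]; split => //; lia.
- move=> i k s n s' H1 _ [-> H2]; rewrite size_setr //; split => //.
  by have := size_jn_setr (behead (getr s i)) H1; rewrite size_behead; lia.
- by move=> i k s n _ _; split => //; lia.
- move=> i k s x r a s1 b s2 H1 H2 _ [-> H3] _ [-> H4].
  rewrite size_setr //; split => //.
  by have := size_jn_setr r H1; rewrite H2 /=; lia.
Qed.

Lemma ev_nonblank c s n s' : ev c s n s' -> all nonblank s -> all nonblank s'.
Proof.
elim=> {c s n s'} //.
- move=> i x s n H1 H2 H; apply: nonblank_setr => //.
  by rewrite nonblank_cons H2 nonblank_getr.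
- by move=> c1 c2 s s1 s2 a b _ H1 _ H2 /H1.
- move=> i k s n s' H1 _ IH H; apply: IH; apply: nonblank_setr => //.
  by have := nonblank_getr H1 H; case: (getr s i) => // ? ?; rewrite nonblank_cons => /andP[].
- move=> i k s x r a s1 b s2 H1 H2 _ IH1 _ IH2 H; apply: IH2; apply: IH1.
  apply: nonblank_setr => //.
  by have := nonblank_getr H1 H; rewrite H2 nonblank_cons => /andP[].
Qed.

Lemma head_nseq p : head Blank (nseq p Blank) = Blank. Proof. by case: p. Qed.

Definition homed (tp : tape) s Z := exists p, tp = mk (nseq p Blank) (jn s ++ Z).

Lemma popF_sim s i tp Z B : i < size s -> all nonblank s -> homed tp s Z ->
  size (jn s) <= B ->
  exists tp', runs (popF i) tp (10 * B.+1) (head Blank (getr s i)) tp' /\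
    homed tp' (setr s i (behead (getr s i))) Z.
Proof.
move=> Hi nb [p ->] HB.
have si : size (take i s) = i by rewrite size_take Hi.
have nbt : all nonblank (take i s) by move: nb; rewrite {1}(getr_split Hi) all_cat => /andP[].
have := nonblank_getr Hi nb; have le := size_jn_take s i.
have HB' : 10 * (size (jn (take i s))).+1 <= 10 * B.+1 by lia.
rewrite (jn_split _ Hi); case E : (getr s i) => [|a r] nbr /=.
  exists (mk (Blank :: behead (nseq p Blank)) (jn s ++ Z)).
  rewrite (jn_split _ Hi) E; split.
    by have := popF_nil (jn (drop i.+1 s) ++ Z) nbt (head_nseq p); rewrite si; apply: runs_le.
  by exists p.-1.+1; rewrite jn_setr //=; case: (p).
exists (mk [:: Blank, Blank & behead (nseq p Blank)] (jn (setr s i r) ++ Z)); split.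
  rewrite jn_setr //; move: nbr; rewrite nonblank_cons => /andP[na _].
  have := popF_cons (r ++ Blank :: jn (drop i.+1 s) ++ Z) nbt (head_nseq p) na.
  by  rewrite si; apply: runs_le.
by exists p.-1.+2; case: (p).
Qed.

(** By [ev_size], [B] bounds the total length of the registers throughout the run. One push or pop
    walks over them a bounded number of times, hence in at most [10 * B.+1] steps. *)
Theorem compile_sim c s n s' : ev c s n s' -> forall tp Z B, all nonblank s ->
  homed tp s Z -> size (jn s) + n <= B ->
  exists tp', runs (compile c) tp (n * (10 * B.+1)) tt tp' /\ homed tp' s' Z.
Proof.
elim=> {c s n s'}.
- move=> s n tp Z B _ [p ->] HB.
  exists (mk (nseq p Blank) (jn s ++ Z)); split; last by exists p.
  by apply: (@runs_le _ _ _ 1); [lia | apply: ret_runs].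
- move=> i x s n Hi nx tp Z B nb [p ->] HB.
  exists (mk (behead (nseq p Blank)) (jn (setr s i (x :: getr s i)) ++ Z)); split; last first.
    by exists p.-1; case: (p).
  rewrite jn_setr // (jn_split _ Hi).
  have si : size (take i s) = i by rewrite size_take Hi.
  have nbt : all nonblank (take i s) by move: nb; rewrite {1}(getr_split Hi) all_cat => /andP[].
  have nR : getr s i ++ Blank :: jn (drop i.+1 s) ++ Z != [::] by case: (getr s i).
  have le := size_jn_take s i.
  have := pushF_runs x nbt (head_nseq p) nR; rewrite si; apply: runs_le.
  by rewrite mulSn; lia.
- move=> c1 c2 s s1 s2 a b H1 IH1 H2 IH2 tp Z B nb hm HB.
  have [_ sz1] := ev_size H1.
  have [|tp1 [r1 hm1]] := IH1 tp Z B nb hm; first lia.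
  have [|tp2 [r2 hm2]] := IH2 tp1 Z B (ev_nonblank H1 nb) hm1; first lia.
  exists tp2; split => //; rewrite mulnDl; exact: bind_runs r1 r2.
- move=> i k s n s' Hi H IH tp Z B nb hm HB.
  have [|tp1 [r1 hm1]] := popF_sim Hi nb hm (_ : _ <= B); first lia.
  have [| |tp2 [r2 hm2]] := IH tp1 Z B _ hm1.
  + apply: nonblank_setr => //.
    by have := nonblank_getr Hi nb; case: (getr s i) => // ? ?; rewrite nonblank_cons => /andP[].
  + by have := size_jn_setr (behead (getr s i)) Hi; rewrite size_behead; lia.
  by exists tp2; split => //; rewrite mulSn; apply: bind_runs r1 r2.
- move=> i k s n Hi E tp Z B nb hm HB.
  have [|tp1 [r1 hm1]] := popF_sim Hi nb hm (_ : _ <= B); first lia.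
  rewrite E /= in r1 hm1.
  have Es : setr s i [::] = s by rewrite setr_split // {3}(getr_split Hi) E.
  rewrite Es in hm1; case: hm1 => p Etp.
  exists (mk (nseq p Blank) (jn s ++ Z)); split; last by exists p.
  apply: (@runs_le _ _ _ (10 * B.+1 + 1)); first by rewrite !mulSn; lia.
  by apply: loop_stop; apply: bind_runs r1 _; rewrite Etp; apply: ret_runs.
- move=> i k s x r a s1 b s2 Hi E H1 IH1 H2 IH2 tp Z B nb hm HB.
  have [|tp1 [r1 hm1]] := popF_sim Hi nb hm (_ : _ <= B); first lia.
  rewrite E /= in r1 hm1.
  have nbx : x != Blank /\ nonblank r.
    by have := nonblank_getr Hi nb; rewrite E nonblank_cons => /andP[].
  have szr := size_jn_setr r Hi; rewrite E /= in szr.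
  have nb1 : all nonblank (setr s i r) by apply: nonblank_setr => //; case: nbx.
  have [|tp2 [r2 hm2]] := IH1 tp1 Z B nb1 hm1; first lia.
  have [sz1 szj1] := ev_size H1.
  have [|tp3 [r3 hm3]] := IH2 tp2 Z B (ev_nonblank H1 nb1) hm2; first lia.
  exists tp3; split => //.
  (* The second unit that a round of a loop costs pays for the return to its head. *)
  apply: (@runs_le _ _ _ ((10 * B.+1 + (a * (10 * B.+1) + 1)) + b * (10 * B.+1))).
    by rewrite !mulSn mulnDl; lia.
  apply: loop_next r3; apply: bind_runs r1 _.
  have rt q : runs (ret (inl tt : unit + unit)) (mk (nseq q Blank) (jn s1 ++ Z)) 1 (inl tt)
    (mk (nseq q Blank) (jn s1 ++ Z)) by apply: ret_runs.
  by case: hm2 r2 => q -> r2; case: nbx => + _; case: x r2 {E H1 IH1} => // r2 _;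
    apply: bind_runs r2 (rt q).
Qed.

Arguments getr s i /.
Arguments setr s i v /.

(** * Renumbering, moving and copying registers *)

Fixpoint shiftc k (c : cmd) : cmd :=
  match c with
  | Skip => Skip
  | Push i x => Push (k + i) x
  | Seq c1 c2 => Seq (shiftc k c1) (shiftc k c2)
  | Case i f => Case (k + i) (fun x => shiftc k (f x))
  | Loop i f => Loop (k + i) (fun x => shiftc k (f x))
  end.

Lemma getr_cat pre s i : getr (pre ++ s) (size pre + i) = getr s i.
Proof. by rewrite /getr nth_cat ltnNge leq_addr /= addKn. Qed.
Lemma setr_cat pre s i v : setr (pre ++ s) (size pre + i) v = pre ++ setr s i v.
Proof. by elim: pre => //= a pre ->. Qed.

(** Frame property: a renumbered program leaves the registers in front alone, so it can run behind
    saved data. *)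
Lemma ev_shift pre c s n s' : ev c s n s' ->
  ev (shiftc (size pre) c) (pre ++ s) n (pre ++ s').
Proof.
elim=> {c s n s'}.
- by move=> s n; apply: EvSkip.
- move=> i x s n H1 H2; rewrite -setr_cat -(getr_cat pre); apply: EvPush => //.
  by rewrite size_cat ltn_add2l.
- by move=> c1 c2 s s1 s2 a b _ H1 _ H2; apply: EvSeq H1 H2.
- move=> i k s n s' H1 _ H2; apply: EvCase; first by rewrite size_cat ltn_add2l.
  by rewrite getr_cat setr_cat.
- move=> i k s n H1 H2; apply: EvLoop0; first by rewrite size_cat ltn_add2l.
  by rewrite getr_cat.
- move=> i k s x r a s1 b s2 H1 H2 _ H3 _ H4; apply: EvLoop H4.
  + by rewrite size_cat ltn_add2l.
  + by rewrite getr_cat; apply: H2.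
  + by rewrite setr_cat.
Qed.

Lemma getr_setr s i v j : getr (setr s i v) j = if j == i then v else getr s j.
Proof. by rewrite /getr /setr nth_set_nth. Qed.
Lemma setr_setr s i v w : setr (setr s i v) i w = setr s i w.
Proof. by rewrite /setr set_set_nth eqxx. Qed.
Lemma setrC s i j v w : i != j -> setr (setr s i v) j w = setr (setr s j w) i v.
Proof. by move=> H; rewrite /setr set_set_nth (negbTE H). Qed.
Lemma setr_id s i : i < size s -> setr s i (getr s i) = s.
Proof. by move=> H; rewrite setr_split // -getr_split. Qed.

Definition mv i j := Loop i (fun x => Push j x).

Lemma ev_mv i j s : i < size s -> j < size s -> i != j -> all nonblank s ->
  ev (mv i j) s (3 * size (getr s i) + 2)
    (setr (setr s i [::]) j (rev (getr s i) ++ getr s j)).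
Proof.
move: {2}(getr s i) (erefl (getr s i)) => r.
elim: r s => [|x r IH] s E Hi Hj ij nb.
  rewrite E -{2}E setr_id // setr_id //; apply: EvLoop0 => //.
have nbr := nonblank_getr Hi nb.
have [nx {}nbr] : x != Blank /\ nonblank r by apply/andP; rewrite -nonblank_cons -E.
have Hs : size (setr s i r) = size s by rewrite size_setr.
rewrite E; apply: (@ev_le _ _ (1 + (3 * size r + 2)).+2); first by rewrite /=; lia.
apply: EvLoop E _ _ => //; first by apply: EvPush; rewrite ?Hs.
rewrite getr_setr eq_sym (negbTE ij).
set s1 := setr _ j _.
have E1 : getr s1 i = r by rewrite /s1 !getr_setr (negbTE ij) eqxx.
have := IH s1 E1; rewrite E1 /s1.
rewrite !size_setr ?Hs // => /(_ Hi Hj ij).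
have -> : forall a b, setr (setr (setr (setr s i r) j a) i [::]) j b = setr (setr s i [::]) j b.
  by move=> a b; rewrite (setrC _ _ _ ij) setr_setr -(setrC _ _ _ ij) setr_setr.
rewrite getr_setr eqxx rev_cons cat_rcons.
apply; apply: nonblank_setr; rewrite ?size_setr //; first apply: nonblank_setr => //.
by rewrite nonblank_cons nx nonblank_getr.
Qed.

(** Popping and pushing reverses a word; the passage through [t] restores the order. *)
Definition mvto i j t := Seq (mv i t) (mv t j).

Lemma nonblank_nil : nonblank [::]. Proof. by []. Qed.
Lemma nonblank_cat r1 r2 : nonblank (r1 ++ r2) = nonblank r1 && nonblank r2.
Proof. by rewrite /nonblank mem_cat negb_or. Qed.
Lemma nonblank_rev r : nonblank (rev r) = nonblank r.
Proof. by rewrite /nonblank mem_rev. Qed.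

Lemma ev_mvto i j t s : i < size s -> j < size s -> t < size s ->
  i != j -> i != t -> j != t -> all nonblank s -> getr s t = [::] ->
  ev (mvto i j t) s (6 * size (getr s i) + 4)
    (setr (setr s i [::]) j (getr s i ++ getr s j)).
Proof.
move=> Hi Hj Ht ij it jt nb Et.
have nbi := nonblank_getr Hi nb.
apply: (@ev_le _ _ ((3 * size (getr s i) + 2) + (3 * size (getr s i) + 2))); first lia.
apply: EvSeq; first exact: ev_mv.
set s1 := setr _ t _.
have E1 : getr s1 t = rev (getr s i) by rewrite /s1 getr_setr eqxx Et cats0.
have Ej : getr s1 j = getr s j by rewrite /s1 !getr_setr (negbTE jt) eq_sym (negbTE ij).
have S1 : size s1 = size s by rewrite /s1 !size_setr.
have nb1 : all nonblank s1.
  rewrite /s1; apply: nonblank_setr; rewrite ?size_setr //; first exact: nonblank_setr.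
  by rewrite Et cats0 nonblank_rev.
have := @ev_mv t j s1; rewrite S1 E1 Ej size_rev revK eq_sym => /(_ Ht Hj jt nb1).
have -> // : setr s1 t [::] = setr s i [::].
rewrite /s1 setr_setr -[X in setr _ t X]Et.
have -> : getr s t = getr (setr s i [::]) t by rewrite getr_setr eq_sym (negbTE it).
by rewrite setr_id // size_setr.
Qed.

Definition cpto i j t := Seq (mv i t) (Loop t (fun x => Seq (Push i x) (Push j x))).

Lemma ev_dup i j t s : i < size s -> j < size s -> t < size s ->
  i != j -> i != t -> j != t -> all nonblank s ->
  ev (Loop t (fun x => Seq (Push i x) (Push j x))) s (4 * size (getr s t) + 2)
    (setr (setr (setr s t [::]) i (rev (getr s t) ++ getr s i)) j
       (rev (getr s t) ++ getr s j)).
Proof.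
move: {2}(getr s t) (erefl (getr s t)) => r.
elim: r s => [|x r IH] s E Hi Hj Ht ij it jt nb.
  rewrite E -{2}E (setr_id Ht) (setr_id Hi) (setr_id Hj); exact: EvLoop0.
have nbr := nonblank_getr Ht nb.
have [nx {}nbr] : x != Blank /\ nonblank r by apply/andP; rewrite -nonblank_cons -E.
have Hs : size (setr s t r) = size s by rewrite size_setr.
rewrite E; apply: (@ev_le _ _ ((1 + 1) + (4 * size r + 2)).+2); first by rewrite /=; lia.
apply: EvLoop E _ _ => //.
  apply: EvSeq; first by apply: EvPush; rewrite ?Hs.
  by apply: EvPush; rewrite ?size_setr ?Hs.
have ti : t != i by rewrite eq_sym.
have tj : t != j by rewrite eq_sym.
have ji : j != i by rewrite eq_sym.
rewrite !getr_setr (negbTE it) (negbTE ji) (negbTE jt).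
set s1 := setr _ j _.
have E1 : getr s1 t = r by rewrite /s1 !getr_setr (negbTE tj) (negbTE ti) eqxx.
have := IH s1 E1; rewrite E1 /s1 !size_setr ?Hs // => /(_ Hi Hj Ht ij it jt).
rewrite !getr_setr !eqxx (negbTE ij) !rev_cons !cat_rcons.
have -> : forall a b c d, setr (setr (setr (setr (setr (setr s t r) i a) j b) t [::]) i c) j d =
  setr (setr (setr s t [::]) i c) j d.
  move=> a b c d; rewrite (setrC _ _ _ jt) (setrC _ _ _ it) setr_setr.
  by rewrite (setrC _ _ _ ji) setr_setr setr_setr.
have nb0 : all nonblank (setr s t r) by apply: nonblank_setr.
apply; apply: nonblank_setr; rewrite ?size_setr //; last by rewrite nonblank_cons nx nonblank_getr.
by apply: nonblank_setr; rewrite ?size_setr // nonblank_cons nx nonblank_getr.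
Qed.

Lemma ev_cpto i j t s : i < size s -> j < size s -> t < size s ->
  i != j -> i != t -> j != t -> all nonblank s -> getr s t = [::] ->
  ev (cpto i j t) s (7 * size (getr s i) + 4) (setr s j (getr s i ++ getr s j)).
Proof.
move=> Hi Hj Ht ij it jt nb Et.
have nbi := nonblank_getr Hi nb.
apply: (@ev_le _ _ ((3 * size (getr s i) + 2) + (4 * size (getr s i) + 2))); first lia.
apply: EvSeq; first exact: ev_mv.
set s1 := setr _ t _.
have E1 : getr s1 t = rev (getr s i) by rewrite /s1 getr_setr eqxx Et cats0.
have Ej : getr s1 j = getr s j by rewrite /s1 !getr_setr (negbTE jt) eq_sym (negbTE ij).
have Ei : getr s1 i = [::] by rewrite /s1 !getr_setr (negbTE it) eqxx.
have S1 : size s1 = size s by rewrite /s1 !size_setr.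
have nb1 : all nonblank s1.
  rewrite /s1; apply: nonblank_setr; rewrite ?size_setr //; first exact: nonblank_setr.
  by rewrite Et cats0 nonblank_rev.
have := @ev_dup i j t s1; rewrite S1 E1 Ej Ei size_rev revK cats0.
move=> /(_ Hi Hj Ht ij it jt nb1).
have -> // : setr (setr s1 t [::]) i (getr s i) = s.
have -> : setr s1 t [::] = setr s i [::].
  rewrite /s1 setr_setr -[X in setr _ t X]Et.
  have -> : getr s t = getr (setr s i [::]) t by rewrite getr_setr eq_sym (negbTE it).
  by rewrite setr_id // size_setr.
by rewrite setr_setr setr_id.
Qed.

Definition clear i := Loop i (fun _ => Skip).
Lemma ev_clear i s : i < size s -> ev (clear i) s (3 * size (getr s i) + 2) (setr s i [::]).
Proof.
move: {2}(getr s i) (erefl (getr s i)) => r.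
elim: r s => [|x r IH] s E Hi; rewrite E.
  by rewrite -{2}E setr_id //; apply: EvLoop0.
apply: (@ev_le _ _ (1 + (3 * size r + 2)).+2); first by rewrite /=; lia.
apply: EvLoop E _ _ => //; first exact: EvSkip.
have := IH (setr s i r); rewrite getr_setr eqxx setr_setr size_setr //.
exact.
Qed.

Fixpoint pushs i (w : seq sym) : cmd :=
  if w is x :: w' then Seq (pushs i w') (Push i x) else Skip.
Lemma ev_pushs i w s : i < size s -> nonblank w ->
  ev (pushs i w) s (size w).+1 (setr s i (w ++ getr s i)).
Proof.
move=> Hi; elim: w => [|x w IH]; first by rewrite setr_id // => _; apply: EvSkip.
rewrite nonblank_cons => /andP[nx nb] /=; rewrite -addn1; apply: EvSeq; first exact: IH.
have := @EvPush i x (setr s i (w ++ getr s i)) 0; rewrite size_setr // getr_setr eqxx setr_setr.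
exact.
Qed.

(** * Binary trees as data *)

Inductive tree := Lf | Nd of tree & tree.

(** Prefix notation is self-delimiting: the end of a subtree is found by counting, and blanks remain
    free to separate registers. *)
Fixpoint ts (a : tree) : seq sym :=
  if a is Nd b c then One :: ts b ++ ts c else [:: Zero].

Lemma nonblank_ts a : nonblank (ts a).
Proof. by elim: a => //= a IHa b IHb; rewrite nonblank_cons nonblank_cat IHa. Qed.

(* Register 3 counts in unary the subtrees that remain to be read off register 0. *)
Definition take_loop := Loop 3 (fun _ => Case 0 (fun x =>
  Seq (Push 2 x) (if x is One then Seq (Push 3 One) (Push 3 One) else Skip))).
Definition take1 := Seq (Push 3 One) (Seq take_loop (mv 2 1)).

(** Stated with an arbitrary continuation [n], [s'] of the loop, so that the induction passes
    through both subtrees in turn; [y] is the counter unit spent on [a]. *)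
Lemma ev_take_loop a n rest d w y c Z s' :
  ev take_loop [:: rest, d, rev (ts a) ++ w, c & Z] n s' ->
  ev take_loop [:: ts a ++ rest, d, w, y :: c & Z] (6 * size (ts a) + n) s'.
Proof.
elim: a n rest w y c => [|a IHa b IHb] n rest w y c H /=.
  apply: (@ev_le _ _ ((1 + 1).+1 + n).+2); first lia.
  apply: (@EvLoop _ _ _ y c); try by [].
  - apply: EvCase => //=; apply: EvSeq; [by apply: EvPush | exact: EvSkip].
  - exact: H.
rewrite /= size_cat.
apply: (@ev_le _ _ ((1 + (1 + 1)).+1 + (6 * size (ts a) + (6 * size (ts b) + n))).+2); first lia.
apply: (@EvLoop _ _ _ y c); try by [].
- apply: EvCase => //=; apply: EvSeq; first by apply: EvPush.
  by apply: EvSeq; apply: EvPush.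
- rewrite /= -catA; apply: IHa; apply: IHb.
  by move: H; rewrite /= rev_cons rev_cat cat_rcons -catA.
Qed.

Lemma ev_take1 a rest d Z : nonblank rest -> nonblank d -> all nonblank Z ->
  ev take1 [:: ts a ++ rest, d, [::], [::] & Z] (10 * size (ts a) + 10)
    [:: rest, ts a ++ d, [::], [::] & Z].
Proof.
move=> nr nd nZ.
apply: (@ev_le _ _ (1 + ((6 * size (ts a) + 2) + (3 * size (ts a) + 2)))); first lia.
apply: EvSeq; first by apply: EvPush.
rewrite /=; apply: EvSeq.
  by apply: ev_take_loop; apply: EvLoop0.
have /= := @ev_mv 2 1 [:: rest, d, rev (ts a) ++ [::], [::] & Z].
rewrite cats0 revK size_rev; apply => //.
by rewrite nr nd nonblank_rev nonblank_ts.
Qed.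

(** * Polynomial-time functions *)

(* [f] is polynomially bounded in the measure [m]; the base is shifted by 2 so
   that a single exponent absorbs the constants. *)
Definition pb A (m f : A -> nat) := exists k, forall x, f x <= (m x).+2 ^ k.

Section PolyBound.
Variables (A : Type) (m : A -> nat).
Implicit Types f g : A -> nat.

Lemma pb_le g f : (forall x, f x <= g x) -> pb m g -> pb m f.
Proof. by move=> H [k Hk]; exists k => x; apply: leq_trans (H x) (Hk x). Qed.

Lemma pb_const c : pb m (fun _ => c).
Proof.
exists c => x; apply: leq_trans (_ : 2 ^ c <= _); first exact/ltnW/ltn_expl.
by case: c => // c; rewrite leq_exp2r.
Qed.

Lemma pb_id : pb m m.
Proof. by exists 1 => x; rewrite expn1; lia. Qed.

Lemma pb_add f g : pb m f -> pb m g -> pb m (fun x => f x + g x).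
Proof.
move=> [k Hk] [l Hl]; exists (maxn k l).+1 => x.
have H1 : (m x).+2 ^ k <= (m x).+2 ^ maxn k l by rewrite leq_exp2l // leq_maxl.
have H2 : (m x).+2 ^ l <= (m x).+2 ^ maxn k l by rewrite leq_exp2l // leq_maxr.
apply: leq_trans (leq_add (leq_trans (Hk x) H1) (leq_trans (Hl x) H2)) _.
by rewrite addnn -mul2n expnS leq_mul.
Qed.

Lemma pb_mul f g : pb m f -> pb m g -> pb m (fun x => f x * g x).
Proof.
by move=> [k Hk] [l Hl]; exists (k + l) => x; rewrite expnD leq_mul.
Qed.

End PolyBound.

Lemma leq_exp2r' a b k : a <= b -> a ^ k <= b ^ k.
Proof. by case: k => // k; rewrite leq_exp2r. Qed.

Lemma pb_comp A B (m : A -> nat) (n : B -> nat) (h : B -> A) f :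
  pb m f -> pb n (fun x => m (h x)) -> pb n (fun x => f (h x)).
Proof.
move=> [k Hk] H; have [l Hl] := pb_add H (pb_const n 2).
exists (l * k) => x; apply: leq_trans (Hk _) _; rewrite expnM leq_exp2r' //.
by apply: leq_trans (Hl x); rewrite addn2.
Qed.

Class Enc (T : Type) := { code : T -> tree; code_inj : injective code }.
Definition sz {T} {E : Enc T} (x : T) := size (ts (code x)).

(** Quantifying over all [M >= K] lets programs with different needs share one tape and run behind
    saved registers; scratch registers are handed back empty for reuse. *)
Definition PT {A B} {EA : Enc A} {EB : Enc B} (f : A -> B) :=
  exists c K t, pb sz t /\ forall x M, K <= M ->
    ev c (ts (code x) :: nseq M [::]) (t x) (ts (code (f x)) :: nseq M [::]).

Lemma size_jn_nseq M : size (jn (nseq M ([::] : seq sym))) = M.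
Proof. by elim: M => // M IH; rewrite -[nseq _ _]/([::] :: nseq M _) size_jn_cons IH. Qed.

Lemma nonblank_nseq M : all nonblank (nseq M [::]).
Proof. by elim: M. Qed.

(** A unit of cost adds at most one symbol, so a time bound also bounds the output. *)
Lemma PT_size {A B} {EA : Enc A} {EB : Enc B} (f : A -> B) :
  PT f -> pb sz (fun x => sz (f x)).
Proof.
move=> [c [K [t [Ht H]]]]; apply: (@pb_le _ _ (fun x => sz x + t x)); last first.
  by apply: pb_add Ht; apply: pb_id.
move=> x; have [_] := ev_size (H x K (leqnn K)).
by rewrite !size_jn_cons size_jn_nseq /sz; lia.
Qed.

Lemma PT_ext {A B} {EA : Enc A} {EB : Enc B} (f g : A -> B) :
  f =1 g -> PT f -> PT g.
Proof.
by move=> fg [c [K [t [Ht H]]]]; exists c, K, t; split => // x M le; rewrite -fg; apply: H.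
Qed.

(** Makes changes of type free when the trees agree: a cons is coded as a pair, a successor as a
    pair with [tt], a number as a list of units. *)
Lemma PT_recode {A B} {EA : Enc A} {EB : Enc B} (f : A -> B) :
  (forall x, code (f x) = code x) -> PT f.
Proof.
move=> H; exists Skip, 0, (fun _ => 1); split; first exact: pb_const.
by move=> x M _; rewrite H; apply: EvSkip.
Qed.

Lemma PT_id {A} {EA : Enc A} : PT (fun x : A => x).
Proof. exact: PT_recode. Qed.

Lemma PT_comp {A B C} {EA : Enc A} {EB : Enc B} {EC : Enc C} (f : A -> B) (g : B -> C) :
  PT g -> PT f -> PT (fun x => g (f x)).
Proof.
move=> [cg [Kg [tg [Htg Hg]]]] Pf; have Sf := PT_size Pf.
case: Pf => [cf [Kf [tf [Htf Hf]]]].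
exists (Seq cf cg), (Kf + Kg), (fun x => tf x + tg (f x)); split.
  by apply: pb_add => //; apply: pb_comp Sf.
by move=> x M le; apply: EvSeq (Hf _ _ _) (Hg _ _ _); lia.
Qed.

(** * Tree codes of data types *)

Lemma code_unit_inj : injective (fun _ : unit => Lf). Proof. by case=> [] []. Qed.
#[global] Instance Enc_unit : Enc unit := Build_Enc code_unit_inj.

Definition code_bool (b : bool) := if b then Nd Lf Lf else Lf.
Lemma code_bool_inj : injective code_bool. Proof. by do 2 case. Qed.
#[global] Instance Enc_bool : Enc bool := Build_Enc code_bool_inj.

Definition code_nat n := iter n (Nd Lf) Lf.
Lemma code_nat_inj : injective code_nat.
Proof. by elim=> [|n IH] [|m] //= [] H; rewrite (IH m). Qed.
#[global] Instance Enc_nat : Enc nat := Build_Enc code_nat_inj.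

(** The nonblank symbols are the right-growing trees with 0, 1 and 2 inner nodes, which [write_syms]
    tells apart while popping. *)
Definition code_sym a :=
  match a with
  | Zero => Lf | One => Nd Lf Lf | Sep => Nd Lf (Nd Lf Lf) | Blank => Nd (Nd Lf Lf) Lf
  end.
Lemma code_sym_inj : injective code_sym. Proof. by do 2 case. Qed.
#[global] Instance Enc_sym : Enc sym := Build_Enc code_sym_inj.

Section EncPair.
Context {A B : Type} {EA : Enc A} {EB : Enc B}.
Definition code_pair (p : A * B) := Nd (code p.1) (code p.2).
Lemma code_pair_inj : injective code_pair.
Proof. by move=> [a b] [c d] [] /= H1 H2; rewrite (code_inj H1) (code_inj H2). Qed.
#[global] Instance Enc_prod : Enc (A * B) := Build_Enc code_pair_inj.

Definition code_seq : seq A -> tree := foldr (fun x t => Nd (code x) t) Lf.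
Lemma code_seq_inj : injective code_seq.
Proof.
by elim=> [|a s IH] [|b t] //= [] H1 H2; rewrite (code_inj H1) (IH t).
Qed.
#[global] Instance Enc_seq : Enc (seq A) := Build_Enc code_seq_inj.
End EncPair.

(** * Pairing, projections, conditionals, equality *)

Ltac ev_side := rewrite /= ?size_nseq ?nonblank_cat ?nonblank_cons ?nonblank_ts ?nonblank_nseq //.

Lemma PT_pair {A B C} {EA : Enc A} {EB : Enc B} {EC : Enc C} (f : A -> B) (g : A -> C) :
  PT f -> PT g -> PT (fun x => (f x, g x)).
Proof.
move=> Pf Pg; have Sf := PT_size Pf; have Sg := PT_size Pg.
case: Pf Pg => [cf [Kf [tf [Htf Hf]]]] [cg [Kg [tg [Htg Hg]]]].
exists (Seq (cpto 0 1 2) (Seq (shiftc 1 cf) (Seq (mvto 0 2 3) (Seq (shiftc 2 cg)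
  (Seq (mvto 2 0 3) (Seq (mvto 1 0 3) (Push 0 One))))))), (Kf + Kg + 4),
  (fun x => (7 * sz x + 4) + (tf x + ((6 * sz x + 4) + (tg x + ((6 * sz (g x) + 4) +
    ((6 * sz (f x) + 4) + 1)))))); split.
  by repeat first [exact: Htf | exact: Htg | exact: Sf | exact: Sg | exact: pb_id
    | exact: pb_const | apply: pb_add | apply: pb_mul].
move=> x [|[|[|M]]] le; try by move: le; lia.
have e3 : nseq M.+3 [::] = [:: [::], [::], [::] & nseq M ([::] : seq sym)] by [].
apply: EvSeq; first by rewrite e3; apply: ev_cpto; ev_side.
rewrite /= cats0; apply: EvSeq.
  by apply: (@ev_shift [:: ts (code x)]); apply: (Hf x M.+2); lia.
rewrite /=; apply: EvSeq; first by apply: ev_mvto; ev_side.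
rewrite /= cats0; apply: EvSeq.
  by apply: (@ev_shift [:: [::]; ts (code (f x))]); apply: (Hg x M.+1); lia.
rewrite /=; apply: EvSeq; first by apply: ev_mvto; ev_side.
rewrite /= cats0; apply: EvSeq; first by apply: ev_mvto; ev_side.
by rewrite /=; apply: EvPush.
Qed.

Ltac pb_tac := repeat first [assumption | lazymatch goal with
  | |- pb _ (fun _ => ?c) => exact: pb_const
  | |- pb _ (fun x => @?f x + @?g x) => apply: (pb_add (f := f) (g := g))
  | |- pb _ (fun x => @?f x * @?g x) => apply: (pb_mul (f := f) (g := g))
  | _ => exact: pb_id
  end].

Lemma sz_pair {A B} {EA : Enc A} {EB : Enc B} (a : A) (b : B) :
  sz (a, b) = (sz a + sz b).+1.
Proof. by rewrite /sz /= size_cat. Qed.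
Lemma sz_cons {A} {EA : Enc A} (a : A) s : sz (a :: s) = (sz a + sz s).+1.
Proof. by rewrite /sz /= size_cat. Qed.
Lemma sz_nil {A} {EA : Enc A} : sz ([::] : seq A) = 1.
Proof. by []. Qed.
Lemma sz_gt0 {A} {EA : Enc A} (a : A) : 0 < sz a.
Proof. by rewrite /sz; case: (code a). Qed.
Lemma sz_nat n : sz n = n.*2.+1.
Proof. by rewrite /sz /=; elim: n => //= n ->; lia. Qed.
Lemma sz_bool (b : bool) : sz b <= 3.
Proof. by case: b. Qed.
Lemma leq_size_sz {A} {EA : Enc A} (s : seq A) : size s < sz s.
Proof. by elim: s => // a s IH; rewrite sz_cons /=; have := sz_gt0 a; lia. Qed.

Lemma PT_fst {A B} {EA : Enc A} {EB : Enc B} : PT (fun p : A * B => p.1).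
Proof.
exists (Case 0 (fun _ => Seq take1 (Seq (clear 0) (mvto 1 0 2)))), 3,
  (fun p => 20 * sz p + 20); split; first by pb_tac.
move=> [a b] [|[|[|M]]] // _; rewrite sz_pair /=.
apply: (@ev_le _ _ ((10 * sz a + 10) + ((3 * sz b + 2) + (6 * sz a + 4))).+1); first lia.
apply: EvCase => //=; apply: EvSeq.
  by apply: ev_take1; ev_side.
rewrite cats0; apply: EvSeq; first by apply: ev_clear.
rewrite /=.
have := @ev_mvto 1 0 2 [:: [::], ts (@code A EA a), [::], [::] & nseq M [::]].
by rewrite /= cats0; apply; ev_side.
Qed.

Lemma PT_snd {A B} {EA : Enc A} {EB : Enc B} : PT (fun p : A * B => p.2).
Proof.
exists (Case 0 (fun _ => Seq take1 (clear 1))), 3,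
  (fun p => 20 * sz p + 20); split; first by pb_tac.
move=> [a b] [|[|[|M]]] // _; rewrite sz_pair /=.
apply: (@ev_le _ _ ((10 * sz a + 10) + (3 * sz a + 2)).+1); first lia.
apply: EvCase => //=; apply: EvSeq.
  by apply: ev_take1; ev_side.
rewrite cats0.
exact: (@ev_clear 1 [:: ts (code b), ts (code a), [::], [::] & nseq M [::]]).
Qed.

Lemma PT_const {A B} {EA : Enc A} {EB : Enc B} (y : B) : PT (fun _ : A => y).
Proof.
exists (Seq (clear 0) (pushs 0 (ts (code y)))), 0, (fun x => (3 * sz x + 2) + (sz y).+1).
split; first by rewrite -addn1; pb_tac.
move=> x M _; apply: EvSeq; first exact: ev_clear.
have := @ev_pushs 0 (ts (@code B EB y)) [:: [::] & nseq M [::]]; rewrite /= cats0.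
by apply; rewrite ?nonblank_ts.
Qed.

Lemma PT_if {A B} {EA : Enc A} {EB : Enc B} (b : A -> bool) (f g : A -> B) :
  PT b -> PT f -> PT g -> PT (fun x => if b x then f x else g x).
Proof.
move=> [cb [Kb [tb [Htb Hb]]]] [cf [Kf [tf [Htf Hf]]]] [cg [Kg [tg [Htg Hg]]]].
exists (Seq (cpto 0 1 2) (Seq (shiftc 1 cb)
   (Case 1 (fun x => if x is One then Seq (clear 1) cf else cg)))),
  (Kf + Kb + Kg + 3), (fun x => (7 * sz x + 4) + (tb x + (tf x + tg x + 10))).
split; first by pb_tac.
move=> x [|[|[|M]]] le; try by move: le; lia.
apply: EvSeq; first by apply: ev_cpto; ev_side.
rewrite /= cats0; apply: EvSeq.
  by apply: (@ev_shift [:: ts (code x)]); apply: (Hb x M.+2); lia.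
case: (b x) => /=.
  (* The code of [true] is [One] followed by two zeros, and clearing these costs 8; the code of
     [false] is used up by the pop. *)
  apply: (@ev_le _ _ (8 + tf x).+1); first lia.
  apply: EvCase => //=; apply: EvSeq; first exact: ev_clear.
  by apply: (Hf x M.+3); lia.
apply: (@ev_le _ _ (tg x).+1); first lia.
by apply: EvCase => //=; apply: (Hg x M.+3); lia.
Qed.

Lemma PT_behead {A} {EA : Enc A} : PT (fun s : seq A => behead s).
Proof.
exists (Case 0 (fun x => if x is One then Seq take1 (clear 1) else Push 0 Zero)), 3,
  (fun p => 20 * sz p + 20); split; first by pb_tac.
move=> [|a s] [|[|[|M]]] // _.
  by apply: (@ev_le _ _ 2) => //; apply: EvCase => //=; apply: EvPush.
rewrite sz_cons /=.
apply: (@ev_le _ _ ((10 * sz a + 10) + (3 * sz a + 2)).+1); first lia.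
apply: EvCase => //=; apply: EvSeq.
  by apply: ev_take1; ev_side.
rewrite cats0.
exact: (@ev_clear 1 [:: ts (code s), ts (code a), [::], [::] & nseq M [::]]).
Qed.

Lemma ts_cat_inj a b u v : ts a ++ u = ts b ++ v -> a = b /\ u = v.
Proof.
elim: a b u v => [|a1 IH1 a2 IH2] [|b1 b2] u v //=; first by case.
by case; rewrite -!catA => /IH1[-> /IH2[-> ->]].
Qed.

Lemma ts_inj : injective ts.
Proof. by move=> a b E; case: (@ts_cat_inj a b [::] [::]); rewrite ?cats0. Qed.

Definition cmp_loop := Loop 0 (fun x => Case 1 (fun y => if x == y then Skip else Push 2 One)).

(** Register 2 collects a mark for each mismatch. An exhausted [v] is read as [Blank], which differs
    from all symbols of [u]; a longer [v] leaves a rest. Hence the two emptiness tests. *)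
Lemma ev_cmp_loop u v w Z : nonblank u -> exists v' w',
  [/\ ev cmp_loop [:: u, v, w & Z] (4 * size u + 2) [:: [::], v', w' & Z],
   (v' == [::]) && (w' == [::]) = (u == v) && (w == [::]),
   size v' <= size v & size w' <= size w + size u].
Proof.
elim: u v w => [|x u IH] v w.
  move=> _; exists v, w; split; rewrite ?addn0 //; last by rewrite [in RHS]eq_sym.
  exact: EvLoop0.
rewrite nonblank_cons => /andP[nx nu].
pose w1 := if x == head Blank v then w else One :: w.
have [v' [w' [E1 E2 E3 E4]]] := IH (behead v) w1 nu.
exists v', w'; split.
- apply: (@ev_le _ _ ((1.+1) + (4 * size u + 2)).+2); first by rewrite /=; lia.
  apply: (@EvLoop _ _ _ x u) E1 => //; apply: EvCase => //=.
  by rewrite /w1; case: eqP => _; [exact: EvSkip | exact: EvPush].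
- rewrite E2 /w1; case: v {E2 E3 E4} @w1 E1 => [|y v] _ _ /=.
    by rewrite (negbTE nx) andbF.
  by rewrite eqseq_cons; case: (x == y); rewrite ?andbF.
- by move: E3; rewrite size_behead; lia.
- by move: E4; rewrite /w1; case: ifP => _ /=; lia.
Qed.

Lemma PT_eqb {A : eqType} {EA : Enc A} : PT (fun p : A * A => p.1 == p.2).
Proof.
exists (Case 0 (fun _ => Seq take1 (Seq cmp_loop
  (Seq (Case 1 (fun y => if y is Blank then Skip else Push 2 One)) (Seq (clear 1)
  (Case 2 (fun y => if y is Blank then pushs 0 (ts (code true))
     else Seq (clear 2) (Push 0 Zero)))))))), 3, (fun p => 30 * sz p + 30).
split; first by pb_tac.
move=> [a b] [|[|[|M]]] // _; rewrite sz_pair.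
have [v' [w' [E1 E2 E3 E4]]] := @ev_cmp_loop (ts (@code A EA b)) (ts (@code A EA a)) [::]
  ([::] :: nseq M [::]) (nonblank_ts _).
have {}E2 : (a == b) = (v' == [::]) && (w' == [::]).
  rewrite E2 andbT; apply/eqP/eqP => [->//|/ts_inj H]; exact/esym/code_inj.
rewrite /= add0n -!/(sz _) in E3 E4.
pose w2 := if v' is _ :: _ then One :: w' else w'.
have sw2 : size w2 <= (sz b).+1 by rewrite /w2; case: (v') => //= *; lia.
apply: (@ev_le _ _ ((10 * sz a + 10) + ((4 * sz b + 2) + (2 + ((3 * sz a + 2) +
   ((3 * size w2 + 2) + 4).+1)))).+1); first lia.
apply: EvCase => //=; apply: EvSeq; first by apply: ev_take1; ev_side.
rewrite cats0; apply: EvSeq; first exact: E1.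
apply: (@EvSeq _ _ _ [:: [::], behead v', w2, [::] & nseq M [::]]).
  apply: EvCase => //=; rewrite /w2; case E: v' (nonblank_nil) => [|x v] _; first exact: EvSkip.
  have := ev_nonblank E1; rewrite /= !nonblank_ts nonblank_nseq E /= => /(_ isT).
  rewrite nonblank_cons => /andP[/andP[nx _] _].
  by case: (x) nx => // _; apply: EvPush.
apply: EvSeq.
  apply: (@ev_le _ _ (3 * size (behead v') + 2)); first by rewrite size_behead; lia.
  exact: ev_clear.
rewrite /=; have {}E2 : (a == b) = (w2 == [::]).
  by rewrite E2 /w2; case: (v').
have nw2 : nonblank w2.
  have := ev_nonblank E1; rewrite /= !nonblank_ts nonblank_nseq => /(_ isT)/andP[_ /andP[nw _]].
  by rewrite /w2; case: (v') => // *; rewrite nonblank_cons.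
apply: EvCase => //=; rewrite E2; case: (w2) nw2 => [|x w] /=.
  move=> _; apply: (@ev_le _ _ 4) => //.
  by apply: (@ev_pushs 0 [:: One; Zero; Zero] [:: [::], [::], [::], [::] & nseq M [::]]).
rewrite nonblank_cons => /andP[nx _].
have Hc : ev (Seq (clear 2) (Push 0 Zero)) [:: [::], [::], w, [::] & nseq M [::]]
   ((3 * size w + 2) + 1) [:: [:: Zero], [::], [::], [::] & nseq M [::]].
  by apply: EvSeq; [exact: ev_clear | exact: EvPush].
apply: ev_le (_ : (3 * size w + 2) + 1 <= _) _; first lia.
by case: (x) nx.
Qed.

(** * Folds with bounded accumulators *)

Section Foldl.
Context {G X S : Type} {EG : Enc G} {EX : Enc X} {ES : Enc S}.
Variables (l : G -> seq X) (i : G -> S) (st : G -> S -> X -> S) (bd : G -> nat).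

(* Registers: 0 the context, 1 the accumulator, 2 the remaining list. *)
Definition fold_loop cst := Loop 2 (fun x => if x is One then
   Seq (shiftc 2 take1) (Seq (mvto 1 3 4) (Seq (cpto 0 3 4) (Seq (Push 3 One) (Seq (Push 3 One)
     (Seq (shiftc 3 cst) (mvto 3 1 4)))))) else Skip).

Lemma ev_fold_loop cst K tst k B g :
  (forall p M, K <= M -> ev cst (ts (code p) :: nseq M [::]) (tst p)
     (ts (code (st p.1.1 p.1.2 p.2)) :: nseq M [::])) ->
  (forall p, tst p <= (sz p).+2 ^ k) -> sz g <= B ->
  forall s a M, K + 3 <= M -> sz s <= B ->
  (forall j, sz (foldl (st g) a (take j s)) <= B) ->
  ev (fold_loop cst) [:: ts (code g), ts (code a), ts (code s) & nseq M [::]]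
    (size s * (40 * B + 40 + (3 * B + 4) ^ k) + 5)
    [:: ts (code g), ts (code (foldl (st g) a s)), [::] & nseq M [::]].
Proof.
move=> Hst Htst HgB; elim=> [|x s IH] a [|[|[|M]]] le HsB HB; try by move: le; lia.
  apply: (@ev_le _ _ (1 + 2).+2) => //; apply: (@EvLoop _ _ _ Zero [::]) => //=.
    exact: EvSkip.
  exact: EvLoop0.
have HaB : sz a <= B := HB 0.
have Ha'B : sz (st g a x) <= B by have := HB 1; rewrite /= take0.
move: HsB; rewrite sz_cons => HsB.
have H3 := Hst (g, a, x) M.+2; have H3' := Htst (g, a, x).
rewrite !sz_pair in H3'.
(* The triple (g, a, x) has size at most 3 * B + 2, and [pb] shifts its base by 2. *)
have {}H3' : tst (g, a, x) <= (3 * B + 4) ^ k.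
  by apply: leq_trans H3' _; apply: leq_exp2r'; lia.
apply: (@ev_le _ _ (((10 * sz x + 10) + ((6 * sz a + 4) + ((7 * sz g + 4) + (1 + (1 +
   (tst (g, a, x) + (6 * sz (st g a x) + 4))))))) +
   (size s * (40 * B + 40 + (3 * B + 4) ^ k) + 5)).+2).
  by rewrite [size (_ :: _)]/= mulSn; lia.
apply: (@EvLoop _ _ _ One (ts (code x) ++ ts (code s))) => //; last first.
  apply: (IH (st g a x) M.+3); [lia | lia | by move=> j; have := HB j.+1].
rewrite [setr _ _ _]/=; apply: EvSeq.
  apply: (@ev_shift [:: ts (code g); ts (code a)]).
  by apply: (@ev_take1 (code x) (ts (code s)) [::] (nseq M [::])); ev_side.
rewrite /= cats0; apply: EvSeq; first by apply: ev_mvto; ev_side.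
rewrite /=; apply: EvSeq; first by apply: ev_cpto; ev_side.
rewrite /=; apply: EvSeq; first exact: EvPush.
rewrite /=; apply: EvSeq; first exact: EvPush.
rewrite /=; apply: EvSeq.
  apply: (@ev_shift [:: ts (code g); [::]; ts (code s)]).
  by rewrite catA; apply: H3; lia.
rewrite /=.
have := @ev_mvto 3 1 4 [:: ts (@code G EG g), [::], ts (@code _ (@Enc_seq X EX) s),
  ts (@code S ES (st g a x)), [::], [::] & nseq M [::]].
by rewrite /= cats0; apply; ev_side.
Qed.

(** The intermediate accumulators must be bounded beforehand: a polynomial-time step may double its
    argument, and its iteration would be exponential. *)
Lemma PT_foldl :
  PT l -> PT i -> PT (fun p : G * S * X => st p.1.1 p.1.2 p.2) -> pb sz bd ->
  (forall g k, sz (foldl (st g) (i g) (take k (l g))) <= bd g) ->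
  PT (fun g => foldl (st g) (i g) (l g)).
Proof.
move=> Pl Pi; have Sl := PT_size Pl; have Si := PT_size Pi.
case: Pl Pi => [cl [Kl [tl [Htl Hl]]]] [ci [Ki [ti [Hti Hi]]]].
move=> [cst [Kst [tst [[k Hk] Hst]]]] Hbd HB.
pose B g := @sz G EG g + @sz _ (@Enc_seq X EX) (l g) + bd g.
have pB : pb sz B by rewrite /B; pb_tac.
exists (Seq (cpto 0 1 2) (Seq (shiftc 1 ci) (Seq (cpto 0 2 3) (Seq (shiftc 2 cl)
  (Seq (fold_loop cst) (Seq (clear 0) (mvto 1 0 2))))))), (Kl + Ki + Kst + 6),
  (fun g => (7 * sz g + 4) + (ti g + ((7 * sz g + 4) + (tl g +
    ((sz (l g) * (40 * B g + 40 + (3 * B g + 4) ^ k) + 5) + ((3 * sz g + 2) +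
     (6 * bd g + 4))))))); split.
  have pBk : pb sz (fun g => (3 * B g + 4) ^ k).
    elim: (k) => [|k' IH]; first exact: pb_const.
    by apply: (@pb_le _ _ (fun g => (3 * B g + 4) * (3 * B g + 4) ^ k')) => [g|];
      [rewrite expnS | pb_tac].
  by pb_tac.
move=> g [|[|[|[|M]]]] le; try by move: le; lia.
apply: EvSeq; first by apply: ev_cpto; ev_side.
rewrite /= cats0; apply: EvSeq.
  by apply: (@ev_shift [:: ts (code g)]); apply: (Hi g M.+3); lia.
rewrite /=; apply: EvSeq; first by apply: ev_cpto; ev_side.
rewrite /= cats0; apply: EvSeq.
  by apply: (@ev_shift [:: ts (code g); ts (code (i g))]); apply: (Hl g M.+2); lia.
rewrite /=; apply: EvSeq.
  apply: (@ev_le _ _ (size (l g) * (40 * B g + 40 + (3 * B g + 4) ^ k) + 5)).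
    by rewrite leq_add2r leq_mul // ltnW // leq_size_sz.
  apply: (@ev_fold_loop cst Kst tst k (B g) g Hst Hk _ (l g) (i g) M.+2).
  - by rewrite /B; lia.
  - by move: le; lia.
  - by rewrite /B; lia.
  - by move=> j; apply: leq_trans (HB g j) _; rewrite /B; lia.
apply: EvSeq; first exact: ev_clear.
rewrite /=; apply: (@ev_le _ _ (6 * sz (foldl (st g) (i g) (l g)) + 4)).
  have := HB g (size (l g)); rewrite take_size; lia.
have := @ev_mvto 1 0 2 [:: [::], ts (@code S ES (foldl (st g) (i g) (l g))), [::],
  [::], [::] & nseq M [::]].
by rewrite /= cats0; apply; ev_side.
Qed.
End Foldl.

Section Lifted.
Context {G A B X : Type} {EG : Enc G} {EA : Enc A} {EB : Enc B} {EX : Enc X}.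

Lemma PT_ofst (f : G -> A * B) : PT f -> PT (fun g => (f g).1).
Proof. exact: (PT_comp PT_fst). Qed.
Lemma PT_osnd (f : G -> A * B) : PT f -> PT (fun g => (f g).2).
Proof. exact: (PT_comp PT_snd). Qed.

Lemma PT_cons (a : G -> X) (s : G -> seq X) : PT a -> PT s -> PT (fun g => a g :: s g).
Proof.
move=> Pa Ps; apply: (@PT_comp _ _ _ _ _ _ (fun g => (a g, s g)) (fun p => p.1 :: p.2)).
  exact: PT_recode.
exact: PT_pair.
Qed.

Lemma PT_S (n : G -> nat) : PT n -> PT (fun g => (n g).+1).
Proof.
move=> Pn; apply: (@PT_comp _ _ _ _ _ _ (fun g => (tt, n g)) (fun p => p.2.+1)).
  exact: PT_recode.
exact: PT_pair (PT_const _) Pn.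
Qed.

Lemma PT_obehead (s : G -> seq X) : PT s -> PT (fun g => behead (s g)).
Proof. exact: PT_comp PT_behead. Qed.

Lemma PT_and (a b : G -> bool) : PT a -> PT b -> PT (fun g => a g && b g).
Proof. by move=> Pa Pb; apply: (PT_if Pa Pb (PT_const false)). Qed.
Lemma PT_not (a : G -> bool) : PT a -> PT (fun g => ~~ a g).
Proof. by move=> Pa; apply: (PT_if Pa (PT_const false) (PT_const true)). Qed.
End Lifted.

Lemma PT_eq {G} {A : eqType} {EG : Enc G} {EA : Enc A} (a b : G -> A) :
  PT a -> PT b -> PT (fun g => a g == b g).
Proof.
by move=> Pa Pb; apply: (PT_comp (f := fun g => (a g, b g)) PT_eqb); apply: PT_pair.
Qed.

Lemma PT_units {G} {EG : Enc G} (n : G -> nat) : PT n -> PT (fun g => nseq (n g) tt).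
Proof.
by apply: (PT_comp (g := fun n => nseq n tt)); apply: PT_recode; elim=> //= k ->.
Qed.

Lemma PT_sizeu {G} {EG : Enc G} (s : G -> seq unit) : PT s -> PT (fun g => size (s g)).
Proof.
by apply: (PT_comp (g := fun s => size s)); apply: PT_recode; elim=> //= [[]] r /= ->.
Qed.

Lemma PT_pred {G} {EG : Enc G} (n : G -> nat) : PT n -> PT (fun g => (n g).-1).
Proof.
move=> Pn; apply: (PT_ext (f := fun g => size (behead (nseq (n g) tt)))).
  by move=> g; rewrite size_behead size_nseq.
exact/PT_sizeu/PT_obehead/PT_units.
Qed.

Lemma pb_exp A (m f : A -> nat) k : pb m f -> pb m (fun x => f x ^ k).
Proof.
move=> H; elim: k => [|k IH]; first exact: pb_const.
apply: (@pb_le _ _ (fun x => f x * f x ^ k)) => [x|]; first by rewrite expnS.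
exact: pb_mul.
Qed.

(** * Folds bounded step by step, and list functions *)

Section FoldVariants.
Context {G X S Y : Type} {EG : Enc G} {EX : Enc X} {ES : Enc S} {EY : Enc Y}.
Implicit Types (l : G -> seq X) (i : G -> S) (st : G -> S -> X -> S).

(** An invariant indexed by the number of steps made reduces the bound on all accumulators to a
    check of a single step. *)
Lemma PT_foldl_inv l i st (I : G -> nat -> S -> Prop) (bd : G -> nat) :
  PT l -> PT i -> PT (fun p : G * S * X => st p.1.1 p.1.2 p.2) -> pb sz bd ->
  (forall g, I g 0 (i g)) ->
  (forall g k s x, k < size (l g) -> sz x <= sz (l g) -> I g k s -> I g k.+1 (st g s x)) ->
  (forall g k s, k <= size (l g) -> I g k s -> sz s <= bd g) ->
  PT (fun g => foldl (st g) (i g) (l g)).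
Proof.
move=> Pl Pi Pst Pbd I0 IS Ib; apply: (PT_foldl (bd := bd)) => // g k.
have szc (u v : seq X) : sz u <= sz (u ++ v).
  by elim: u => [|y u IH]; rewrite ?sz_gt0 // cat_cons !sz_cons; lia.
have H (r : seq X) j s : j + size r <= size (l g) -> sz r <= sz (l g) -> I g j s ->
    I g (j + size r) (foldl (st g) s r).
  elim: r j s => [|x r IH] j s; first by rewrite addn0.
  rewrite sz_cons /= addnS -addSn => le le2 Hs; apply: IH; [by [] | lia |].
  by apply: IS => //; lia.
apply: (Ib g (0 + size (take k (l g)))).
  by rewrite add0n size_take_min geq_minr.
apply: H => //; first by rewrite add0n size_take_min geq_minr.
by rewrite -{2}(cat_take_drop k (l g)).
Qed.

(** Growth per step by an amount that depends on the context alone sums to this amount times the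
    length of the list. *)
Lemma PT_foldl_add l i st (q : G -> nat) :
  PT l -> PT i -> PT (fun p : G * S * X => st p.1.1 p.1.2 p.2) -> pb sz q ->
  (forall g s x, sz x <= sz (l g) -> sz (st g s x) <= sz s + q g) ->
  PT (fun g => foldl (st g) (i g) (l g)).
Proof.
move=> Pl Pi Pst Pq Hq.
apply: (PT_foldl_inv (I := fun g k s => sz s <= sz (i g) + k * q g)
  (bd := fun g => sz (i g) + sz (l g) * q g)) => //.
- have := PT_size Pl; have := PT_size Pi; by move=> *; pb_tac.
- by move=> g; lia.
- by move=> g k s x _ Hx Hs; apply: leq_trans (Hq _ _ _ Hx) _; rewrite mulSn; lia.
- move=> g k s Hk Hs; apply: leq_trans Hs _; rewrite leq_add2l leq_mul //.
  by apply: leq_trans Hk _; apply/ltnW/leq_size_sz.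
Qed.

Lemma PT_bound l (h : G -> X -> Y) :
  PT l -> PT (fun p : G * X => h p.1 p.2) ->
  exists2 q, pb sz q & forall g x, sz x <= sz (l g) -> sz (h g x) <= q g.
Proof.
move=> Pl Ph; have := PT_size Pl; have [k Hk] := PT_size Ph => Hl.
exists (fun g => (sz g + sz (l g) + 3) ^ k).
  by apply: pb_exp; pb_tac.
move=> g x Hx; apply: leq_trans (Hk (g, x)) _; apply: leq_exp2r'.
by rewrite sz_pair; lia.
Qed.
End FoldVariants.

Lemma PT_rev {G X} {EG : Enc G} {EX : Enc X} (s : G -> seq X) :
  PT s -> PT (fun g => rev (s g)).
Proof.
move=> Ps; apply: (PT_ext (f := fun g => foldl (fun a x => x :: a) [::] (s g))).
  by move=> g; rewrite -[RHS]cats0 -/(catrev _ _) /=; elim: (s g) [::] => [|x r IH] a //=;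
   rewrite IH rev_cons cat_rcons.
apply: (PT_foldl_add (q := fun g => sz (s g) + 1)) => //.
- exact: PT_const.
- exact: PT_cons (PT_osnd (PT_id)) (PT_osnd (PT_ofst PT_id)).
- have := PT_size Ps; by move=> *; pb_tac.
- by move=> g a x H; rewrite /= sz_cons; lia.
Qed.

Lemma sz_cat {X} {EX : Enc X} (s t : seq X) : (sz (s ++ t)).+1 = sz s + sz t.
Proof. by elim: s => [|x s IH]; rewrite ?sz_nil // cat_cons !sz_cons; lia. Qed.

Lemma sz_rev {X} {EX : Enc X} (s : seq X) : sz (rev s) = sz s.
Proof.
elim: s => [|x s IH] //; rewrite rev_cons -cats1 sz_cons.
by apply: succn_inj; rewrite sz_cat sz_cons sz_nil; lia.
Qed.

Lemma PT_cat {G X} {EG : Enc G} {EX : Enc X} (s t : G -> seq X) :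
  PT s -> PT t -> PT (fun g => s g ++ t g).
Proof.
move=> Ps Pt; apply: (PT_ext (f := fun g => foldl (fun a x => x :: a) (t g) (rev (s g)))).
  by move=> g; rewrite -[in RHS](revK (s g)); elim: (rev (s g)) (t g) => [|x r IH] a //=;
   rewrite IH rev_cons cat_rcons.
apply: (PT_foldl_add (q := fun g => sz (s g) + 1)) => //.
- exact: PT_rev.
- exact: PT_cons (PT_osnd (PT_id)) (PT_osnd (PT_ofst PT_id)).
- have := PT_size Ps; by move=> *; pb_tac.
- by move=> g a x; rewrite sz_rev /= sz_cons => H; lia.
Qed.

Lemma PT_rcons {G X} {EG : Enc G} {EX : Enc X} (s : G -> seq X) (x : G -> X) :
  PT s -> PT x -> PT (fun g => rcons (s g) (x g)).
Proof.
move=> Ps Px; apply: (PT_ext (f := fun g => s g ++ [:: x g])) => [g|]; first by rewrite cats1.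
by apply: PT_cat => //; apply: PT_cons => //; apply: PT_const.
Qed.

Lemma PT_map {G X Y} {EG : Enc G} {EX : Enc X} {EY : Enc Y} (l : G -> seq X)
    (h : G -> X -> Y) :
  PT l -> PT (fun p : G * X => h p.1 p.2) -> PT (fun g => map (h g) (l g)).
Proof.
move=> Pl Ph; have [q Pq Hq] := PT_bound Pl Ph.
apply: (PT_ext (f := fun g => rev (foldl (fun a x => h g x :: a) [::] (l g)))).
  move=> g; rewrite -[RHS](revK (map _ _)) -[in RHS](cats0 (rev (map _ _))); congr rev.
  by elim: (l g) [::] => [|x r IH] a //=; rewrite IH rev_cons cat_rcons.
apply: PT_rev; apply: (PT_foldl_add (q := fun g => q g + 1)) => //.
- exact: PT_const.
- apply: PT_cons; last exact: PT_osnd (PT_ofst PT_id).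
  apply: (PT_comp (f := fun p : G * seq Y * X => (p.1.1, p.2)) Ph).
  apply: PT_pair; [exact: PT_ofst (PT_ofst PT_id) | exact: PT_osnd PT_id].
- by pb_tac.
- by move=> g a x H; rewrite /= sz_cons; have := Hq _ _ H; lia.
Qed.

Lemma PT_flatten {G X} {EG : Enc G} {EX : Enc X} (s : G -> seq (seq X)) :
  PT s -> PT (fun g => flatten (s g)).
Proof.
move=> Ps; apply: (PT_ext (f := fun g => foldl (fun a x => a ++ x) [::] (s g))).
  move=> g; rewrite -[RHS]cat0s; elim: (s g) [::] => [|x r IH] a /=; first by rewrite cats0.
  by rewrite IH catA.
apply: (PT_foldl_add (q := fun g => sz (s g))) => //.
- exact: PT_const.
- exact: PT_cat (PT_osnd (PT_ofst PT_id)) (PT_osnd (PT_id)).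
- exact: PT_size.
- by move=> g a x H; rewrite -ltnS sz_cat; lia.
Qed.

Lemma PT_osize {G X} {EG : Enc G} {EX : Enc X} (s : G -> seq X) :
  PT s -> PT (fun g => size (s g)).
Proof.
move=> Ps; apply: (PT_ext (f := fun g => size (map (fun _ => tt) (s g)))).
  by move=> g; rewrite size_map.
by apply: PT_sizeu; apply: PT_map => //; apply: PT_const.
Qed.

Lemma PT_all {G X} {EG : Enc G} {EX : Enc X} (l : G -> seq X) (p : G -> X -> bool) :
  PT l -> PT (fun q : G * X => p q.1 q.2) -> PT (fun g => all (p g) (l g)).
Proof.
move=> Pl Pp; apply: (PT_ext (f := fun g => foldl (fun b x => b && p g x) true (l g))).
  move=> g; rewrite -[RHS]andTb; elim: (l g) true => [|x r IH] b //=; first by rewrite andbT.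
  by rewrite IH andbA.
apply: (PT_foldl_add (q := fun g => 3)) => //.
- exact: PT_const.
- apply: PT_and; first exact: PT_osnd (PT_ofst PT_id).
  apply: (PT_comp (f := fun p : G * bool * X => (p.1.1, p.2)) Pp).
  apply: PT_pair; [exact: PT_ofst (PT_ofst PT_id) | exact: PT_osnd PT_id].
- by pb_tac.
- by move=> g a x H; have := sz_bool (a && p g x); lia.
Qed.

Lemma PT_mem {G} {X : eqType} {EG : Enc G} {EX : Enc X} (x : G -> X) (l : G -> seq X) :
  PT x -> PT l -> PT (fun g => x g \in l g).
Proof.
move=> Px Pl; apply: (PT_ext (f := fun g => ~~ all (fun y => y != x g) (l g))).
  by move=> g; rewrite -has_predC -has_pred1; apply: eq_has => y /=; rewrite negbK.
apply: PT_not; apply: PT_all => //; apply: PT_not; apply: PT_eq; first exact: PT_osnd PT_id.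
exact: PT_comp (PT_ofst PT_id).
Qed.

Lemma PT_nth {G X} {EG : Enc G} {EX : Enc X} (d : G -> X) (l : G -> seq X) (n : G -> nat) :
  PT d -> PT l -> PT n -> PT (fun g => nth (d g) (l g) (n g)).
Proof.
move=> Pd Pl Pn.
apply: (PT_ext (f := fun g => (foldl (fun st x => (st.1.+1, if st.1 == n g then x else st.2))
    (0, d g) (l g)).2)).
  move=> g.
  have H k (y : X) (r : seq X) : (foldl (fun (st : nat * X) x => (st.1.+1, if st.1 == n g then x else st.2)) (k, y) r).2 =
      if k <= n g then nth y r (n g - k) else y.
    elim: r k y => [|x r IH] k y /=; first by rewrite nth_nil if_same.
    rewrite IH; case: (ltngtP k (n g)) => [lt|gt|->].
    - by have -> : n g - k = (n g - k.+1).+1 by lia.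
    - by [].
    - by rewrite subnn.
  by rewrite H subn0.
apply: PT_osnd; apply: (PT_foldl_inv (bd := fun g => 2 * sz (l g) + 3 + sz (d g) + sz (l g))
  (I := fun g k st => st.1 = k /\ sz st.2 <= sz (d g) + sz (l g))) => //.
- by apply: PT_pair => //; apply: PT_const.
- have P2 : PT (fun p : G * (nat * X) * X => p.1.2) by exact: PT_osnd (PT_ofst PT_id).
  apply: PT_pair; first exact: PT_S (PT_ofst P2).
  apply: PT_if; [|exact: PT_osnd PT_id | exact: PT_osnd P2].
  by apply: PT_eq; [exact: PT_ofst P2 | exact: (PT_comp Pn) (PT_ofst (PT_ofst PT_id))].
- have := PT_size Pd; have := PT_size Pl; by move=> *; pb_tac.
- by move=> g; split => //=; lia.
- move=> g k [a y] x _ Hx [/= -> Hy]; split => //; case: ifP => _; lia.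
- move=> g k [a y] Hk [/= -> Hy]; rewrite sz_pair sz_nat.
  have H : size (l g) < sz (l g) by apply: leq_size_sz.
  by lia.
Qed.

Lemma PT_iota {G} {EG : Enc G} (n : G -> nat) : PT n -> PT (fun g => iota 0 (n g)).
Proof.
move=> Pn; apply: (PT_ext (f := fun g => rev (foldl (fun a _ => size a :: a) [::] (nseq (n g) tt)))).
  move=> g; rewrite -[RHS]revK; congr rev.
  have H k m : foldl (fun a (_ : unit) => size a :: a) (rev (iota 0 k)) (nseq m tt) = rev (iota 0 (k + m)).
    elim: m k => [|m IH] k /=; first by rewrite addn0.
    rewrite size_rev size_iota -[k :: rev _]rev_rcons -cats1 -(iotaD 0 k 1) IH.
    by rewrite addn1 addSnnS.
  exact: (H 0).
apply: PT_rev; apply: (PT_foldl_inv (bd := fun g => sz (n g) * (2 * sz (n g) + 2) + 1)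
  (I := fun g k s => size s = k /\ sz s <= k * (2 * sz (n g) + 2) + 1)).
- exact: PT_units.
- exact: PT_const.
- have P2 : PT (fun p : G * seq nat * unit => p.1.2) by exact: PT_osnd (PT_ofst PT_id).
  by apply: PT_cons => //; apply: PT_osize.
- have := PT_size Pn; by move=> *; pb_tac.
- by [].
- move=> g k s []; rewrite size_nseq => Hk _ [Es Hs]; split; first by rewrite /= Es.
  by rewrite sz_cons sz_nat Es mulSn sz_nat; move: Hs; rewrite sz_nat; lia.
- move=> g k s; rewrite size_nseq => Hk [_ Hs]; apply: leq_trans Hs _.
  by rewrite leq_add2r leq_mul // sz_nat; lia.
Qed.

Lemma PT_nseq {G X} {EG : Enc G} {EX : Enc X} (n : G -> nat) (x : G -> X) :
  PT n -> PT x -> PT (fun g => nseq (n g) (x g)).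
Proof.
move=> Pn Px; apply: (PT_ext (f := fun g => map (fun _ => x g) (nseq (n g) tt))).
  by move=> g; rewrite map_nseq.
by apply: PT_map; [exact: PT_units | exact: (PT_comp Px) (PT_ofst PT_id)].
Qed.

Lemma PT_addn {G} {EG : Enc G} (m n : G -> nat) : PT m -> PT n -> PT (fun g => m g + n g).
Proof.
move=> Pm Pn; apply: (PT_ext (f := fun g => size (nseq (m g) tt ++ nseq (n g) tt))).
  by move=> g; rewrite size_cat !size_nseq.
by apply/PT_sizeu/PT_cat; apply: PT_units.
Qed.

(** * The algorithm *)

Ltac pt_user := fail.
Ltac pt_step := lazymatch goal with
  | H : PT ?f |- PT ?f => exact: H
  | |- PT (fun x => x) => exact: PT_id
  | |- PT fst => exact: PT_fst
  | |- PT snd => exact: PT_snd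
  | |- PT (fun _ => ?c) => exact: PT_const
  | |- PT (fun x => fst (@?f x)) => apply: (PT_ofst (f := f))
  | |- PT (fun x => snd (@?f x)) => apply: (PT_osnd (f := f))
  | |- PT (fun x => (@?f x, @?h x)) => apply: (PT_pair (f := f) (g := h))
  | |- PT (fun x => @?f x :: @?h x) => apply: (PT_cons (a := f) (s := h))
  | |- PT (fun x => (@?f x) ++ (@?h x)) => apply: (PT_cat (s := f) (t := h))
  | |- PT (fun x => rcons (@?f x) (@?h x)) => apply: (PT_rcons (s := f) (x := h))
  | |- PT (fun x => (@?f x) && (@?h x)) => apply: (PT_and (a := f) (b := h))
  | |- PT (fun x => ~~ (@?f x)) => apply: (PT_not (a := f))
  | |- PT (fun x => (@?f x) == (@?h x)) => apply: (PT_eq (a := f) (b := h))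
  | |- PT (fun x => (@?f x) \in (@?h x)) => apply: (PT_mem (x := f) (l := h))
  | |- PT (fun x => (@?f x).-1) => apply: (PT_pred (n := f))
  | |- PT (fun x => (@?f x).+1) => apply: (PT_S (n := f))
  | |- PT (fun x => (@?f x) + (@?h x)) => apply: (PT_addn (m := f) (n := h))
  | |- PT (fun x => rev (@?f x)) => apply: (PT_rev (s := f))
  | |- PT (fun x => size (@?f x)) => apply: (PT_osize (s := f))
  | |- PT (fun x => behead (@?f x)) => apply: (PT_obehead (s := f))
  | |- PT (fun x => flatten (@?f x)) => apply: (PT_flatten (s := f))
  | |- PT (fun x => iota 0 (@?f x)) => apply: (PT_iota (n := f))
  | |- PT (fun x => nseq (@?f x) (@?h x)) => apply: (PT_nseq (n := f) (x := h))
  | |- PT (fun x => nth (@?d x) (@?f x) (@?h x)) => apply: (PT_nth (d := d) (l := f) (n := h))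
  | |- PT (fun x => map (@?h x) (@?f x)) => apply: (PT_map (h := h) (l := f))
  | |- PT (fun x => all (@?h x) (@?f x)) => apply: (PT_all (p := h) (l := f))
  | H : PT ?f |- PT (fun x => ?f (@?a x)) => apply: (PT_comp (f := a) H)
  | _ => first [pt_user | apply: PT_if]
  end.
Ltac pt := repeat (pt_step; cbv beta).

Lemma sz_true : sz true = 3. Proof. by []. Qed.
Lemma sz_false : sz false = 1. Proof. by []. Qed.

(** * Parsing the operation tables *)

Definition parse_nats (bits : seq bool) : seq nat :=
  rev (foldl (fun (st : seq nat * nat) b => if b then (st.1, st.2.+1) else (st.2 :: st.1, 0))
    ([::], 0) bits).1.

Lemma PT_parse_nats : PT parse_nats.
Proof.
rewrite /parse_nats; apply: PT_rev; apply: PT_ofst.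
apply: (PT_foldl_add (q := fun=> 5)); pt.
  exact: pb_const.
move=> g [s n] b _ /=; case: b; rewrite !sz_pair ?sz_cons !sz_nat; lia.
Qed.

Definition row := (nat * (seq nat * nat))%type.

(** Adding one in base m + 1, the flag being the carry. A carry out of the last digit tells that all
    tuples have been seen. *)
Definition incr_step m (st : bool * seq nat) (d : nat) : bool * seq nat :=
  if st.1 then (if d == m then (true, 0 :: st.2) else (false, d.+1 :: st.2))
  else (false, d :: st.2).
Definition incr m (rt : seq nat) : bool * seq nat :=
  ((foldl (incr_step m) (true, [::]) rt).1, rev (foldl (incr_step m) (true, [::]) rt).2).

Lemma PT_incr {G} {EG : Enc G} (m : G -> nat) (rt : G -> seq nat) :
  PT m -> PT rt -> PT (fun g => incr (m g) (rt g)).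
Proof.
move=> Pm Pr; rewrite /incr.
have H : PT (fun g => foldl (incr_step (m g)) (true, [::]) (rt g)).
  apply: (PT_foldl_add (q := fun g => sz (rt g) + 10)); rewrite /incr_step; pt.
    by apply: pb_add; [exact: PT_size | exact: pb_const].
  move=> g [b s] x Hx /=; case: b; last by rewrite !sz_pair sz_cons; lia.
  by case: ifP => _; rewrite !sz_pair sz_cons ?(sz_nat 0) ?(sz_nat x.+1) ?sz_true ?sz_false;
    move: Hx; rewrite sz_nat; lia.
by pt.
Qed.

(* The digits of the current tuple are stored least significant first, and
   [m] is the largest digit; the flag tells whether a table is being read. *)
Definition pstate := ((bool * seq nat) * (nat * seq row))%type.
Definition parse_step m (st : pstate) (v : nat) : pstate :=
  if st.1.1 then
    ((~~ (incr m st.1.2).1, (incr m st.1.2).2),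
     (if (incr m st.1.2).1 then st.2.1.+1 else st.2.1, (st.2.1, (rev st.1.2, v)) :: st.2.2))
  else ((true, nseq v 0), st.2).
Definition parse_rows m (body : seq nat) : seq row :=
  (foldl (parse_step m) ((false, [::]), (0, [::])) body).2.2.

Lemma incr_bound m rt : all (fun d => d <= m) rt ->
  size (incr m rt).2 = size rt /\ all (fun d => d <= m) (incr m rt).2.
Proof.
move=> H; rewrite /incr /= size_rev all_rev.
have G st : all (fun d => d <= m) st.2 ->
    size (foldl (incr_step m) st rt).2 = size rt + size st.2 /\
    all (fun d => d <= m) (foldl (incr_step m) st rt).2.
  elim: rt H st => [|d r IH] //= /andP[Hd Hr] [b s] /= Hs.
  rewrite addSnnS; rewrite /incr_step /=; case: b; last first.
    by apply: (IH Hr (false, d :: s)); rewrite /= Hd.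
  case: eqP => E; first exact: (IH Hr (true, 0 :: s)).
  by apply: (IH Hr (false, d.+1 :: s)); rewrite /= Hs andbT; lia.
by have [] := G (true, [::]) isT; rewrite addn0.
Qed.

Lemma sz_seq_nat m s : all (fun d => d <= m) s -> sz s <= size s * (2 * m + 2) + 1.
Proof.
elim: s => [|d s IH] // /andP[Hd /IH Hs]; rewrite sz_cons sz_nat /= mulSn; lia.
Qed.

(** Must hold for lists that encode no algebra as well. The digits never exceed [m], and their
    number is an arity read from [body], which is coded in unary and so is at most the size of
    [body]. *)
Lemma PT_parse_rows {G} {EG : Enc G} (m : G -> nat) (body : G -> seq nat) :
  PT m -> PT body -> PT (fun g => parse_rows (m g) (body g)).
Proof.
move=> Pm Pb; rewrite /parse_rows; apply: PT_osnd; apply: PT_osnd.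
have Sm := PT_size Pm; have Sb := PT_size Pb.
pose tb g := @sz _ (@Enc_seq _ Enc_nat) (body g) * (2 * @sz _ Enc_nat (m g) + 2) + 1.
pose Q g := 3 * @sz _ (@Enc_seq _ Enc_nat) (body g) + tb g + 10.
have PQ : pb sz Q by rewrite /Q /tb; pb_tac.
apply: (PT_foldl_inv (bd := fun g => tb g + 10 + 2 * sz (body g) + (sz (body g) * Q g + 1))
  (I := fun g k (st : pstate) => [/\ size st.1.2 <= sz (body g),
     all (fun d => d <= m g) st.1.2, st.2.1 <= k & sz st.2.2 <= k * Q g + 1])).
- by [].
- by pt.
- rewrite /parse_step.
  have PI : PT (fun p : G * pstate * nat => incr (m p.1.1) p.1.2.1.2) by apply: PT_incr; pt.
  by pt.
- by rewrite /tb; pb_tac.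
- by [].
- move=> g k [[b rt] [j rows]] v /= Hk Hv [H1 H2 H3 H4].
  rewrite /parse_step /=; case: b => /=; last first.
    split => //; try by lia.
    + by rewrite size_nseq; move: Hv; rewrite sz_nat; lia.
    + by rewrite all_nseq orbT.
  have [I1 I2] := incr_bound H2; split => //.
  + by rewrite I1.
  + by case: ifP => _; lia.
  + rewrite sz_cons !sz_pair sz_rev mulSn sz_nat.
    have T := sz_seq_nat H2.
    have T2 : size rt * (2 * m g + 2) <= sz (body g) * (2 * sz (m g) + 2).
      by rewrite leq_mul // sz_nat; lia.
    have L : size (body g) < sz (body g) by apply: leq_size_sz.
    have QE : Q g = 3 * sz (body g) + tb g + 10 by [].
    have TE : tb g = sz (body g) * (2 * sz (m g) + 2) + 1 by [].
    by move: (Q g) (tb g) QE TE H4 => q t QE TE H4; lia.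
- move=> g k [[b rt] [j rows]] /= Hk [H1 H2 H3 H4].
  rewrite !sz_pair [sz j]sz_nat.
  have T := sz_seq_nat H2.
  have T2 : size rt * (2 * m g + 2) <= sz (body g) * (2 * sz (m g) + 2).
    by rewrite leq_mul // sz_nat; lia.
  have L : size (body g) < sz (body g) by apply: leq_size_sz.
  have T3 : k * Q g <= sz (body g) * Q g by rewrite leq_mul //; lia.
  have TE : tb g = sz (body g) * (2 * sz (m g) + 2) + 1 by [].
  by have := sz_bool b; move: (Q g) (tb g) TE T3 H4 => q t TE T3 H4; lia.
Qed.

(** * Evaluating gate lists *)

Definition lookup (rows : seq row) (j : nat) (args : seq nat) : nat :=
  foldl (fun acc (r : row) => if (r.1 == j) && (r.2.1 == args) then r.2.2 else acc) 0 rows.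

Lemma PT_lookup {G} {EG : Enc G} (rows : G -> seq row) j args :
  PT rows -> PT j -> PT args -> PT (fun g => lookup (rows g) (j g) (args g)).
Proof.
move=> Pr Pj Pa; rewrite /lookup.
apply: (PT_foldl_add (q := fun g => sz (rows g))); pt.
  exact: PT_size.
move=> g s [k [a v]] /=; rewrite !sz_pair => H; case: ifP => _; lia.
Qed.

Lemma lookup_bound rows j args : sz (lookup rows j args) <= sz rows.
Proof.
rewrite /lookup; have H (B : nat) (r : seq row) s : sz r <= B -> sz s <= B ->
   sz (foldl (fun acc (r : row) => if (r.1 == j) && (r.2.1 == args) then r.2.2 else acc) s r) <= B.
  elim: r s => [|[k [a v]] r IH] s //= H Hs.
  apply: IH; first by move: H; rewrite sz_cons; lia.
  by case: ifP => _ //; move: H; rewrite sz_cons !sz_pair; lia.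
by apply: H => //; apply: sz_gt0.
Qed.

Definition gate := (nat * seq nat)%type.
(** The values of all vertices so far: the three inputs come first, so gate [i] is vertex
    [3 + i]. *)
Definition vals (rows : seq row) (P : seq gate) (env : seq nat) : seq nat :=
  foldl (fun vs (g : gate) => rcons vs (lookup rows g.1 (map (nth 0 vs) g.2))) env P.

Lemma PT_vals {G} {EG : Enc G} (rows : G -> seq row) P env :
  PT rows -> PT P -> PT env -> PT (fun g => vals (rows g) (P g) (env g)).
Proof.
move=> Pr PP Pe; rewrite /vals.
apply: (PT_foldl_add (q := fun g => sz (rows g) + 1)) => //.
- apply: PT_rcons; first by pt.
  by apply: PT_lookup; pt.
- by apply: pb_add; [exact: PT_size | exact: pb_const].
- move=> g s x _; rewrite -cats1 -ltnS sz_cat sz_cons sz_nil.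
  have := lookup_bound (rows g) x.1 (map (nth 0 s) x.2); lia.
Qed.

(** * Closures in the square and the two nested loops *)

Definition key := (nat * nat)%type.
(** An element of A^2 with three vertices, where the term that generates it is applied to the three
    vertex columns of [gens]. *)
Definition elem := (key * (nat * (nat * nat)))%type.
Definition clstate := (seq gate * seq elem)%type.

Definition keys (S : seq elem) : seq key := map fst S.
Definition find_elem (S : seq elem) (k : key) : nat * (nat * nat) :=
  foldl (fun acc (e : elem) => if e.1 == k then e.2 else acc) (0, (0, 0)) S.
Definition argkeys (r1 r2 : row) : seq key :=
  [seq (nth 0 r1.2.1 i, nth 0 r2.2.1 i) | i <- iota 0 (size r1.2.1)].
Definition fires (S : seq elem) (r1 r2 : row) : bool :=
  (r1.1 == r2.1) && (all (fun k => k \in keys S) (argkeys r1 r2) &&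
    ((r1.2.2, r2.2.2) \notin keys S)).
Definition cl_step (st : clstate) (rr : row * row) : clstate :=
  if fires st.2 rr.1 rr.2 then
    (st.1 ++ [:: (rr.1.1, [seq (find_elem st.2 k).1 | k <- argkeys rr.1 rr.2]);
                 (rr.1.1, [seq (find_elem st.2 k).2.1 | k <- argkeys rr.1 rr.2]);
                 (rr.1.1, [seq (find_elem st.2 k).2.2 | k <- argkeys rr.1 rr.2])],
     ((rr.1.2.2, rr.2.2.2), (size st.1 + 3, (size st.1 + 4, size st.1 + 5))) :: st.2)
  else st.
(** The list [prs] is a clock that ticks |A|^2 times. *)
Definition saturate (prs : seq (nat * nat)) (rp : seq (row * row)) (st : clstate) : clstate :=
  foldl (fun st _ => foldl cl_step st rp) st prs.

(** With [u] = (U, (V, U')), the columns are (a,e0,e0) and (e,e,d) for the keys, and (U,V,T),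
    (V,V,T), (U',W,W) for the vertices. *)
Definition gens a e e0 d (u : nat * (nat * nat)) w t : seq elem :=
  [:: ((a, e), u); ((e0, e), (u.2.1, (u.2.1, w))); ((e0, d), (t, (t, w)))].

Definition istate := ((bool * seq gate) * (nat * (nat * nat)))%type.
(** The vertex V of s(W,W,T) has the value s(c,c,d) at (c,c,d), since t(c,c,c) = c and t(c,c,d) =
    d. *)
Definition in_eval (rows : seq row) (st : istate) (cd : nat * nat) : nat :=
  nth 0 (vals rows st.1.2 [:: cd.1; cd.1; cd.2]) st.2.2.1.
Definition in_clos prs rp rows a e0 t w (st : istate) (cd : nat * nat) : clstate :=
  saturate prs rp (st.1.2, gens a (in_eval rows st cd) e0 cd.2 st.2 w t).
Definition in_step prs rp rows a e0 t w (st : istate) (cd : nat * nat) : istate :=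
  ((st.1.1 && ((a, cd.2) \in keys (in_clos prs rp rows a e0 t w st cd).2),
    (in_clos prs rp rows a e0 t w st cd).1),
   find_elem (in_clos prs rp rows a e0 t w st cd).2 (a, cd.2)).

Definition ostate := ((bool * seq gate) * (nat * nat))%type.
Definition out_eval (rows : seq row) (st : ostate) (ab : nat * nat) : nat :=
  nth 0 (vals rows st.1.2 [:: ab.1; ab.2; ab.2]) st.2.1.
(** The start is s(x,y,z) = x: then s(x,W,T) and s(x,W,W) are the input x, vertex 0, and s(W,W,T) is
    W. *)
Definition inner prs rp rows (st : ostate) (ab : nat * nat) : istate :=
  foldl (in_step prs rp rows ab.1 (out_eval rows st ab) st.2.1 st.2.2)
    (st.1, (0, (st.2.2, 0))) prs.
Definition out_step prs rp rows (st : ostate) (ab : nat * nat) : ostate :=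
  ((inner prs rp rows st ab).1,
   ((inner prs rp rows st ab).2.1, (inner prs rp rows st ab).2.2.2)).
(** For t = z, vertex 2, the term t(x,y,y) is y, vertex 1. *)
Definition solve prs rp rows : ostate :=
  foldl (out_step prs rp rows) ((true, [::]), (2, 1)) prs.

(** * The algorithm runs in polynomial time *)

Lemma PT_find_elem {G} {EG : Enc G} (S : G -> seq elem) k :
  PT S -> PT k -> PT (fun g => find_elem (S g) (k g)).
Proof.
move=> PS Pk; rewrite /find_elem.
apply: (PT_foldl_add (q := fun g => sz (S g))); pt.
  exact: PT_size.
move=> g s [k' i] /=; rewrite sz_pair => H; case: ifP => _; lia.
Qed.

Lemma PT_keys {G} {EG : Enc G} (S : G -> seq elem) : PT S -> PT (fun g => keys (S g)).
Proof. by move=> PS; rewrite /keys; pt. Qed.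

Lemma PT_argkeys {G} {EG : Enc G} (r1 r2 : G -> row) :
  PT r1 -> PT r2 -> PT (fun g => argkeys (r1 g) (r2 g)).
Proof. by move=> P1 P2; rewrite /argkeys; pt. Qed.

Ltac pt_user ::= lazymatch goal with
  | |- PT (fun x => lookup (@?a x) (@?b x) (@?c x)) =>
      apply: (PT_lookup (rows := a) (j := b) (args := c))
  | |- PT (fun x => vals (@?a x) (@?b x) (@?c x)) =>
      apply: (PT_vals (rows := a) (P := b) (env := c))
  | |- PT (fun x => find_elem (@?a x) (@?b x)) => apply: (PT_find_elem (S := a) (k := b))
  | |- PT (fun x => argkeys (@?a x) (@?b x)) => apply: (PT_argkeys (r1 := a) (r2 := b))
  | |- PT (fun x => keys (@?a x)) => apply: (PT_keys (S := a))
  end.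

Lemma PT_cl_step {G} {EG : Enc G} (st : G -> clstate) (rr : G -> row * row) :
  PT st -> PT rr -> PT (fun g => cl_step (st g) (rr g)).
Proof.
by move=> Ps Pr; rewrite /cl_step; apply: PT_if; rewrite /fires; pt.
Qed.

(* Every number occurring in the state is bounded: [R] bounds the keys, the
   operation symbols and the arities, [B] the vertex numbers. *)
Definition gate_le R B (g : gate) :=
  [&& sz g.1 <= R, size g.2 <= R & all (fun i => i <= B) g.2].
Definition elem_le R B (e : elem) :=
  [&& sz e.1 <= R, e.2.1 <= B, e.2.2.1 <= B & e.2.2.2 <= B].
Definition cl_le R B a b (st : clstate) :=
  [/\ all (gate_le R B) st.1, all (elem_le R B) st.2, size st.1 <= a & size st.2 <= b].

Definition gate_sz R B := R + (R * (2 * B + 2) + 1) + 2.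
Lemma sz_gates R B (P : seq gate) : all (gate_le R B) P -> sz P <= size P * gate_sz R B + 1.
Proof.
elim: P => [|[j s] P IH] // /andP[/and3P[/= H1 H2 H3] /IH H].
have H4 := sz_seq_nat H3; have H5 : size s * (2 * B + 2) <= R * (2 * B + 2) by rewrite leq_mul.
by rewrite sz_cons sz_pair mulSn {1}/gate_sz; lia.
Qed.

Definition elem_sz R B := R + 6 * B + 10.
Lemma sz_elems R B (S : seq elem) : all (elem_le R B) S -> sz S <= size S * elem_sz R B + 1.
Proof.
elim: S => [|[k [u [v w]]] S IH] // /andP[/and4P[/= H1 H2 H3 H4] /IH H].
by rewrite sz_cons !sz_pair mulSn {1}/elem_sz !sz_nat; lia.
Qed.

Lemma sz_cl R B a b (st : clstate) : cl_le R B a b st -> sz st <= a * gate_sz R B + b * elem_sz R B + 3.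
Proof.
case: st => P S [/= H1 H2 H3 H4]; rewrite sz_pair.
have K1 := sz_gates H1; have K2 := sz_elems H2.
have K3 : size P * gate_sz R B <= a * gate_sz R B by rewrite leq_mul.
have K4 : size S * elem_sz R B <= b * elem_sz R B by rewrite leq_mul.
by lia.
Qed.

Lemma gates_le_sz (P : seq gate) : all (gate_le (sz P) (sz P)) P.
Proof.
have H (Q : nat) (s : seq nat) : sz s <= Q -> all (fun i => i <= Q) s.
  elim: s => [|x s IH] //; rewrite sz_cons sz_nat /= => H; rewrite IH ?andbT; lia.
have K (Q : nat) : sz P <= Q -> all (gate_le Q Q) P.
  elim: P => [|[j s] P IH] //; rewrite sz_cons sz_pair /= => le.
  have L : size s < sz s by apply: leq_size_sz.
  rewrite IH ?andbT; last by lia.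
  by rewrite /gate_le /= H; lia.
exact: K.
Qed.

Lemma elems_le_sz (S : seq elem) : all (elem_le (sz S) (sz S)) S.
Proof.
have K (Q : nat) : sz S <= Q -> all (elem_le Q Q) S.
  elim: S => [|[k [u [v w]]] S IH] //; rewrite sz_cons !sz_pair !sz_nat /= => le.
  by rewrite IH ?andbT /elem_le /=; lia.
exact: K.
Qed.

Lemma gate_le_mono R B R' B' : R <= R' -> B <= B' ->
  forall g, gate_le R B g -> gate_le R' B' g.
Proof.
move=> HR HB [j s] /and3P[/= H1 H2 H3]; apply/and3P; split=> /=; try lia.
by apply: sub_all H3 => i; lia.
Qed.
Lemma elem_le_mono R B R' B' : R <= R' -> B <= B' ->
  forall e, elem_le R B e -> elem_le R' B' e.
Proof.
by move=> HR HB [k [u [v w]]] /and4P[/= H1 H2 H3 H4]; apply/and4P; split=> /=; lia.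
Qed.

Lemma cl_le_sz R B (st : clstate) : sz st <= R -> sz st <= B -> cl_le R B (size st.1) (size st.2) st.
Proof.
case: st => P S; rewrite sz_pair => HR HB; split=> //=.
  by apply: sub_all (gates_le_sz P); apply: gate_le_mono; lia.
by apply: sub_all (elems_le_sz S); apply: elem_le_mono; lia.
Qed.

Lemma find_elem_le R B S k : all (elem_le R B) S ->
  [/\ (find_elem S k).1 <= B, (find_elem S k).2.1 <= B & (find_elem S k).2.2 <= B].
Proof.
rewrite /find_elem; have : [/\ (0, (0, 0)).1 <= B, (0, (0, 0)).2.1 <= B & (0, (0, 0)).2.2 <= B].
  by [].
elim: S (0, (0, 0)) => [|e S IH] // s Hs /= /andP[/and4P[_ H1 H2 H3] HS].
by apply: IH HS; case: ifP.
Qed.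

(** The slack 5 is for the third new vertex, which comes after the three inputs, the old gates and
    two new gates. *)
Lemma cl_step_le R B a b (st : clstate) (rr : row * row) : sz rr <= R -> a + 5 <= B -> cl_le R B a b st ->
  cl_le R B (a + 3) (b + 1) (cl_step st rr).
Proof.
move=> Hr HB [H1 H2 H3 H4]; rewrite /cl_step; case: ifP => _; last by split => //; lia.
have HF k := find_elem_le k H2.
have Ha : size (argkeys rr.1 rr.2) <= R.
  rewrite size_map size_iota.
  case: rr Hr => [[j [t v]] r2] /=; rewrite !sz_pair.
  have L : size t < sz t by apply: leq_size_sz. lia.
have Hj : sz rr.1.1 <= R.
  by case: rr Hr {Ha} => [[j [t v]] r2] /=; rewrite !sz_pair; lia.
have Hk : sz (rr.1.2.2, rr.2.2.2) <= R.
  by case: rr Hr {Ha Hj} => [[j [t v]] [j2 [t2 v2]]] /=; rewrite !sz_pair; lia.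
split=> /=; rewrite ?size_cat ?addn1 //; try by rewrite leq_add2r.
  have HA (F : key -> nat) : (forall k, F k <= B) ->
      all (fun i => i <= B) [seq F k | k <- argkeys rr.1 rr.2].
    by move=> HF'; apply/allP => i /mapP[k _ ->].
  rewrite all_cat H1 /= andbT /gate_le /= !(size_map _ (argkeys _ _)) Ha Hj /=.
  by rewrite !HA // => k; case: (HF k).
by rewrite H2 andbT /elem_le /= Hk /=; lia.
Qed.

Lemma foldl_le {X S} {EX : Enc X} (f : S -> X -> S) (I : nat -> S -> Prop) Q l s :
  sz l <= Q -> I 0 s ->
  (forall k s x, k < size l -> sz x <= Q -> I k s -> I k.+1 (f s x)) ->
  I (size l) (foldl f s l).
Proof.
move=> HQ I0 IS.
have H (r : seq X) j s' : j + size r <= size l -> sz r <= Q -> I j s' ->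
    I (j + size r) (foldl f s' r).
  elim: r j s' => [|x r IH] j s'; first by rewrite addn0.
  rewrite sz_cons /= addnS -addSn => le le2 Hs; apply: IH; [by [] | lia |].
  by apply: IS => //; lia.
exact: (H l 0).
Qed.

Lemma pass_le R B a b (st : clstate) (rp : seq (row * row)) : sz rp <= R -> a + 3 * size rp + 5 <= B -> cl_le R B a b st ->
  cl_le R B (a + 3 * size rp) (b + size rp) (foldl cl_step st rp).
Proof.
move=> Hr HB H.
apply: (foldl_le (I := fun k => cl_le R B (a + 3 * k) (b + k)) Hr).
  by rewrite muln0 !addn0.
move=> k s x Hk Hx Hs; have -> : a + 3 * k.+1 = (a + 3 * k) + 3 by lia.
have -> : b + k.+1 = (b + k) + 1 by lia.
by apply: cl_step_le => //; lia.
Qed.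

Lemma saturate_le R B a b (st : clstate) (rp : seq (row * row)) (prs : seq (nat * nat)) : sz rp <= R ->
  a + 3 * (size prs * size rp) + 5 <= B -> cl_le R B a b st ->
  cl_le R B (a + 3 * (size prs * size rp)) (b + size prs * size rp) (saturate prs rp st).
Proof.
move=> Hr HB H; rewrite /saturate.
apply: (foldl_le (I := fun k => cl_le R B (a + 3 * (k * size rp)) (b + k * size rp))
  (leqnn (sz prs))).
  by rewrite mul0n muln0 !addn0.
move=> k s x Hk _ Hs; rewrite mulSn.
have -> : a + 3 * (size rp + k * size rp) = a + 3 * (k * size rp) + 3 * size rp by lia.
have -> : b + (size rp + k * size rp) = b + k * size rp + size rp by lia.
apply: pass_le => //.
have : k.+1 * size rp <= size prs * size rp by rewrite leq_mul.
by rewrite mulSn; lia.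
Qed.

Lemma pb_gate_sz A (m R B : A -> nat) : pb m R -> pb m B -> pb m (fun x => gate_sz (R x) (B x)).
Proof. by move=> HR HB; rewrite /gate_sz; pb_tac. Qed.
Lemma pb_elem_sz A (m R B : A -> nat) : pb m R -> pb m B -> pb m (fun x => elem_sz (R x) (B x)).
Proof. by move=> HR HB; rewrite /elem_sz; pb_tac. Qed.

Lemma sz_cl_pair (st : clstate) : size st.1 <= sz st /\ size st.2 <= sz st.
Proof.
case: st => P S; rewrite sz_pair /=.
have L1 : size P < sz P by apply: leq_size_sz.
have L2 : size S < sz S by apply: leq_size_sz.
by lia.
Qed.

Lemma PT_pass {G} {EG : Enc G} (st : G -> clstate) rp :
  PT st -> PT rp -> PT (fun g => foldl cl_step (st g) (rp g)).
Proof.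
move=> Ps Pr; have Ss := PT_size Ps; have Sr := PT_size Pr.
pose (R := fun g => sz (st g) + sz (rp g)).
pose (B := fun g => sz (st g) + 3 * sz (rp g) + 5).
have pR : pb sz R by rewrite /R; pb_tac.
have pB : pb sz B by rewrite /B; pb_tac.
apply: (PT_foldl_inv (I := fun g k => cl_le (R g) (B g) (size (st g).1 + 3 * k) (size (st g).2 + k))
 (bd := fun g => B g * gate_sz (R g) (B g) + B g * elem_sz (R g) (B g) + 3)) => //.
- by apply: PT_cl_step; pt.
- have := pb_gate_sz pR pB; have := pb_elem_sz pR pB; by move=> *; pb_tac.
- by move=> g; rewrite muln0 !addn0; apply: cl_le_sz; rewrite /R /B; lia.
- move=> g k s x Hk Hx Hs.
  have -> : size (st g).1 + 3 * k.+1 = (size (st g).1 + 3 * k) + 3 by lia.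
  have -> : size (st g).2 + k.+1 = (size (st g).2 + k) + 1 by lia.
  have [L1 L2] := sz_cl_pair (st g).
  have L : size (rp g) < sz (rp g) by apply: leq_size_sz.
  by apply: cl_step_le => //; rewrite /R /B; lia.
- move=> g k s Hk Hs; apply: leq_trans (sz_cl Hs) _.
  have [L1 L2] := sz_cl_pair (st g).
  have L : size (rp g) < sz (rp g) by apply: leq_size_sz.
  by rewrite !leq_add2r leq_add // leq_mul //; rewrite /B; lia.
Qed.

Lemma PT_saturate {G} {EG : Enc G} prs rp (st : G -> clstate) :
  PT prs -> PT rp -> PT st -> PT (fun g => saturate (prs g) (rp g) (st g)).
Proof.
move=> Pp Pr Ps; have Ss := PT_size Ps; have Sr := PT_size Pr; have Sp := PT_size Pp.
pose (sp := fun g => sz (prs g)).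
pose (sr := fun g => sz (rp g)).
pose (ss := fun g => sz (st g)).
pose (R := fun g => ss g + sr g).
pose (B := fun g => ss g + 3 * (sp g * sr g) + 5).
have pR : pb sz R by rewrite /R; pb_tac.
have pB : pb sz B by rewrite /B; pb_tac.
apply: (PT_foldl_inv (I := fun g k => cl_le (R g) (B g)
    (size (st g).1 + 3 * (k * size (rp g))) (size (st g).2 + k * size (rp g)))
 (bd := fun g => B g * gate_sz (R g) (B g) + B g * elem_sz (R g) (B g) + 3)) => //.
- by apply: PT_pass; pt.
- have := pb_gate_sz pR pB; have := pb_elem_sz pR pB; by move=> *; pb_tac.
- by move=> g; rewrite mul0n muln0 !addn0; apply: cl_le_sz; rewrite /R /B -/(ss g); lia.
- move=> g k s x Hk Hx Hs; rewrite mulSn.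
  have -> : size (st g).1 + 3 * (size (rp g) + k * size (rp g)) =
    size (st g).1 + 3 * (k * size (rp g)) + 3 * size (rp g) by lia.
  have -> : size (st g).2 + (size (rp g) + k * size (rp g)) =
    size (st g).2 + k * size (rp g) + size (rp g) by lia.
  have [L1 L2] := sz_cl_pair (st g).
  have L : size (rp g) < sz (rp g) by apply: leq_size_sz.
  have Lp : size (prs g) < sz (prs g) by apply: leq_size_sz.
  apply: pass_le => //; first by rewrite /R /sr; lia.
  have : k.+1 * size (rp g) <= sp g * sr g by rewrite leq_mul // /sp /sr; lia.
  by rewrite mulSn /B /ss; lia.
- move=> g k s Hk Hs; apply: leq_trans (sz_cl Hs) _.
  have [L1 L2] := sz_cl_pair (st g).
  have L : size (rp g) < sz (rp g) by apply: leq_size_sz.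
  have Lp : size (prs g) < sz (prs g) by apply: leq_size_sz.
  have : k * size (rp g) <= sp g * sr g by rewrite leq_mul // /sp /sr; lia.
  by move=> ?; rewrite !leq_add2r leq_add // leq_mul //; rewrite /B /ss; lia.
Qed.

(** A gate returns a value listed in [rows], or 0, so values do not grow with the length of the
    program. *)
Lemma nth_vals_le Q (rows : seq row) (P : seq gate) (env : seq nat) i : sz rows <= Q ->
  all (fun v : nat => sz v <= Q) env -> sz (nth 0 (vals rows P env) i) <= Q.
Proof.
move=> HQ He; have {He} : all (fun v : nat => sz v <= Q) (vals rows P env).
  rewrite /vals; elim: P env He => [|g P IH] env He //=; apply: IH.
  rewrite all_rcons He andbT; apply: leq_trans HQ; exact: lookup_bound.
case: (ltnP i (size (vals rows P env))) => Hi H; first exact: (allP H) (mem_nth _ Hi).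
by rewrite nth_default //; apply: leq_trans HQ; apply: sz_gt0.
Qed.

Definition ist_le R B a (st : istate) :=
  [/\ all (gate_le R B) st.1.2, size st.1.2 <= a, st.2.1 <= B, st.2.2.1 <= B & st.2.2.2 <= B].
Definition ost_le R B a (st : ostate) :=
  [/\ all (gate_le R B) st.1.2, size st.1.2 <= a, st.2.1 <= B & st.2.2 <= B].

Lemma sz_ist R B a (st : istate) : ist_le R B a st -> sz st <= a * gate_sz R B + 6 * B + 12.
Proof.
case: st => [[b P] [u [v w]]] [/= H1 H2 H3 H4 H5]; rewrite !sz_pair !sz_nat.
have K1 := sz_gates H1; have := sz_bool b.
have K3 : size P * gate_sz R B <= a * gate_sz R B by rewrite leq_mul.
by lia.
Qed.

Lemma sz_ost R B a (st : ostate) : ost_le R B a st -> sz st <= a * gate_sz R B + 6 * B + 12.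
Proof.
case: st => [[b P] [u v]] [/= H1 H2 H3 H4]; rewrite !sz_pair !sz_nat.
have K1 := sz_gates H1; have := sz_bool b.
have K3 : size P * gate_sz R B <= a * gate_sz R B by rewrite leq_mul.
by lia.
Qed.

(** [2 * Q + 1] is the size of a key whose two entries have size at most [Q]. By [nth_vals_le] the
    evaluated entry stays within [Q], so only the number of gates changes from round to round. *)
Lemma in_step_le Q R B a (prs : seq (nat * nat)) (rp : seq (row * row)) (rows : seq row)
    (a0 e0 t w : nat) (st : istate) (cd : nat * nat) :
  sz rows <= Q -> sz rp <= R -> sz a0 <= Q -> sz e0 <= Q -> sz cd <= Q -> 2 * Q + 1 <= R ->
  t <= B -> w <= B -> a + 3 * (size prs * size rp) + 5 <= B -> ist_le R B a st ->
  ist_le R B (a + 3 * (size prs * size rp)) (in_step prs rp rows a0 e0 t w st cd).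
Proof.
move=> Hrows Hrp Ha He0 Hcd HR Ht Hw HB [H1 H2 H3 H4 H5].
have [Hc Hd] : sz cd.1 <= Q /\ sz cd.2 <= Q.
  by case: (cd) Hcd => c d; rewrite sz_pair /=; lia.
have He : sz (in_eval rows st cd) <= Q.
  by apply: nth_vals_le => //=; rewrite Hc Hd.
have [|I1 I2 I3 _] := @saturate_le R B a 3 (st.1.2, gens a0 (in_eval rows st cd) e0 cd.2 st.2 w t)
   rp prs Hrp HB.
  by split => //=; rewrite /elem_le /= !sz_pair; lia.
by have [F1 F2 F3] := find_elem_le (a0, cd.2) I2; split.
Qed.

Lemma inner_le Q R B a (prs : seq (nat * nat)) (rp : seq (row * row)) (rows : seq row)
    (st : ostate) (ab : nat * nat) :
  sz rows <= Q -> sz prs <= Q -> sz rp <= R -> sz ab <= Q -> 2 * Q + 1 <= R ->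
  a + 3 * (size prs * (size prs * size rp)) + 5 <= B -> ost_le R B a st ->
  ist_le R B (a + 3 * (size prs * (size prs * size rp))) (inner prs rp rows st ab).
Proof.
move=> Hrows Hprs Hrp Hab HR HB [H1 H2 H3 H4].
have [Hc Hd] : sz ab.1 <= Q /\ sz ab.2 <= Q.
  by case: (ab) Hab => c d; rewrite sz_pair /=; lia.
have He : sz (out_eval rows st ab) <= Q.
  by apply: nth_vals_le => //=; rewrite Hc Hd.
apply: (foldl_le (I := fun k => ist_le R B (a + 3 * (k * (size prs * size rp)))) Hprs).
  by rewrite mul0n muln0 addn0; split.
move=> k s x Hk Hx Hs; rewrite (mulSn k).
have -> : a + 3 * (size prs * size rp + k * (size prs * size rp)) =
  a + 3 * (k * (size prs * size rp)) + 3 * (size prs * size rp) by lia.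
apply: (in_step_le (Q := Q)) => //.
have : k.+1 * (size prs * size rp) <= size prs * (size prs * size rp) by rewrite leq_mul.
by rewrite mulSn; lia.
Qed.

Lemma out_step_le Q R B a (prs : seq (nat * nat)) (rp : seq (row * row)) (rows : seq row)
    (st : ostate) (ab : nat * nat) :
  sz rows <= Q -> sz prs <= Q -> sz rp <= R -> sz ab <= Q -> 2 * Q + 1 <= R ->
  a + 3 * (size prs * (size prs * size rp)) + 5 <= B -> ost_le R B a st ->
  ost_le R B (a + 3 * (size prs * (size prs * size rp))) (out_step prs rp rows st ab).
Proof.
move=> H1 H2 H3 H4 H5 H6 H7.
by have [] := inner_le H1 H2 H3 H4 H5 H6 H7; split.
Qed.

Lemma PT_inner {G} {EG : Enc G} (prs : G -> seq (nat * nat)) (rp : G -> seq (row * row))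
    (rows : G -> seq row) (st : G -> ostate) (ab : G -> nat * nat) :
  PT prs -> PT rp -> PT rows -> PT st -> PT ab ->
  PT (fun g => inner (prs g) (rp g) (rows g) (st g) (ab g)).
Proof.
move=> Pp Pr Pw Ps Pa; have Ss := PT_size Ps; have Sr := PT_size Pr; have Sp := PT_size Pp.
have Sw := PT_size Pw; have Sa := PT_size Pa.
pose (sp := fun g => sz (prs g)); pose (sr := fun g => sz (rp g)).
pose (ss := fun g => sz (st g)); pose (sw := fun g => sz (rows g)); pose (sa := fun g => sz (ab g)).
pose (Q := fun g => sw g + sp g + sa g).
pose (R := fun g => 2 * Q g + 1 + sr g + ss g).
pose (B := fun g => ss g + 3 * (sp g * (sp g * sr g)) + 5).
have pR : pb sz R by rewrite /R /Q; pb_tac.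
have pB : pb sz B by rewrite /B; pb_tac.
have P1 : PT (fun p : G * istate * (nat * nat) => out_eval (rows p.1.1) (st p.1.1) (ab p.1.1)).
  by rewrite /out_eval; pt.
have P2 : PT (fun p : G * istate * (nat * nat) => in_eval (rows p.1.1) p.1.2 p.2).
  by rewrite /in_eval; pt.
have P3 : PT (fun p : G * istate * (nat * nat) => in_clos (prs p.1.1) (rp p.1.1) (rows p.1.1)
    (ab p.1.1).1 (out_eval (rows p.1.1) (st p.1.1) (ab p.1.1)) (st p.1.1).2.1 (st p.1.1).2.2
    p.1.2 p.2).
  by rewrite /in_clos /gens; apply: PT_saturate; pt.
have Ls g : [/\ size (st g).1.2 < ss g, (st g).2.1 < ss g & (st g).2.2 < ss g].
  rewrite /ss; case: (st g) => [[b P] [u v]] /=; rewrite !sz_pair !sz_nat.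
  by have L : size P < sz P by [apply: leq_size_sz]; split; lia.
have Lp g : size (prs g) < sp g by apply: leq_size_sz.
have Lr g : size (rp g) < sr g by apply: leq_size_sz.
have Lc g k : k <= size (prs g) ->
    k * (size (prs g) * size (rp g)) <= sp g * (sp g * sr g).
  move=> le; rewrite !leq_mul //; have := Lp g; have := Lr g; lia.
apply: (PT_foldl_inv (I := fun g k => ist_le (R g) (B g)
    (size (st g).1.2 + 3 * (k * (size (prs g) * size (rp g)))))
 (bd := fun g => B g * gate_sz (R g) (B g) + 6 * B g + 12)) => //.
- by pt.
- by rewrite /in_step; pt.
- have := pb_gate_sz pR pB; by move=> *; pb_tac.
- move=> g; rewrite mul0n muln0 addn0; case: (Ls g) => L1 L2 L3; split => //=; try by rewrite /B; lia.
  apply: sub_all (gates_le_sz _); apply: gate_le_mono.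
    by rewrite /R /ss; case: (st g) => [[b P] o]; rewrite !sz_pair /=; lia.
  by rewrite /B /ss; case: (st g) => [[b P] o]; rewrite !sz_pair /=; lia.
- move=> g k s x Hk Hx Hs; rewrite (mulSn k).
  have -> : forall a b c, a + 3 * (b + c) = a + 3 * c + 3 * b by lia.
  case: (Ls g) => L1 L2 L3.
  have Hab : sz (ab g).1 < sa g /\ sz (ab g).2 < sa g.
    by rewrite /sa; case: (ab g) => [a b]; rewrite sz_pair /=; lia.
  have E1 : sz (rp g) = sr g by []. have E2 : sz (rows g) = sw g by [].
  have E3 : sz (prs g) = sp g by []. have EQ : Q g = sw g + sp g + sa g by [].
  have ER : R g = 2 * Q g + 1 + sr g + ss g by [].
  have EB : B g = ss g + 3 * (sp g * (sp g * sr g)) + 5 by [].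
  apply: (in_step_le (Q := Q g)) => //; try lia.
  + by apply: nth_vals_le => /=; rewrite ?andbT; lia.
  + by have := Lc g k.+1 Hk; rewrite (mulSn k); lia.
- move=> g k s Hk Hs; apply: leq_trans (sz_ist Hs) _.
  rewrite !leq_add2r leq_mul //; have := Lc g k Hk; case: (Ls g) => L1 L2 L3; rewrite /B; lia.
Qed.

Lemma PT_solve {G} {EG : Enc G} (prs : G -> seq (nat * nat)) (rp : G -> seq (row * row))
    (rows : G -> seq row) :
  PT prs -> PT rp -> PT rows -> PT (fun g => solve (prs g) (rp g) (rows g)).
Proof.
move=> Pp Pr Pw; have Sr := PT_size Pr; have Sp := PT_size Pp; have Sw := PT_size Pw.
pose (sp := fun g => sz (prs g)); pose (sr := fun g => sz (rp g)); pose (sw := fun g => sz (rows g)).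
pose (Q := fun g => sw g + sp g).
pose (R := fun g => 2 * Q g + 1 + sr g).
(* Three gates for each pair of rows, in each pass of each inner step of each outer step, plus the
   slack of [cl_step_le]. *)
pose (B := fun g => 3 * (sp g * (sp g * (sp g * sr g))) + 5).
have pR : pb sz R by rewrite /R /Q; pb_tac.
have pB : pb sz B by rewrite /B; pb_tac.
have P1 : PT (fun p : G * ostate * (nat * nat) =>
    inner (prs p.1.1) (rp p.1.1) (rows p.1.1) p.1.2 p.2).
  by apply: PT_inner; pt.
have Lp g : size (prs g) < sp g by apply: leq_size_sz.
have Lr g : size (rp g) < sr g by apply: leq_size_sz.
have Lc g k : k <= size (prs g) ->
    k * (size (prs g) * (size (prs g) * size (rp g))) <= sp g * (sp g * (sp g * sr g)).
  move=> le; rewrite !leq_mul //; have := Lp g; have := Lr g; lia.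
apply: (PT_foldl_inv (I := fun g k => ost_le (R g) (B g)
    (3 * (k * (size (prs g) * (size (prs g) * size (rp g))))))
 (bd := fun g => B g * gate_sz (R g) (B g) + 6 * B g + 12)) => //.
- by pt.
- by rewrite /out_step; pt.
- have := pb_gate_sz pR pB; by move=> *; pb_tac.
- by move=> g; rewrite mul0n muln0; split => //=; rewrite /B; lia.
- move=> g k s x Hk Hx Hs; rewrite (mulSn k) mulnDr addnC.
  have E1 : sz (rp g) = sr g by []. have E2 : sz (rows g) = sw g by [].
  have E3 : sz (prs g) = sp g by []. have EQ : Q g = sw g + sp g by [].
  have ER : R g = 2 * Q g + 1 + sr g by [].
  apply: (out_step_le (Q := Q g)) => //; try lia.
  + by have := Lc g k.+1 Hk; rewrite (mulSn k) /B; lia.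
- move=> g k s Hk Hs; apply: leq_trans (sz_ost Hs) _.
  rewrite !leq_add2r leq_mul //; have := Lc g k Hk; rewrite /B; lia.
Qed.

(** * From input bits to the answer *)

Definition rowpairs (rows : seq row) : seq (row * row) :=
  flatten [seq [seq (r1, r2) | r2 <- rows] | r1 <- rows].
Definition pairs n : seq (nat * nat) :=
  flatten [seq [seq (a, b) | b <- iota 0 n] | a <- iota 0 n].

Definition enc_gate (g : gate) : seq sym :=
  One :: enc_nat g.1 ++ enc_nat (size g.2) ++ flatten [seq enc_nat i | i <- g.2].
Definition enc_inputs : seq sym := flatten (map enc_vertex [:: VIn 0; VIn 1; VIn 2]).
Definition answer (st : ostate) : seq sym :=
  if st.1.1 then
    One :: enc_nat (size st.1.2 + 3) ++ enc_nat st.2.1 ++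
      enc_inputs ++ flatten [seq enc_gate g | g <- st.1.2]
  else [:: Zero].

Definition solve_rows n (rows : seq row) : ostate := solve (pairs n) (rowpairs rows) rows.
(** The largest digit is |A| - 1. After the two header numbers, tables are read until the input
    ends. *)
Definition decide_nats (nats : seq nat) : seq sym :=
  answer (solve_rows (nth 0 nats 0) (parse_rows (nth 0 nats 0).-1 (behead (behead nats)))).
Definition decide (bits : seq bool) : seq sym := decide_nats (parse_nats bits).

Lemma PT_enc_nat {G} {EG : Enc G} (n : G -> nat) : PT n -> PT (fun g => enc_nat (n g)).
Proof. by move=> Pn; rewrite /enc_nat; pt. Qed.

Lemma PT_enc_gate : PT enc_gate.
Proof.
rewrite /enc_gate; apply: PT_cons; first by pt.
apply: PT_cat; first by apply: PT_enc_nat; pt.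
apply: PT_cat; first by apply: PT_enc_nat; pt.
by apply: PT_flatten; apply: PT_map; [pt | apply: PT_enc_nat; pt].
Qed.

Lemma PT_answer : PT answer.
Proof.
rewrite /answer; apply: PT_if; [by pt | | by pt].
apply: PT_cons; first by pt.
apply: PT_cat; first by apply: PT_enc_nat; pt.
apply: PT_cat; first by apply: PT_enc_nat; pt.
apply: PT_cat; first by pt.
by apply: PT_flatten; apply: PT_map; [pt | apply: (PT_comp PT_enc_gate); pt].
Qed.

Lemma PT_decide : PT decide.
Proof.
apply: (PT_comp (g := decide_nats)); last exact: PT_parse_nats.
apply: (PT_comp (g := answer)); first exact: PT_answer.
have P1 : PT (fun nats : seq nat => parse_rows (nth 0 nats 0).-1 (behead (behead nats))).
  by apply: PT_parse_rows; pt.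
have P2 : PT (fun p : nat * seq row => solve_rows p.1 p.2).
  by rewrite /solve_rows; apply: PT_solve; rewrite /pairs /rowpairs; pt.
by apply: (PT_comp (f := fun nats : seq nat => (nth 0 nats 0,
  parse_rows (nth 0 nats 0).-1 (behead (behead nats)))) P2); pt.
Qed.

(** * Correctness *)

Lemma parse_nats_enc (l : seq nat) :
  parse_nats (flatten [seq rcons (nseq k true) false | k <- l]) = l.
Proof.
rewrite /parse_nats; set f := fun st b => _.
have Hf k acc c : foldl f (acc, c) (rcons (nseq k true) false) = (k + c :: acc, 0).
  rewrite -cats1; elim: k c => [|k IH] c //=.
  by rewrite IH addSnnS.
have H acc : foldl f (acc, 0) (flatten [seq rcons (nseq k true) false | k <- l]) =
    (rev l ++ acc, 0).
  elim: l acc => [|k l IH] acc //=.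
  by rewrite foldl_cat Hf addn0 IH rev_cons cat_rcons.
by rewrite H cats0 revK.
Qed.

Lemma incr_cons m d u : incr m (d :: u) =
  if d == m then ((incr m u).1, 0 :: (incr m u).2) else (false, d.+1 :: u).
Proof.
have H b s v : foldl (incr_step m) (b, s) v =
    ((foldl (incr_step m) (b, [::]) v).1, (foldl (incr_step m) (b, [::]) v).2 ++ s).
  elim: v b s => [|x v IH] b s //=; rewrite /incr_step /=; case: b; last first.
    by rewrite IH [in RHS]IH /= -catA.
  by case: eqP => _; rewrite IH [in RHS]IH /= -catA.
have H2 v : foldl (incr_step m) (false, [::]) v = (false, rev v).
  by elim: v => [|x v IH] //=; rewrite /incr_step /= H IH rev_cons cats1.
rewrite /incr /= /incr_step /=; case: eqP => _.
  by rewrite H /= rev_cat.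
by rewrite H H2 /= rev_cat revK.
Qed.

Lemma mem_all_tuples n k t : (t \in all_tuples n k) = (size t == k) && all (fun x => x < n) t.
Proof.
elim: k t => [|k IH] t /=.
  by rewrite inE -size_eq0; case: t.
apply/flatten_mapP/idP => [[i Hi /mapP[u Hu ->]] /=|].
  by move: Hi Hu; rewrite mem_iota IH eqSS /= => -> /andP[-> ->].
case: t => [|i u] //=; rewrite eqSS => /and3P[Hs Hi Hu].
exists i; first by rewrite mem_iota.
by apply/map_f; rewrite IH Hs.
Qed.

Section Odometer.
Variables (m : nat) (f : seq nat -> nat) (j : nat).

Definition odo_rows k u := [seq (j, (rev u ++ t, f (rev u ++ t))) | t <- all_tuples m.+1 k].

(** Running through the [k] lowest digits, all 0 at the start, resets them to 0 and increments the
    rest [u] once. The order is that of [all_tuples], where the last entry, the lowest digit, varies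
    fastest. *)
Lemma odometer k u rows :
  foldl (parse_step m) ((true, nseq k 0 ++ u), (j, rows))
    [seq f (rev u ++ t) | t <- all_tuples m.+1 k] =
  ((~~ (incr m u).1, nseq k 0 ++ (incr m u).2),
   (if (incr m u).1 then j.+1 else j, rev (odo_rows k u) ++ rows)).
Proof.
elim: k u rows => [|k IH] u rows; first by rewrite /odo_rows /= cats0 /parse_step.
have shift (v : seq nat) : nseq k.+1 0 ++ v = nseq k 0 ++ 0 :: v.
  by elim: (k) => //= k' ->.
have E u' i : [seq f (rev u' ++ t) | t <- [seq i :: t | t <- all_tuples m.+1 k]] =
    [seq f (rev (i :: u') ++ t) | t <- all_tuples m.+1 k].
  by rewrite -map_comp; apply: eq_map => t /=; rewrite rev_cons cat_rcons.
have E2 u' i : [seq (j, (rev u' ++ t, f (rev u' ++ t))) | t <- [seq i :: t | t <- all_tuples m.+1 k]] =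
    odo_rows k (i :: u').
  by rewrite -map_comp; apply: eq_map => t /=; rewrite rev_cons cat_rcons.
(* Induction on the values i, ..., m that the next digit has still to take. *)
have B d i rows' : 0 < d -> i + d = m.+1 ->
    foldl (parse_step m) ((true, nseq k 0 ++ i :: u), (j, rows'))
      [seq f (rev u ++ t) | t <- flatten [seq [seq i :: t | t <- all_tuples m.+1 k] | i <- iota i d]] =
    ((~~ (incr m u).1, nseq k.+1 0 ++ (incr m u).2),
     (if (incr m u).1 then j.+1 else j,
      rev [seq (j, (rev u ++ t, f (rev u ++ t))) |
           t <- flatten [seq [seq i :: t | t <- all_tuples m.+1 k] | i <- iota i d]] ++ rows')).
  elim: d i rows' => // d IHd i rows' _ Hi.
  rewrite [iota i d.+1]/= [map _ (_ :: _)]/= [flatten _]/= !map_cat foldl_cat E E2 IH incr_cons.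
  rewrite rev_cat -catA.
  case: eqP => Him.
    have -> : d = 0 by lia.
    by rewrite -shift.
  by apply: IHd; lia.
rewrite shift.
exact: (B m.+1 0 rows).
Qed.
End Odometer.

Definition enc_table n (op : nat * (seq nat -> nat)) : seq nat :=
  op.1 :: [seq op.2 t | t <- all_tuples n op.1].

Lemma mem_parse m ops (z : seq nat) j rows r :
  r \in (foldl (parse_step m) ((false, z), (j, rows))
           (flatten [seq enc_table m.+1 op | op <- ops])).2.2 <->
  r \in rows \/ exists i t, [/\ i < size ops, t \in all_tuples m.+1 (nth op_default ops i).1 &
     r = (j + i, (t, (nth op_default ops i).2 t))].
Proof.
elim: ops z j rows => [|op ops IH] z j rows /=.
  by split=> [|[//|[i [t [Hi]]]]]; [left | ].
rewrite foldl_cat.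
(* For empty [u] the carry comes out at once: the table is complete, the flag drops and the
   operation index grows. *)
have := odometer m op.2 j op.1 [::] rows; rewrite cats0 /= => ->.
rewrite IH mem_cat mem_rev; split.
- case=> [/orP[/mapP[t Ht ->]|Hr]|[i [t [Hi Ht ->]]]].
  + by right; exists 0, t; rewrite addn0.
  + by left.
  + by right; exists i.+1, t; rewrite addSnnS.
- case=> [->|[[|i] [t [Hi Ht ->]]]]; first by left; rewrite orbT.
  + by left; apply/orP; left; apply/mapP; exists t; rewrite ?addn0.
  + by right; exists i, t; rewrite addSnnS.
Qed.

Definition rows_for (A : alg) (rows : seq row) := forall r, r \in rows <->
  exists j t, [/\ j < size (ops A), t \in all_tuples (univ_size A) (arity A j) &
    r = (j, (t, opf A j t))].

Lemma parse_rows_for A : 0 < univ_size A ->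
  rows_for A (parse_rows (univ_size A).-1
    (flatten [seq enc_table (univ_size A) op | op <- ops A])).
Proof.
move=> Hn r; have E : univ_size A = (univ_size A).-1.+1 by lia.
rewrite {2}E mem_parse; split; first by case=> // -[i [t [Hi Ht ->]]]; exists i, t; rewrite E.
by case=> j [t [Hj Ht ->]]; right; exists j, t; rewrite -E.
Qed.

Lemma foldl_pick (X : eqType) Y (p : X -> bool) (f : X -> Y) (s : seq X) acc : has p s ->
  exists2 x, x \in s /\ p x & foldl (fun acc x => if p x then f x else acc) acc s = f x.
Proof.
elim/last_ind: s => [|s x IH] //; rewrite has_rcons foldl_rcons.
case: ifP => [px _|_ /= /IH[y [ys py] ->]]; first by exists x; rewrite // mem_rcons mem_head.
by exists y; rewrite // mem_rcons in_cons ys orbT.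
Qed.

(** All matching rows carry the same value, so the choice made by the fold does not affect the
    result. *)
Lemma lookup_rows A rows j t : rows_for A rows -> j < size (ops A) ->
  t \in all_tuples (univ_size A) (arity A j) -> lookup rows j t = opf A j t.
Proof.
move=> Hrows Hj Ht; rewrite /lookup.
case: (@foldl_pick _ _ (fun r : row => (r.1 == j) && (r.2.1 == t)) (fun r => r.2.2) rows 0).
  apply/hasP; exists (j, (t, opf A j t)); last by rewrite /= !eqxx.
  by apply/Hrows; exists j, t.
by move=> r [/Hrows[j' [t' [_ _ ->]]] /= /andP[/eqP-> /eqP->]] ->.
Qed.

Lemma term_nested_ind (P : term -> Prop) :
  (forall i, P (Var i)) ->
  (forall j ts, (forall i, i < size ts -> P (nth (Var 0) ts i)) -> P (App j ts)) ->
  forall t, P t.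
Proof.
move=> HV HA; fix IH 1; case=> [i|j ts]; first exact: HV.
have HF : forall i, i < size ts -> P (nth (Var 0) ts i); last exact: HA.
elim: ts => [i Hi|t ts IHts [_|i Hi]]; [by case: (notF Hi) | exact: IH | exact: IHts].
Qed.

Lemma nth_pairs n x : (x \in pairs n) = (x.1 < n) && (x.2 < n).
Proof.
case: x => a b; apply/flatten_mapP/andP => /= [[c Hc /mapP[d Hd [-> ->]]]|[Ha Hb]].
  by move: Hc Hd; rewrite !mem_iota.
by exists a; rewrite ?mem_iota //; apply/mapP; exists b; rewrite ?mem_iota.
Qed.

(** * Gate lists, terms and generated elements *)

Section Semantics.
Variables (A : alg) (rows : seq row).
Hypotheses (okA : alg_ok A) (rowsA : rows_for A rows).
Let n := univ_size A.

Lemma opf_lt j args : j < size (ops A) -> size args = arity A j ->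
  all (fun x => x < n) args -> opf A j args < n.
Proof.
case: okA => _ [_ H] Hj Hs Ha; have [_] := H j Hj; apply.
by rewrite mem_all_tuples Hs eqxx.
Qed.

Lemma lookup_opf j args : j < size (ops A) -> size args = arity A j ->
  all (fun x => x < n) args -> lookup rows j args = opf A j args.
Proof. by move=> Hj Hs Ha; apply: lookup_rows => //; rewrite mem_all_tuples Hs eqxx. Qed.

Lemma teval_lt env t : all (fun x => x < n) env -> term_wf A (size env) t ->
  teval A env t < n.
Proof.
move=> He; elim/term_nested_ind: t => [i|j ts IH] /=.
  by move=> Hi; apply: (allP He); apply: mem_nth.
case/and3P=> Hj /eqP Hs /(all_nthP (Var 0)) Hts; apply: opf_lt; rewrite ?size_map //.
apply/(all_nthP 0) => i; rewrite size_map => Hi.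
by rewrite (nth_map (Var 0)) //; apply: IH => //; apply: Hts.
Qed.

Lemma teval_idem x m t : alg_idempotent A -> x < n -> term_wf A m t ->
  teval A (nseq m x) t = x.
Proof.
move=> idA Hx; elim/term_nested_ind: t => [i|j ts IH] /=.
  by move=> Hi; rewrite nth_nseq Hi.
case/and3P=> Hj /eqP Hs /(all_nthP (Var 0)) Hts.
rewrite -[RHS](idA j Hj x Hx); congr opf; rewrite -Hs.
apply: (@eq_from_nth _ 0); first by rewrite size_map size_nseq.
move=> i; rewrite size_map => Hi.
by rewrite (nth_map (Var 0)) // nth_nseq Hi; apply: IH => //; apply: Hts.
Qed.

Definition wf_prog (P : seq gate) := forall i, i < size P ->
  vertex_ok A 3 (3 + i) (VGate (nth (0, [::]) P i).1 (nth (0, [::]) P i).2).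
Definition env_ok (env : seq nat) := size env = 3 /\ all (fun x => x < n) env.
Definition pval (P : seq gate) (env : seq nat) i := nth 0 (vals rows P env) i.

Lemma wf_prog_rcons P g : wf_prog (rcons P g) <->
  wf_prog P /\ vertex_ok A 3 (3 + size P) (VGate g.1 g.2).
Proof.
split=> [H|[HP Hg] i].
  split; last by have := H (size P); rewrite size_rcons nth_rcons ltnn eqxx; apply.
  by move=> i Hi; have := H i; rewrite size_rcons nth_rcons Hi; apply; apply: ltnW.
rewrite size_rcons ltnS leq_eqVlt nth_rcons => /orP[/eqP->|Hi].
  by rewrite ltnn eqxx.
by rewrite Hi; apply: HP.
Qed.

Lemma vals_rcons P g env : vals rows (rcons P g) env =
  rcons (vals rows P env) (lookup rows g.1 (map (nth 0 (vals rows P env)) g.2)).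
Proof. by rewrite /vals foldl_rcons. Qed.

Lemma size_vals P env : size (vals rows P env) = size env + size P.
Proof.
by elim/last_ind: P => [|P g IH]; rewrite ?addn0 // vals_rcons !size_rcons IH addnS.
Qed.

Lemma pval_cat P Q env i : size env = 3 -> i < 3 + size P -> pval (P ++ Q) env i = pval P env i.
Proof.
move=> He; elim/last_ind: Q => [|Q g IH]; first by rewrite cats0.
move=> Hi; rewrite -rcons_cat /pval vals_rcons nth_rcons size_vals He size_cat.
have -> : i < 3 + (size P + size Q) by lia.
exact: IH.
Qed.

Lemma vals_lt P env : wf_prog P -> env_ok env -> all (fun x => x < n) (vals rows P env).
Proof.
move=> + [He1 He2]; elim/last_ind: P => [|P g IH] // /wf_prog_rcons[/IH HP].
rewrite /vertex_ok => /and3P[Hj /eqP Hs /allP Ha]; rewrite vals_rcons all_rcons HP andbT.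
have Hargs : all (fun x => x < n) (map (nth 0 (vals rows P env)) g.2).
  apply/allP => x /mapP[i /Ha Hi ->]; apply: (allP HP); apply: mem_nth.
  by rewrite size_vals He1.
by rewrite lookup_opf ?size_map //; apply: opf_lt; rewrite ?size_map.
Qed.

Lemma pval_lt P env i : wf_prog P -> env_ok env -> pval P env i < n.
Proof.
move=> HP He; have H := vals_lt HP He; rewrite /pval.
case: (ltnP i (size (vals rows P env))) => Hi; first exact: (allP H) (mem_nth 0 Hi).
by rewrite nth_default //; case: okA.
Qed.

Lemma pval_input P env i : size env = 3 -> i < 3 -> pval P env i = nth 0 env i.
Proof. by move=> He Hi; rewrite -[P]cat0s pval_cat. Qed.

Lemma pval_gate P env i : wf_prog P -> env_ok env -> i < size P ->
  pval P env (3 + i) =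
  opf A (nth (0, [::]) P i).1 (map (pval P env) (nth (0, [::]) P i).2).
Proof.
move=> + He; elim/last_ind: P => [|P g IH] // /wf_prog_rcons[HP Hg].
have [He1 He2] := He.
rewrite size_rcons ltnS leq_eqVlt nth_rcons -cats1 => Hi.
have Hext args : all (fun a => a < 3 + size P) args ->
    map (pval (P ++ [:: g]) env) args = map (pval P env) args.
  by move=> /allP Ha; apply/eq_in_map => a /Ha; apply: pval_cat.
case/orP: Hi => [/eqP->|Hi].
  move: Hg => /and3P[Hj /eqP Hs Ha]; rewrite ltnn eqxx Hext //.
  rewrite /pval cats1 vals_rcons nth_rcons size_vals He1 ltnn eqxx.
  rewrite lookup_opf ?size_map //; apply/allP => x /mapP[a _ ->].
  exact: pval_lt.
rewrite Hi pval_cat ?ltn_add2l // IH // Hext //.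
have /and3P[_ _ Ha] := HP i Hi; apply: sub_all Ha => a.
by move=> /leq_trans; apply; rewrite leq_add2l ltnW.
Qed.

(* The two key coordinates of an element, and the value of each of its three
   vertices on an input triple. *)
Inductive coord := Key1 | Key2 | V1 of seq nat | V2 of seq nat | V3 of seq nat.
Definition cval P (c : coord) (e : elem) : nat :=
  match c with
  | Key1 => e.1.1
  | Key2 => e.1.2
  | V1 env => pval P env e.2.1
  | V2 env => pval P env e.2.2.1
  | V3 env => pval P env e.2.2.2
  end.
Definition coord_ok c :=
  match c with Key1 | Key2 => True | V1 env | V2 env | V3 env => env_ok env end.

Definition idx_ok (P : seq gate) (e : elem) :=
  [/\ e.2.1 < 3 + size P, e.2.2.1 < 3 + size P & e.2.2.2 < 3 + size P].

(** One term serves all coordinates: [e] is generated by [G] in the power of A indexed by the two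
    keys and by each of the three vertices at each input triple. So a key found in the closure
    yields a term whose values at the vertices are known. *)
Definition gen_by P (G : seq elem) (e : elem) := exists t, term_wf A (size G) t /\
  forall c, coord_ok c -> cval P c e = teval A (map (cval P c) G) t.

Definition cl_inv (G : seq elem) (st : clstate) :=
  [/\ wf_prog st.1, forall e, e \in G -> idx_ok st.1 e &
      forall e, e \in st.2 -> idx_ok st.1 e /\ gen_by st.1 G e].

Lemma idx_ok_cat P Q e : idx_ok P e -> idx_ok (P ++ Q) e.
Proof.
by case=> H1 H2 H3; split; rewrite size_cat addnA; apply: ltn_addr.
Qed.

Lemma cval_cat P Q c e : coord_ok c -> idx_ok P e -> cval (P ++ Q) c e = cval P c e.
Proof. by move=> + [H1 H2 H3]; case: c => //= env [He _]; apply: pval_cat. Qed.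

Lemma gen_by_cat P Q G e : (forall e, e \in G -> idx_ok P e) -> idx_ok P e ->
  gen_by P G e -> gen_by (P ++ Q) G e.
Proof.
move=> HG He [t [Ht H]]; exists t; split=> // c Hc; rewrite cval_cat // H //.
by congr teval; apply/eq_in_map => g /HG Hg; rewrite cval_cat.
Qed.

Lemma gen_by_all P G (E : seq elem) : (forall e, e \in E -> gen_by P G e) ->
  exists ts, [/\ size ts = size E, all (term_wf A (size G)) ts &
    forall c, coord_ok c -> map (cval P c) E = map (teval A (map (cval P c) G)) ts].
Proof.
elim: E => [|e E IH] H; first by exists [::].
have [t [Ht1 Ht2]] : gen_by P G e by apply: H; rewrite mem_head.
have [|ts [H1 H2 H3]] := IH; first by move=> e' He'; apply: H; rewrite in_cons He' orbT.
exists (t :: ts); split=> /=; rewrite ?H1 ?Ht1 //.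
by move=> c Hc; rewrite Ht2 // H3.
Qed.

Lemma find_elem_in S k : k \in keys S -> (k, find_elem S k) \in S.
Proof.
move=> /mapP[e He Ek]; rewrite /find_elem.
case: (@foldl_pick _ _ (fun e : elem => e.1 == k) snd S (0, (0, 0))).
  by apply/hasP; exists e; rewrite // Ek.
by move=> [k' v] /= [H /eqP <-] ->.
Qed.

Lemma argkeys_unzip (r1 r2 : row) : size r1.2.1 = size r2.2.1 ->
  map fst (argkeys r1 r2) = r1.2.1 /\ map snd (argkeys r1 r2) = r2.2.1.
Proof.
move=> Hs; rewrite /argkeys -!map_comp.
by split; [rewrite -[RHS](mkseq_nth 0) | rewrite -[RHS](mkseq_nth 0) -Hs]; apply: eq_map.
Qed.

(** Keys, gates and generating terms grow in parallel: operation [j] is applied to the elements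
    found under the argument keys, coordinate by coordinate. *)
Lemma cl_step_inv G st rr : rr.1 \in rows -> rr.2 \in rows -> cl_inv G st ->
  cl_inv G (cl_step st rr).
Proof.
move=> Hr1 Hr2 [Hwf HG HS]; rewrite /cl_step; case: ifP => // /and3P[/eqP Ej /allP HK _].
move: rr Hr1 Hr2 Ej HK => [r1 r2] /= Hr1 Hr2 Ej HK.
move/rowsA: Hr1 => [j [t1 [Hj Ht1 E1]]]; move/rowsA: Hr2 => [j2 [t2 [_ Ht2 E2]]].
move: Ej; rewrite E1 E2 /= => Ej; subst j2; rewrite -E1 -E2.
move: Ht1 Ht2; rewrite !mem_all_tuples => /andP[/eqP Hs1 _] /andP[/eqP Hs2 _].
have [|K1 K2] := @argkeys_unzip r1 r2; first by rewrite E1 E2 /= Hs1.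
set K := argkeys r1 r2 in K1 K2 HK *.
rewrite E1 /= in K1; rewrite E2 /= in K2.
pose E : seq elem := [seq (k, find_elem st.2 k) | k <- K].
have HE e : e \in E -> e \in st.2 by case/mapP=> k /HK Hk ->; apply: find_elem_in.
have sE : size E = arity A j by rewrite size_map -Hs1 -K1 (size_map fst).
have [|ts [S1 S2 S3]] := @gen_by_all st.1 G E.
  by move=> e /HE /HS[].
set Q := [:: _; _; _].
have HQ f : (forall e, e \in E -> f e.2 < 3 + size st.1) ->
  forall m, [&& j < size (ops A), size [seq f (find_elem st.2 k) | k <- K] == arity A j &
     all (fun a => a < 3 + (size st.1 + m)) [seq f (find_elem st.2 k) | k <- K]].
  move=> Hf m; rewrite Hj size_map -(size_map (fun k => (k, find_elem st.2 k))) sE eqxx /=.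
  apply/allP => a /mapP[k Hk ->]; rewrite addnA ltn_addr //.
  by apply: (Hf (k, find_elem st.2 k)); apply/mapP; exists k.
have I1 : forall e, e \in E -> e.2.1 < 3 + size st.1 by move=> e /HE/HS[[]].
have I2 : forall e, e \in E -> e.2.2.1 < 3 + size st.1 by move=> e /HE/HS[[]].
have I3 : forall e, e \in E -> e.2.2.2 < 3 + size st.1 by move=> e /HE/HS[[]].
have Hwf' : wf_prog (st.1 ++ Q).
  rewrite -[Q]/([:: _] ++ [:: _] ++ [:: _]) !catA !cats1.
  apply/wf_prog_rcons; split; last first.
    by rewrite !size_rcons -(addn2 (size st.1)); apply: (HQ (fun i => i.2.2)).
  apply/wf_prog_rcons; split; last first.
    by rewrite !size_rcons -(addn1 (size st.1)); apply: (HQ (fun i => i.2.1)).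
  apply/wf_prog_rcons; split => //.
  by rewrite -[size st.1]addn0; apply: (HQ (fun i => i.1)).
split => //=.
  by move=> e /HG; apply: idx_ok_cat.
move=> e; rewrite in_cons => /orP[/eqP->|/HS[H1 H2]]; last first.
  by split; [apply: idx_ok_cat | apply: gen_by_cat].
split; first by split; rewrite /= size_cat /=; lia.
exists (App j ts); split; first by rewrite /= Hj S1 sE eqxx.
have Hc0 c e' : coord_ok c -> e' \in E -> cval (st.1 ++ Q) c e' = cval st.1 c e'.
  by move=> Hc /HE/HS[He _]; rewrite cval_cat.
move=> c Hc /=; have Hmap : map (cval (st.1 ++ Q) c) E = map (teval A (map (cval (st.1 ++ Q) c) G)) ts.
  have -> : map (cval (st.1 ++ Q) c) E = map (cval st.1 c) E by apply/eq_in_map => e' /Hc0; apply.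
  have -> : map (cval (st.1 ++ Q) c) G = map (cval st.1 c) G.
    by apply/eq_in_map => e' /HG He'; rewrite cval_cat.
  exact: S3.
rewrite -Hmap /E -map_comp.
have gate_pval m env : m < 3 -> env_ok env -> pval (st.1 ++ Q) env (size st.1 + (3 + m)) =
    opf A (nth (0, [::]) Q m).1 (map (pval (st.1 ++ Q) env) (nth (0, [::]) Q m).2).
  move=> Hm He; rewrite addnCA pval_gate //; last by rewrite size_cat ltn_add2l.
  by rewrite nth_cat ltnNge leq_addr /= addKn.
case: c Hc {Hmap Hc0} => [_|_|env He|env He|env He] /=.
- by rewrite -{1}K1.
- by rewrite -{1}K2.
- by rewrite (gate_pval 0) //= -map_comp.
- by rewrite (gate_pval 1) //= -map_comp.
- by rewrite (gate_pval 2) //= -map_comp.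
Qed.
End Semantics.

(** * Saturation reaches the closure *)

Lemma foldl_mem (X : eqType) S (I : S -> Prop) (f : S -> X -> S) l s : I s ->
  (forall s x, x \in l -> I s -> I (f s x)) -> I (foldl f s l).
Proof.
elim: l s => [|x l IH] s //= Hs H; apply: IH => [|s' x' Hx]; apply: H => //.
  by rewrite mem_head.
by rewrite in_cons Hx orbT.
Qed.

Lemma foldl_prefix (X : eqType) S (I : seq X -> S -> Prop) (f : S -> X -> S) l s :
  I [::] s -> (forall r s x, x \in l -> I r s -> I (rcons r x) (f s x)) -> I l (foldl f s l).
Proof.
move=> H0; elim/last_ind: l => [|l x IH] // HI; rewrite foldl_rcons; apply: (HI).
  by rewrite mem_rcons mem_head.
by apply: IH => r s' y Hy; apply: HI; rewrite mem_rcons in_cons Hy orbT.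
Qed.

Lemma mem_rowpairs rows rr : rr \in rowpairs rows -> rr.1 \in rows /\ rr.2 \in rows.
Proof. by case/flatten_mapP=> r1 H1 /mapP[r2 H2 ->]. Qed.

Lemma rowpairs_mem rows r1 r2 : r1 \in rows -> r2 \in rows -> (r1, r2) \in rowpairs rows.
Proof. by move=> H1 H2; apply/flatten_mapP; exists r1 => //; apply: map_f. Qed.

(** Repetitions are discounted because generators may share a key. *)
Definition nkeys (st : clstate) := size (undup (keys st.2)).
Definition closed_under (rp : seq (row * row)) (st : clstate) :=
  forall rr, rr \in rp -> ~~ fires st.2 rr.1 rr.2.

Lemma cl_step_nkeys st rr : (cl_step st rr = st /\ ~~ fires st.2 rr.1 rr.2) \/
  nkeys (cl_step st rr) = (nkeys st).+1.
Proof.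
rewrite /cl_step; case Hf: (fires _ _ _); [right | by left].
by case/and3P: Hf => _ _ Hk; rewrite /nkeys /= (negbTE Hk).
Qed.

(** The number of keys never decreases, so a single firing makes the whole pass increase it; without
    a firing the state has been tested against all pairs of rows. *)
Lemma pass_nkeys rp st : (foldl cl_step st rp = st /\ closed_under rp st) \/
  nkeys st < nkeys (foldl cl_step st rp).
Proof.
have mono r s : nkeys s <= nkeys (foldl cl_step s r).
  elim: r s => [|rr r IH] s //=; apply: leq_trans (IH _).
  by case: (cl_step_nkeys s rr) => [[->]|->].
elim: rp st => [|rr rp IH] st /=; first by left; split.
case: (cl_step_nkeys st rr) => [[-> Hf]|Hs]; last first.
  by right; apply: leq_trans (mono _ _); rewrite Hs.
case: (IH st) => [[-> Hc]|]; [left | by right].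
by split=> // r; rewrite in_cons => /orP[/eqP->|/Hc].
Qed.

Lemma cl_step_ext st rr : exists Q, (cl_step st rr).1 = st.1 ++ Q.
Proof.
rewrite /cl_step; case: ifP => _; first by eexists; reflexivity.
by exists [::]; rewrite cats0.
Qed.

Lemma cl_step_sub st rr : {subset st.2 <= (cl_step st rr).2}.
Proof. by rewrite /cl_step; case: ifP => _ e //= He; rewrite in_cons He orbT. Qed.

Lemma saturate_ext prs rp st : exists Q, (saturate prs rp st).1 = st.1 ++ Q.
Proof.
apply: (foldl_mem (I := fun s : clstate => exists Q, s.1 = st.1 ++ Q)).
  by exists [::]; rewrite cats0.
move=> s x _ Hs; apply: (foldl_mem (I := fun s : clstate => exists Q, s.1 = st.1 ++ Q)) => //.
move=> s' rr _ [Q E]; have [Q' ->] := cl_step_ext s' rr.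
by exists (Q ++ Q'); rewrite E catA.
Qed.

Lemma saturate_sub prs rp st : {subset st.2 <= (saturate prs rp st).2}.
Proof.
apply: (foldl_mem (I := fun s : clstate => {subset st.2 <= s.2})) => //.
move=> s x _ Hs; apply: (foldl_mem (I := fun s : clstate => {subset st.2 <= s.2})) => //.
by move=> s' rr _ H e /H; apply: cl_step_sub.
Qed.

Section Correct.
Variables (A : alg) (rows : seq row).
Hypotheses (okA : alg_ok A) (idA : alg_idempotent A) (rowsA : rows_for A rows).
Let n := univ_size A.
Let rp := rowpairs rows.

Notation cl_inv := (cl_inv A rows).

Lemma pass_inv G st : cl_inv G st -> cl_inv G (foldl cl_step st rp).
Proof.
move=> H; apply: (foldl_mem (I := cl_inv G)) => // s rr /mem_rowpairs[H1 H2].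
exact: cl_step_inv.
Qed.

Lemma saturate_inv G prs st : cl_inv G st -> cl_inv G (saturate prs rp st).
Proof.
by move=> H; apply: (foldl_mem (I := cl_inv G)) => // s x _; apply: pass_inv.
Qed.

Definition key_ok (e : elem) := (e.1.1 < n) && (e.1.2 < n).

Lemma cl_inv_keys G st : all key_ok G -> cl_inv G st -> {subset keys st.2 <= pairs n}.
Proof.
move=> HG [_ _ HS] k /mapP[e /HS[_ [t [Ht He]]] ->].
have HGc c : c = Key1 \/ c = Key2 -> all (fun x => x < n) (map (cval rows st.1 c) G).
  move=> Hc; rewrite all_map; apply: sub_all HG => g /andP[H1 H2] /=.
  by case: Hc => ->.
rewrite nth_pairs; have -> : e.1.1 = cval rows st.1 Key1 e by [].
have -> : e.1.2 = cval rows st.1 Key2 e by [].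
by rewrite !He //; apply/andP; split; apply: teval_lt => //;
  rewrite ?size_map //; apply: HGc; [left | right].
Qed.

(** The start has at least one key. If none of the |A|^2 passes were stationary, there would be more
    than |A|^2 keys, but all of them lie in A^2. *)
Lemma saturate_closed G st : all key_ok G -> cl_inv G st -> st.2 != [::] ->
  closed_under rp (saturate (pairs n) rp st).
Proof.
move=> HG Hst Hne.
have : closed_under rp (saturate (pairs n) rp st) \/
   size (pairs n) < nkeys (saturate (pairs n) rp st).
  apply: (foldl_prefix (I := fun r s => closed_under rp s \/ size r < nkeys s)).
    right; rewrite /nkeys /= -has_predT; apply/hasP.
    by case: (st.2) Hne => // e S _; exists e.1; rewrite // mem_undup mem_head.
  move=> r s x _ [Hc|Hs].
    left; suff -> : foldl cl_step s rp = s by [].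
    elim: (rp) Hc => [|rr l IH] //= Hc.
    rewrite {2}/cl_step (negbTE (Hc rr _)) ?mem_head //; apply: IH => r' Hr'.
    by apply: Hc; rewrite in_cons Hr' orbT.
  case: (pass_nkeys rp s) => [[-> Hc]|Hlt]; [by left | right].
  by rewrite size_rcons; apply: leq_ltn_trans Hs Hlt.
case=> //; rewrite ltnNge => /negP[]; apply: uniq_leq_size; first exact: undup_uniq.
move=> k; rewrite mem_undup.
exact: (cl_inv_keys HG (saturate_inv (pairs n) Hst)).
Qed.

Lemma closed_term G st t : all key_ok G -> {subset G <= st.2} -> closed_under rp st ->
  term_wf A (size G) t ->
  (teval A (map (fun e => e.1.1) G) t, teval A (map (fun e => e.1.2) G) t) \in keys st.2.
Proof.
move=> HG Hsub Hcl; elim/term_nested_ind: t => [i|j ts IH] /=.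
  move=> Hi; pose e0 : elem := ((0, 0), (0, (0, 0))).
  rewrite !(nth_map e0) // -surjective_pairing; apply/map_f/Hsub.
  exact: mem_nth.
case/and3P=> Hj /eqP Hs /(all_nthP (Var 0)) Hts.
set t1 := map _ ts; set t2 := map _ ts.
have HG1 : all (fun x => x < n) (map (fun e => e.1.1) G).
  by rewrite all_map; apply: sub_all HG => e /andP[].
have HG2 : all (fun x => x < n) (map (fun e => e.1.2) G).
  by rewrite all_map; apply: sub_all HG => e /andP[].
have Ht1 : t1 \in all_tuples n (arity A j).
  rewrite mem_all_tuples size_map Hs eqxx /=; apply/(all_nthP 0) => i.
  rewrite size_map => Hi; rewrite (nth_map (Var 0)) //.
  by apply: teval_lt; rewrite ?size_map //; apply: Hts.
have Ht2 : t2 \in all_tuples n (arity A j).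
  rewrite mem_all_tuples size_map Hs eqxx /=; apply/(all_nthP 0) => i.
  rewrite size_map => Hi; rewrite (nth_map (Var 0)) //.
  by apply: teval_lt; rewrite ?size_map //; apply: Hts.
pose r1 : row := (j, (t1, opf A j t1)); pose r2 : row := (j, (t2, opf A j t2)).
have Hr1 : r1 \in rows by apply/rowsA; exists j, t1.
have Hr2 : r2 \in rows by apply/rowsA; exists j, t2.
have := Hcl (r1, r2) (rowpairs_mem Hr1 Hr2); rewrite /fires /= eqxx /=.
have -> : all (fun k => k \in keys st.2) (argkeys r1 r2).
  apply/allP => k /mapP[i]; rewrite mem_iota /= add0n size_map => Hi ->.
  by rewrite !(nth_map (Var 0)) //; apply: IH => //; apply: Hts.
by rewrite negbK.
Qed.

Lemma gens_maltsev a e e0 d u w t st : has_maltsev A ->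
  a < n -> e < n -> e0 < n -> d < n -> {subset gens a e e0 d u w t <= st.2} ->
  closed_under rp st -> (a, d) \in keys st.2.
Proof.
move=> [q [Hq Hm]] Ha He He0 Hd Hsub Hcl.
have := @closed_term (gens a e e0 d u w t) st q; rewrite /= /key_ok /= Ha He He0 Hd.
have [_ ->] := Hm e0 a He0 Ha; have [-> _] := Hm e d He Hd.
by apply.
Qed.
End Correct.

(** * Invariants of the two loops *)

Section Loops.
Variables (A : alg) (rows : seq row).
Hypotheses (okA : alg_ok A) (idA : alg_idempotent A) (rowsA : rows_for A rows).
Let n := univ_size A.
Let rp := rowpairs rows.
Let pv P i x y z := pval rows P [:: x; y; z] i.

Lemma env_ok3 x y z : x < n -> y < n -> z < n -> env_ok A [:: x; y; z].
Proof. by move=> Hx Hy Hz; split=> //=; rewrite Hx Hy Hz. Qed.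

Lemma gen_by_mem P G g : g \in G -> gen_by A rows P G g.
Proof.
move=> Hg; exists (Var (index g G)); split=> [|c Hc]; first by rewrite /= index_mem.
by rewrite /= (nth_map g) ?index_mem // nth_index.
Qed.

(** [f] is the operation of the term that generates the element with key (a,d): the key coordinates
    give its two equations, the vertex coordinates the three updates. *)
Lemma in_step_spec a e0 t w (st : istate) (cd : nat * nat) :
  let P := st.1.2 in let st' := in_step (pairs n) rp rows a e0 t w st cd in
  wf_prog A P -> a < n -> e0 < n -> cd.1 < n -> cd.2 < n ->
  [/\ st.2.1 < 3 + size P, st.2.2.1 < 3 + size P & st.2.2.2 < 3 + size P] ->
  t < 3 + size P -> w < 3 + size P -> st.1.1 ->
  [/\ wf_prog A st'.1.2, exists Q, st'.1.2 = P ++ Q &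
  (~~ st'.1.1 /\ ~ has_maltsev A) \/
  (st'.1.1 /\
   [/\ st'.2.1 < 3 + size st'.1.2, st'.2.2.1 < 3 + size st'.1.2,
       st'.2.2.2 < 3 + size st'.1.2 &
    exists f : nat -> nat -> nat -> nat,
     [/\ forall x, x < n -> f x x x = x, f a e0 e0 = a,
      let e := pv P st.2.2.1 cd.1 cd.1 cd.2 in f e e cd.2 = cd.2 &
      forall x y z, x < n -> y < n -> z < n ->
       [/\ pv st'.1.2 st'.2.1 x y z = f (pv P st.2.1 x y z) (pv P st.2.2.1 x y z) (pv P t x y z),
        pv st'.1.2 st'.2.2.1 x y z =
          f (pv P st.2.2.1 x y z) (pv P st.2.2.1 x y z) (pv P t x y z) &
        pv st'.1.2 st'.2.2.2 x y z =
          f (pv P st.2.2.2 x y z) (pv P w x y z) (pv P w x y z)]]])].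
Proof.
move=> P st' wfP Ha He0 Hc Hd [HU HV HU'] Ht Hw Hok.
pose e := in_eval rows st cd.
have He : e < n by apply: (pval_lt okA rowsA _ wfP); apply: env_ok3.
pose G := gens a e e0 cd.2 st.2 w t.
have Gkeys : all (key_ok A) G by rewrite /= /key_ok /= -/n Ha He He0 Hd.
have Gidx g : g \in G -> idx_ok P g.
  by rewrite !inE => /or3P[] /eqP ->; split.
have inv0 : cl_inv A rows G (P, G).
  by split=> // g Hg; split; [exact: Gidx | exact: gen_by_mem].
have inv := saturate_inv okA rowsA (pairs n) inv0.
have Hcl := saturate_closed okA rowsA Gkeys inv0 isT.
have Hsub := @saturate_sub (pairs n) rp (P, G).
have [Q EQ] := saturate_ext (pairs n) rp (P, G).
rewrite /= in EQ; set C := saturate _ _ _ in inv Hcl Hsub EQ.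
have EC : in_clos (pairs n) rp rows a e0 t w st cd = C by [].
have Est : st' = ((st.1.1 && ((a, cd.2) \in keys C.2), C.1), find_elem C.2 (a, cd.2)).
  by rewrite /st' /in_step EC.
rewrite Est /= Hok /=; case: inv => wfC _ HC; split=> //; first by exists Q.
case Hin: ((a, cd.2) \in keys C.2); last first.
  left; split=> // HM; have := gens_maltsev okA rowsA HM Ha He He0 Hd Hsub Hcl.
  by rewrite Hin.
right; split=> //; have [[I1 I2 I3] [q [Hq Hv]]] := HC _ (find_elem_in Hin).
split=> //; exists (fun x y z => teval A [:: x; y; z] q); split.
- by move=> x Hx; apply: (teval_idem (m := 3)).
- by have := Hv Key1 I; rewrite /=.
- by have := Hv Key2 I; rewrite /=.
move=> x y z Hx Hy Hz; have Hxyz := env_ok3 Hx Hy Hz.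
have HG i : i < 3 + size P -> pval rows C.1 [:: x; y; z] i = pval rows P [:: x; y; z] i.
  by move=> Hi; rewrite EQ pval_cat.
split; [have := Hv (V1 [:: x; y; z]) Hxyz | have := Hv (V2 [:: x; y; z]) Hxyz |
  have := Hv (V3 [:: x; y; z]) Hxyz];
  by rewrite /pv /G /= ?(HG st.2.1) ?(HG st.2.2.1) ?(HG st.2.2.2) ?(HG t) ?(HG w).
Qed.

(* [T] and [W] are the vertices of [t(x,y,z)] and [t(x,y,y)]. *)
Definition out_facts (done : seq (nat * nat)) P T W :=
  [/\ wf_prog A P, T < 3 + size P, W < 3 + size P &
   [/\ forall y z, y < n -> z < n -> pv P T y y z = z,
    forall x y z, x < n -> y < n -> z < n -> pv P W x y z = pv P T x y y &
    forall a b, (a, b) \in done -> a < n -> b < n -> pv P T a b b = a]].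

(* [U], [V], [U'] are the vertices of [s(x,W,T)], [s(W,W,T)], [s(x,W,W)] for
   the term [s] built so far. *)
Definition in_facts (dab dcd : seq (nat * nat)) P W U V U' :=
  [/\ U < 3 + size P, V < 3 + size P, U' < 3 + size P &
   [/\ forall x y z, x < n -> y < n -> z < n -> pv P U' x y z = pv P U x y y,
    forall x y z, x < n -> y < n -> z < n -> pv P V x y y = pv P W x y z,
    forall c d, c < n -> d < n -> pv P U c c d = pv P V c c d,
    forall c d, (c, d) \in dcd -> c < n -> d < n -> pv P V c c d = d &
    forall a b, (a, b) \in dab -> a < n -> b < n -> pv P U a b b = a]].

Lemma out_facts_cat dab P Q T W : wf_prog A (P ++ Q) ->
  out_facts dab P T W -> out_facts dab (P ++ Q) T W.
Proof.
move=> wfPQ [wfP HT HW [H1 H2 H3]].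
have E i x y z : i < 3 + size P -> pv (P ++ Q) i x y z = pv P i x y z.
  by move=> Hi; apply: pval_cat.
split=> //; try by rewrite size_cat addnA ltn_addr.
by split=> *; rewrite !E //; [apply: H1 | apply: H2 | apply: H3].
Qed.

Lemma in_step_correct dab dcd a b e0 T W (st : istate) (cd : nat * nat) :
  a < n -> b < n -> cd.1 < n -> cd.2 < n -> st.1.1 ->
  out_facts dab st.1.2 T W -> pv st.1.2 T a b b = e0 ->
  in_facts (rcons dab (a, b)) dcd st.1.2 W st.2.1 st.2.2.1 st.2.2.2 ->
  let st' := in_step (pairs n) rp rows a e0 T W st cd in
  (~~ st'.1.1 /\ ~ has_maltsev A) \/
  [/\ st'.1.1, out_facts dab st'.1.2 T W, pv st'.1.2 T a b b = e0 &
   in_facts (rcons dab (a, b)) (rcons dcd cd) st'.1.2 W st'.2.1 st'.2.2.1 st'.2.2.2].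
Proof.
move=> Ha Hb Hc Hd Hok HO He0 [IU IV IU' [J1 J2 J3 J4 J5]] st'.
have [wfP HT HW [K1 K2 K3]] := HO; set P := st.1.2 in HO He0 IU IV IU' J1 J2 J3 J4 J5 wfP HT HW K1 K2 K3 *.
have He0n : e0 < n by rewrite -He0; apply: (pval_lt okA rowsA _ wfP); apply: env_ok3.
have [wfP' [Q EQ]] := @in_step_spec a e0 T W st cd wfP Ha He0n Hc Hd (And3 IU IV IU') HT HW Hok.
rewrite -/st' in wfP' EQ *; case=> [?|[Hok' [L1 L2 L3 [f [f1 f2 f3 Hf]]]]]; first by left.
right; rewrite EQ in wfP'.
have E i x y z : i < 3 + size P -> pv st'.1.2 i x y z = pv P i x y z.
  by move=> Hi; rewrite EQ; apply: pval_cat.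
split=> //; first by rewrite EQ; apply: out_facts_cat.
  by rewrite E.
have vlt i x y z : x < n -> y < n -> z < n -> pv P i x y z < n.
  by move=> *; apply: (pval_lt okA rowsA _ wfP); apply: env_ok3.
split=> //; split.
(* At (x,y,y) both V and T take the value of W, so the update of U becomes that of U'. *)
- move=> x y z Hx Hy Hz; have [_ _ ->] := Hf x y z Hx Hy Hz.
  have [-> _ _] := Hf x y y Hx Hy Hy.
  by rewrite (J1 x y z) // (J2 x y z) // (K2 x y z).
(* Here all three arguments of [f] are equal to the value of W. *)
- move=> x y z Hx Hy Hz; have [_ -> _] := Hf x y y Hx Hy Hy.
  by rewrite E // (J2 x y z) // -(K2 x y z) // f1 // vlt.
- move=> c d Hc' Hd'; have [-> -> _] := Hf c c d Hc' Hc' Hd'.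
  by rewrite J3.
(* The new pair is settled by f(e,e,d) = d, an earlier one by f(d,d,d) = d. *)
- move=> c d; rewrite mem_rcons in_cons => /orP[/eqP Ecd|Hcd] Hc' Hd'.
    have [_ -> _] := Hf c c d Hc' Hc' Hd'; rewrite K1 //.
    by move: f3; rewrite -Ecd.
  have [_ -> _] := Hf c c d Hc' Hc' Hd'.
  by rewrite K1 // J4 // f1.
(* The value of T at (a',b',b') is e0 for the new pair, where f(a,e0,e0) = a, and a' for an earlier
   pair, where f(a',a',a') = a'. *)
- move=> a' b' Hin Ha' Hb'; have [-> _ _] := Hf a' b' b' Ha' Hb' Hb'.
  rewrite (J5 a' b') // (J2 a' b' b') // K2 //.
  move: Hin; rewrite mem_rcons in_cons => /orP Hab'.
  by case: Hab' => [/eqP[-> ->]|Hin]; rewrite ?He0 // K3 // f1.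
Qed.

Lemma in_step_fail a e0 T W (st : istate) (cd : nat * nat) : ~~ st.1.1 ->
  ~~ (in_step (pairs n) rp rows a e0 T W st cd).1.1.
Proof. by rewrite /in_step /= => /negbTE->. Qed.

Lemma out_step_correct dab (st : ostate) (ab : nat * nat) : ab.1 < n -> ab.2 < n ->
  (~~ st.1.1 /\ ~ has_maltsev A) \/ (st.1.1 /\ out_facts dab st.1.2 st.2.1 st.2.2) ->
  let st' := out_step (pairs n) rp rows st ab in
  (~~ st'.1.1 /\ ~ has_maltsev A) \/
  (st'.1.1 /\ out_facts (rcons dab ab) st'.1.2 st'.2.1 st'.2.2).
Proof.
case: ab => a b /= Ha Hb Hst.
pose e0 := out_eval rows st (a, b); set T := st.2.1 in Hst *; set W := st.2.2 in Hst *.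
have : (~~ (inner (pairs n) rp rows st (a, b)).1.1 /\ ~ has_maltsev A) \/
  let st' := inner (pairs n) rp rows st (a, b) in
  [/\ st'.1.1, out_facts dab st'.1.2 T W, pv st'.1.2 T a b b = e0 &
   in_facts (rcons dab (a, b)) (pairs n) st'.1.2 W st'.2.1 st'.2.2.1 st'.2.2.2].
  apply: (foldl_prefix (I := fun dcd (s : istate) => (~~ s.1.1 /\ ~ has_maltsev A) \/
    [/\ s.1.1, out_facts dab s.1.2 T W, pv s.1.2 T a b b = e0 &
     in_facts (rcons dab (a, b)) dcd s.1.2 W s.2.1 s.2.2.1 s.2.2.2])).
    case: Hst => [?|[Hok HO]]; [by left | right].
    have [wfP HT HW [K1 K2 K3]] := HO; split=> //=.
    have E0 x y z : x < n -> y < n -> z < n -> pv st.1.2 0 x y z = x.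
      by move=> *; rewrite /pv pval_input.
    split=> //; split.
    - by move=> x y z *; rewrite !E0.
    - by move=> x y z Hx Hy Hz; rewrite (K2 x y y) // (K2 x y z).
    (* W takes the value t(c,c,c) = c at (c,c,d). *)
    - by move=> c d Hc Hd; rewrite E0 // K2 // K1.
    - by [].
    - by move=> a' b' _ Ha' Hb'; rewrite E0.
  move=> dcd s cd; rewrite nth_pairs => /andP[Hc Hd].
  case=> [[Hno HM]|[Hok HO He0 HI]]; first by left; split=> //; apply: in_step_fail.
  exact: in_step_correct.
case=> [?|[Hok HO He0 [IU IV IU' [J1 J2 J3 J4 J5]]]]; [by left | right].
split=> //; have [wfP HT HW [K1 K2 K3]] := HO; split=> //; split=> //.
(* U and V agree at (y,y,z), and the inner loop has treated all pairs, so V returns z there. *)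
- by move=> y z Hy Hz; rewrite /= J3 // J4 // nth_pairs Hy.
Qed.

Theorem solve_correct : let st := solve_rows n rows in
  (~~ st.1.1 /\ ~ has_maltsev A) \/
  [/\ st.1.1, wf_prog A st.1.2, st.2.1 < 3 + size st.1.2 &
   is_maltsev_fun A (fun x y z => pv st.1.2 st.2.1 x y z)].
Proof.
move=> st; suff : (~~ st.1.1 /\ ~ has_maltsev A) \/
    (st.1.1 /\ out_facts (pairs n) st.1.2 st.2.1 st.2.2).
  case=> [?|[Hok [wfP HT _ [K1 _ K3]]]]; [by left | right; split=> // x y; rewrite -/n => Hx Hy].
  by split; [apply: K1 | apply: K3 => //; rewrite nth_pairs /= Hy].
apply: (foldl_prefix (I := fun dab (s : ostate) => (~~ s.1.1 /\ ~ has_maltsev A) \/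
    (s.1.1 /\ out_facts dab s.1.2 s.2.1 s.2.2))).
  by right; split=> //; split=> //; split=> // *; rewrite /pv !pval_input.
move=> dab s ab; rewrite nth_pairs => /andP[Ha Hb]; exact: out_step_correct.
Qed.
End Loops.

(** * The Turing machine *)

Definition prog_circuit (P : seq gate) T : circuit :=
  Circ ([:: VIn 0; VIn 1; VIn 2] ++ [seq VGate g.1 g.2 | g <- P]) T.

Lemma answer_prog (st : ostate) : st.1.1 -> answer st = answer_circuit (prog_circuit st.1.2 st.2.1).
Proof.
move=> H; rewrite /answer H /answer_circuit /enc_circuit /prog_circuit; congr cons.
rewrite [size (verts _)]/= size_map addn3 [verts _]/=; congr (_ ++ (_ ++ _)).
have -> : [seq enc_gate g | g <- st.1.2] = map enc_vertex [seq VGate g.1 g.2 | g <- st.1.2].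
  by rewrite -map_comp; apply: eq_map.
by rewrite /enc_inputs -flatten_cat -map_cat.
Qed.

Lemma prog_circuit_ok A P T : wf_prog A P -> T < 3 + size P ->
  circuit_ok A 3 (prog_circuit P T).
Proof.
move=> wfP HT; rewrite /prog_circuit; split; last split.
- move=> p; rewrite [size _]/= size_map; case: p => [|[|[|p]]] // Hp.
  have Hp' : p < size P by [].
  rewrite [nth _ _ _]/= (nth_map (0, [::])) //.
  by have := wfP p Hp'.
- move=> i Hi; rewrite [verts _]/= -[X in count _ X]/([:: VIn 0; VIn 1; VIn 2] ++ _) count_cat.
  have -> : count (is_input i) [seq VGate g.1 g.2 | g <- P] = 0 by elim: (P).
  rewrite addn0.
  by case: i Hi => [|[|[|]]].
- by rewrite [size _]/= size_map.
Qed.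

Lemma prog_circuit_eval A rows P T x y z : alg_ok A -> rows_for A rows -> wf_prog A P ->
  env_ok A [:: x; y; z] ->
  circuit_eval A (prog_circuit P T) [:: x; y; z] = pval rows P [:: x; y; z] T.
Proof.
move=> okA rowsA wfP Henv; rewrite /circuit_eval /prog_circuit /pval /=.
congr nth; elim/last_ind: P wfP => [|P g IH] // /wf_prog_rcons[wfP Hg].
rewrite map_rcons foldl_rcons vals_rcons IH //; congr rcons; rewrite /=.
case/and3P: Hg => Hj /eqP Hs Ha; rewrite (lookup_opf rowsA) ?size_map //.
by apply/allP => v /mapP[i _ ->]; apply: (pval_lt okA rowsA i wfP Henv).
Qed.

Definition alg_nats (A : alg) : seq nat :=
  univ_size A :: size (ops A) :: flatten [seq enc_table (univ_size A) op | op <- ops A].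

Lemma enc_alg_nats A : enc_alg A = flatten [seq enc_nat k | k <- alg_nats A].
Proof.
rewrite /enc_alg /alg_nats /=; congr (_ ++ (_ ++ _)).
elim: (ops A) => [|op l IH] //=.
by rewrite IH map_cat flatten_cat -!catA -map_comp.
Qed.

Definition bit_sym (b : bool) := if b then One else Sep.
Definition alg_bits A : seq bool := flatten [seq rcons (nseq k true) false | k <- alg_nats A].

Lemma enc_alg_bits A : enc_alg A = map bit_sym (alg_bits A).
Proof.
rewrite enc_alg_nats /alg_bits map_flatten -map_comp; congr flatten; apply: eq_map => k /=.
by rewrite map_rcons map_nseq.
Qed.

Lemma decide_correct A : alg_ok A -> alg_idempotent A ->
  (decide (alg_bits A) = answer_no /\ ~ has_maltsev A) \/
  exists C, [/\ decide (alg_bits A) = answer_circuit C, circuit_ok A 3 C &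
    is_maltsev_fun A (fun x y z => circuit_eval A C [:: x; y; z])].
Proof.
move=> okA idA; have n0 := okA.1; have rowsA := parse_rows_for n0.
rewrite /decide /alg_bits parse_nats_enc /decide_nats /=.
set rows := parse_rows _ _ in rowsA *.
case: (solve_correct okA idA rowsA) => [[Hno HM]|[Hok wfP HT HM]].
  by left; split=> //; rewrite /answer (negbTE Hno).
right; exists (prog_circuit (solve_rows (univ_size A) rows).1.2 (solve_rows (univ_size A) rows).2.1).
split; [exact: answer_prog | exact: prog_circuit_ok |].
have E x y z : x < univ_size A -> y < univ_size A -> z < univ_size A -> env_ok A [:: x; y; z].
  by move=> Hx Hy Hz; split=> //=; rewrite Hx Hy Hz.
by move=> x y Hx Hy; rewrite !(prog_circuit_eval _ okA rowsA wfP) //; try exact: E; apply: HM.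
Qed.

(** A register, and likewise the output, ends at its first blank. *)
Lemma nonblank_answer st : nonblank (answer st).
Proof.
have N k : nonblank (enc_nat k).
  by rewrite /enc_nat nonblank_rcons; elim: k.
have NF T (f : T -> seq sym) s : (forall x, nonblank (f x)) -> nonblank (flatten (map f s)).
  by move=> H; elim: s => //= x s IH; rewrite nonblank_cat H.
rewrite /answer; case: ifP => // _; rewrite nonblank_cons !nonblank_cat !N /=.
by apply: (NF) => g; rewrite /enc_gate nonblank_cons !nonblank_cat !N /=; apply: NF.
Qed.

(** * Conversion between tape symbols and trees *)

Definition read_bits : cmd :=
  Seq (mv 0 1) (Seq (Push 0 Zero) (Loop 1 (fun x =>
    Seq (pushs 0 (ts (code (if x is One then true else false)))) (Push 0 One)))).

(** The list is built from its last bit, hence the reversal; the lone [Zero] pushed first is the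
    empty list. *)
Lemma ev_read_bits bits Z : all nonblank Z ->
  ev read_bits [:: map bit_sym bits, [::] & Z] (20 * size bits + 10)
    [:: ts (code bits), [::] & Z].
Proof.
move=> nZ; have nb b : nonblank (map bit_sym b).
  by elim: b => // [[]] b; rewrite nonblank_cons.
apply: (@ev_le _ _ ((3 * size bits + 2) + (1 + (7 * size bits + 2)))); first lia.
apply: EvSeq.
  by rewrite -(size_map bit_sym bits); apply: ev_mv => //=; rewrite nb nZ.
rewrite /= cats0; apply: EvSeq; first exact: EvPush.
rewrite /=; have H r l : ev (Loop 1 (fun x =>
    Seq (pushs 0 (ts (code (if x is One then true else false)))) (Push 0 One)))
  [:: ts (code l), map bit_sym r & Z] (7 * size r + 2) [:: ts (code (catrev r l)), [::] & Z].
  elim: r l => [|b r IH] l; first exact: EvLoop0.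
  apply: (@ev_le _ _ ((4 + 1) + (7 * size r + 2)).+2); first by rewrite /=; lia.
  apply: (@EvLoop _ _ _ (bit_sym b) (map bit_sym r)) (IH (b :: l)) => //.
  apply: EvSeq.
    apply: (@ev_le _ _ (size (ts (code b))).+1); first by case: (b).
    have -> : (if bit_sym b is One then true else false) = b by case: (b).
    by apply: ev_pushs => //; rewrite nonblank_ts.
  by apply: EvPush.
by rewrite -map_rev -(size_rev bits); have := H (rev bits) [::]; rewrite catrevE revK cats0.
Qed.

Definition write_syms : cmd :=
  Seq (Loop 0 (fun x => if x is One then
    Case 0 (fun y => if y is Zero then Push 1 Zero else
      Case 0 (fun _ => Case 0 (fun y => if y is Zero then Push 1 One else
        Case 0 (fun _ => Case 0 (fun _ => Push 1 Sep)))))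
    else Skip)) (mv 1 0).

Lemma ev_write_syms s Z : all nonblank Z -> nonblank s ->
  ev write_syms [:: ts (code s), [::] & Z] (20 * size s + 10) [:: s, [::] & Z].
Proof.
move=> nZ ns.
apply: (@ev_le _ _ ((10 * size s + 5) + (3 * size s + 2))); first lia.
rewrite /write_syms; set L := Loop _ _.
have H r l : nonblank r -> ev L [:: ts (code r), l & Z] (10 * size r + 5) [:: [::], rev r ++ l & Z].
  elim: r l => [|b r IH] l.
    move=> _; apply: (@ev_le _ _ (1 + 2).+2) => //.
    by apply: (@EvLoop _ _ _ Zero [::]) => //=; [exact: EvSkip | exact: EvLoop0].
  rewrite nonblank_cons => /andP[nb nr].
  apply: (@ev_le _ _ (6 + (10 * size r + 5)).+2); first by rewrite /=; lia.
  rewrite rev_cons cat_rcons.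
  apply: (@EvLoop _ _ _ One (ts (code b) ++ ts (code r))) (IH (b :: l) nr) => //.
  case: b nb => // _; do ?[apply: EvCase => //=]; by apply: EvPush.
apply: EvSeq; first exact: H.
have := @ev_mv 1 0 [:: [::], rev s ++ [::] & Z].
rewrite /= !cats0 revK size_rev; apply => //.
by rewrite nonblank_rev ns.
Qed.

Lemma nonblank_bits bits : nonblank (map bit_sym bits).
Proof. by elim: bits => // [[]] b; rewrite nonblank_cons. Qed.

Lemma decide_cmd : exists c K t, pb id t /\ forall bits,
  ev c (map bit_sym bits :: nseq K [::]) (t (size bits)) (decide bits :: nseq K [::]).
Proof.
have Sd := PT_size PT_decide; have [c [K [t [Ht H]]]] := PT_decide.
have [k1 Hk1] := Ht; have [k2 Hk2] := Sd.
exists (Seq read_bits (Seq c write_syms)), K.+1,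
  (fun s => (20 * s + 10) + ((4 * s + 3) ^ k1 + (20 * (4 * s + 3) ^ k2 + 10))); split.
  have P : pb id (fun s => 4 * s + 3).
    by apply: pb_add (pb_const _ _); apply: pb_mul (pb_const _ _) (pb_id _).
  have Pk k := pb_exp k P; have P1 := Pk k1; have P2 := Pk k2.
  have P0 : pb id (fun s : nat => s) by exact: pb_id.
  by pb_tac.
(* A bit takes at most 3 symbols and its list cell one more; the end of the list takes one. *)
move=> bits; have szb : (sz bits).+2 <= 4 * size bits + 3.
  elim: bits => [|b bits IH]; first by rewrite sz_nil.
  by rewrite sz_cons /=; have := sz_bool b; lia.
apply: EvSeq; first by apply: ev_read_bits; apply: nonblank_nseq.
apply: EvSeq.
  apply: (@ev_le _ _ (t bits)).
    by apply: leq_trans (Hk1 _) _; apply: leq_exp2r'.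
  by apply: (H bits K.+1).
apply: (@ev_le _ _ (20 * size (decide bits) + 10)).
  rewrite leq_add2r leq_mul2l /=; apply: leq_trans (ltnW (leq_size_sz _)) _.
  by apply: leq_trans (Hk2 _) _; apply: leq_exp2r'.
by apply: ev_write_syms; [apply: nonblank_nseq | apply: nonblank_answer].
Qed.

(** * Preparing the tape and writing a fixed answer *)

Lemma skips_init w K : nonblank w ->
  runs (skips K.+1) (mk [::] w) (size w + K + 2) tt
    (mk (rev (jn (w :: nseq K [::]))) [::]).
Proof.
move=> nw; have H k L : runs (skips k) (mk L [::]) k.+1 tt (mk (rev (jn (nseq k [::])) ++ L) [::]).
  elim: k L => [|k IH] L; first exact: ret_runs.
  rewrite -[k.+2]add1n; apply: bind_runs; first exact: (@skip1_runs [::] L [::]).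
  rewrite -[nseq k.+1 _]/([::] :: nseq k [::]) jn_cons cat0s rev_cons cat_rcons.
  exact: IH.
apply: (@runs_le _ _ _ ((size w).+1 + K.+1)); first lia.
rewrite jn_cons rev_cat rev_cons cat_rcons; apply: (@bind_runs _ _ _ _ _ _ _ tt) (H K _).
by have := @skip1_runs w [::] [::] nw erefl; rewrite !cats0.
Qed.

(** The scratch registers are unwritten cells at first; walking over them turns their blanks into
    explicit cells, as [homed] requires. *)
Definition setup K : frag unit := do _ <- skips K; do _ <- goL; do _ <- backs K; goR.

Lemma setup_runs w K : nonblank w -> exists tp,
  runs (setup K.+1) (mk [::] w) (10 * (size w + K + 2)) tt tp /\
  homed tp (w :: nseq K [::]) [:: Blank].
Proof.
move=> nw; set s := w :: nseq K [::].
have ns : all nonblank s by rewrite /= nw nonblank_nseq.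
have sK : size s = K.+1 by rewrite /= size_nseq.
have sj : size (jn s) = size w + K + 1.
  by rewrite size_jn_cons size_jn_nseq; lia.
exists (mk (nseq 1 Blank) (jn s ++ [:: Blank])); split; last by exists 1.
apply: (@runs_le _ _ _ ((size w + K + 2) + (1 + ((size (jn s)).*2.+1 + 1)))).
  by rewrite sj; lia.
apply: bind_runs; first exact: skips_init.
apply: bind_runs; first exact: goL_runs.
apply: bind_runs.
  by rewrite -[rev _]cats0 -sK; apply: backs_runs.
exact: goR_runs.
Qed.

(** Writes from right to left, after a blank that cuts off the input remaining on the right. *)
Fixpoint puts (s : seq sym) : frag unit :=
  if s is x :: s' then do _ <- puts s'; do _ <- goL; put x Stay else put Blank Stay.

Lemma puts_runs s L b R :
  runs (puts s) (mk L (b :: R)) (2 * size s + 1) tt (mk (drop (size s) L) (s ++ Blank :: R)).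
Proof.
elim: s => [|x s IH]; first by rewrite drop0; apply: prim_mk.
apply: (@runs_le _ _ _ ((2 * size s + 1) + (1 + 1))); first by rewrite /=; lia.
apply: bind_runs IH _; apply: bind_runs; first exact: goL_runs.
have -> : head Blank (s ++ Blank :: R) :: behead (s ++ Blank :: R) = s ++ Blank :: R.
  by case: (s).
have -> : drop (size (x :: s)) L = behead (drop (size s) L).
  by rewrite -drop1 drop_drop add1n.
exact: prim_mk.
Qed.

(* An algebra on one element is recognized from its first two symbols, since
   the length of its code is not bounded in terms of its size. *)
Definition is_trivial : frag bool :=
  do _ <- goR; do a <- prim (fun a => (a, a, Stay));
  if a is Sep then ret true else do _ <- goL; ret false.

Lemma is_trivial_true w : runs is_trivial (mk [::] [:: One, Sep & w]) 3 true (mk [:: One] (Sep :: w)).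
Proof.
rewrite -[3]/(1 + (1 + 1)); apply: bind_runs; first exact: goR_runs.
apply: (@bind_runs _ _ _ _ _ _ _ Sep); first exact: prim_mk.
exact: ret_runs.
Qed.

Lemma is_trivial_false w : runs is_trivial (mk [::] [:: One, One & w]) 4 false (mk [::] [:: One, One & w]).
Proof.
rewrite -[4]/(1 + (1 + (1 + 1))); apply: bind_runs; first exact: goR_runs.
apply: (@bind_runs _ _ _ _ _ _ _ One); first exact: prim_mk.
apply: bind_runs; first exact: goL_runs.
exact: ret_runs.
Qed.

Section Machine.
Variable F : frag unit.
Definition machine_delta (q : fstate F + unit) (a : sym) : (fstate F + unit) * sym * move :=
  match q with inl q => fdelta q a | inr _ => (inr tt, a, Stay) end.
Definition machine : TM :=
  @MkTM (fstate F + unit)%type (inl (fstart F)) (fun q => if q is inr _ then true else false)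
    machine_delta.

Definition mconf (q : fstate F + unit) (tp : tape) : config machine :=
  (q, tp.1.1, tp.1.2, tp.2).

Lemma machine_run tp n tp' : runs F tp n tt tp' -> exists2 t, t <= n &
  run t (mconf (inl (fstart F)) tp) = mconf (inr tt) tp'.
Proof.
rewrite /runs; move: (fstart F) => q H.
have stepE q0 t r b mv : fdelta q0 t.1.2 = (r, b, mv) ->
    step (mconf (inl q0) t) = mconf r (tape_step b mv t).
  case: t => [[l a] r'] /= ->.
  by case: mv => //; [case: l | case: r'].
elim: H => {q tp n tp'} [q tp n [] b mv H|q tp n [] tp' q' b mv H _ [t le IH]].
  by exists 1 => //; apply: stepE H.
exists t.+1 => //; rewrite /run iterSr (stepE _ _ _ _ _ H); exact: IH.
Qed.
End Machine.

Lemma init_mk F w : init (machine F) w = mconf (inl (fstart F)) (mk [::] w).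
Proof. by case: w. Qed.

Lemma output_mk F L s R : nonblank s ->
  output (mconf (F := F) (inr tt) (mk L (s ++ Blank :: R))) = s.
Proof.
move=> ns; have -> : output (mconf (F := F) (inr tt) (mk L (s ++ Blank :: R))) =
    upto_blank (s ++ Blank :: R) by case: (s).
elim: s ns => // a s IH; rewrite nonblank_cons => /andP[na /IH] /=.
by case: a na => // _ ->.
Qed.

(** * Length of the input against the size of the algebra *)

Lemma size_all_tuples n k : size (all_tuples n k) = n ^ k.
Proof.
elim: k => //= k IH; rewrite size_flatten /shape -map_comp expnS.
have H (l : seq nat) : sumn [seq size [seq i :: t | t <- all_tuples n k] | i <- l] = size l * n ^ k.
  by elim: l => //= i l ->; rewrite size_map IH mulSn.
by rewrite H size_iota.
Qed.

Definition code_len (l : seq nat) := sumn [seq k.+1 | k <- l].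

Lemma code_len_cat l1 l2 : code_len (l1 ++ l2) = code_len l1 + code_len l2.
Proof. by rewrite /code_len map_cat sumn_cat. Qed.

Lemma size_alg_bits A : size (alg_bits A) = code_len (alg_nats A).
Proof.
rewrite /alg_bits; elim: (alg_nats A) => //= k l IH.
by rewrite size_cat IH size_rcons size_nseq.
Qed.

Lemma alg_size_ge A : alg_ok A -> univ_size A <= alg_size A /\ size (ops A) <= alg_size A.
Proof.
move=> [n0 [ops0 H]]; rewrite /alg_size.
have {}H j : j < size (ops A) -> 0 < (nth op_default (ops A) j).1 by move=> /H[].
case: (ops A) ops0 H => // op l _ H; split.
  rewrite /= (leq_trans _ (leq_addr _ _)) //.
  by rewrite -{1}[univ_size A]expn1; apply: leq_pexp2l => //; apply: (H 0).
by elim: (op :: l) => //= o l' IH; rewrite -add1n leq_add // expn_gt0 n0.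
Qed.

(** For |A| > 1 an arity k is less than |A|^k, so its unary code has at most |A|^k symbols; each of
    the |A|^k values takes at most |A| symbols. *)
Lemma alg_bits_le A : alg_ok A -> 1 < univ_size A -> size (alg_bits A) <= (alg_size A).+2 ^ 2.
Proof.
move=> okA n1; have [le1 le2] := alg_size_ge okA; case: okA => n0 [_ H].
rewrite size_alg_bits /alg_nats /code_len /= -/(code_len _).
suff : code_len (flatten [seq enc_table (univ_size A) op | op <- ops A]) <=
    alg_size A * (univ_size A).+1.
  have : alg_size A * (univ_size A).+1 <= alg_size A * (alg_size A).+1 by rewrite leq_mul.
  by rewrite -mulnn; lia.
have {}H : forall j, j < size (ops A) -> forall t,
    t \in all_tuples (univ_size A) (nth op_default (ops A) j).1 ->
    (nth op_default (ops A) j).2 t < univ_size A.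
  by move=> j /H[_]; apply.
rewrite /alg_size; elim: (ops A) H => //= op l IH H.
rewrite -cat_cons code_len_cat mulnDl leq_add //; last by apply: IH => j; apply: (H j.+1).
rewrite /enc_table /code_len /= mulnS leq_add //; first exact: ltn_expl.
rewrite -(size_all_tuples (univ_size A) op.1).
have {}H t : t \in all_tuples (univ_size A) op.1 -> op.2 t < univ_size A by apply: (H 0).
elim: (all_tuples _ _) H => //= t s IHs H; rewrite mulSn leq_add //.
  by apply: H; rewrite mem_head.
by apply: IHs => t' Ht'; apply: H; rewrite in_cons Ht' orbT.
Qed.

Theorem theorem4p1 :
  exists (M : TM) (c k : nat),
    forall A : alg, alg_ok A -> alg_idempotent A ->
      exists t : nat,
        t <= c * alg_size A ^ k + c /\
        halted (run t (init M (enc_alg A))) /\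
        ((output (run t (init M (enc_alg A))) = answer_no /\ ~ has_maltsev A)
         \/
         (exists C : circuit,
            output (run t (init M (enc_alg A))) = answer_circuit C /\
            circuit_ok A 3 C /\
            is_maltsev_fun A (fun x y z => circuit_eval A C [:: x; y; z]))).
Proof.
have [cmd0 [K [t0 [Ht0 Hcmd]]]] := decide_cmd.
(* On one element every operation is Maltsev, so the circuit whose output is its first input will
   do. *)
pose s0 := answer_circuit (prog_circuit [::] 0).
pose F : frag unit := do b <- is_trivial;
  if b then puts s0 else do _ <- setup K.+1; compile cmd0.
(* The summands are the test for a one-element universe, the preparation of the tape, and the
   simulation with [B] equal to w + K + 1 + t0 w. *)
pose T w := 4 + (10 * (w + K + 2) + t0 w * (10 * (w + K + 1 + t0 w).+1)).
have [k Hk] : pb id T.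
  have P0 : pb id (fun w : nat => w) by exact: pb_id.
  apply: (@pb_le _ _ (fun w => 4 + (10 * (w + K + 2) + t0 w * (10 * (w + K + 1 + t0 w + 1))))).
    by move=> w; rewrite /T; lia.
  by pb_tac.
(* With N the size of the algebra and more than one element, the input length plus 2 is at most (N +
   2)^3, and N + 2 <= 3 * N. The summand with [s0] pays for the one-element case. *)
exists (machine F), (3 ^ (3 * k) + (2 * size s0 + 10)), (3 * k) => A okA idA.
have [le1 _] := alg_size_ge okA; have n0 := okA.1.
rewrite init_mk; have [n1|n2] : univ_size A = 1 \/ 1 < univ_size A by lia.
  have [w Ew] : exists w, enc_alg A = [:: One, Sep & w] by rewrite /enc_alg n1 /=; eexists.
  have [t Ht Et] : exists2 t, t <= 3 + (2 * size s0 + 1) &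
      run t (mconf (inl (fstart F)) (mk [::] (enc_alg A))) =
      mconf (inr tt) (mk (drop (size s0) [:: One]) (s0 ++ Blank :: w)).
    apply: machine_run; rewrite Ew; apply: (bind_runs (is_trivial_true w)).
    exact: puts_runs.
  exists t; split; first by rewrite mulnDl; lia.
  rewrite Et; split=> //; right; exists (prog_circuit [::] 0); split.
    by rewrite output_mk.
  split; first by apply: prog_circuit_ok.
  by move=> x y; rewrite n1; case: x y => [|x] [|y].
have nw : nonblank (enc_alg A) by rewrite enc_alg_bits; apply: nonblank_bits.
have [w Ew] : exists w, enc_alg A = [:: One, One & w].
  by rewrite /enc_alg; case: (univ_size A) n2 => [|[|n]] //= _; eexists.
have sw : size (enc_alg A) = size (alg_bits A) by rewrite enc_alg_bits size_map.
have [tp1 [r1 hm1]] := setup_runs K nw.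
have nb1 : all nonblank (enc_alg A :: nseq K [::]) by rewrite /= nw nonblank_nseq.
have := Hcmd (alg_bits A); rewrite -enc_alg_bits => ev1.
have [|tp2 [r2 [p Etp2]]] := compile_sim (B := size (alg_bits A) + K + 1 + t0 (size (alg_bits A)))
   ev1 nb1 hm1.
  by rewrite size_jn_cons size_jn_nseq sw; lia.
have [t Ht Et] : exists2 t, t <= T (size (alg_bits A)) &
    run t (mconf (inl (fstart F)) (mk [::] (enc_alg A))) = mconf (inr tt) tp2.
  apply: machine_run; rewrite {1}Ew; apply: (bind_runs (is_trivial_false w)).
  by rewrite -Ew -sw; apply: bind_runs r1 _; rewrite sw.
exists t; split.
  have leT : T (size (alg_bits A)) <= (alg_size A).+2 ^ (3 * k).
    apply: leq_trans (Hk _) _; rewrite expnM; apply: leq_exp2r'.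
    have := alg_bits_le okA n2; set N := alg_size A => le.
    have q4 : 2 ^ 2 <= N.+2 ^ 2 by apply: leq_exp2r'.
    by rewrite expnS; move: (N.+2 ^ 2) q4 le => q q4 le; nia.
  apply: leq_trans Ht (leq_trans leT _).
  apply: leq_trans (_ : (3 * alg_size A) ^ (3 * k) <= _); first by apply: leq_exp2r'; lia.
  by rewrite expnMn mulnDl; lia.
rewrite Et; split=> //.
have -> : output (mconf (F := F) (inr tt) tp2) = decide (alg_bits A).
  by rewrite Etp2 jn_cons -catA output_mk //; apply: nonblank_answer.
case: (decide_correct okA idA) => [[-> HM]|[C [-> HC1 HC2]]]; [by left | right].
by exists C.
Qed.
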